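(* Let $\Omega_0,\Omega_1$ be Polish spaces with Borel $\sigma$-algebras $\Sigma_0,\Sigma_1$, let $\mathcal E\subseteq\Omega_0\times\Omega_1$ be closed with all neighborhoods $N_1(x)$ ($x\in\Omega_0$) and $N_0(y)$ ($y\in\Omega_1$) nonempty, and let $\nu_0,\nu_1$ be finite nonzero measures on $\Omega_0,\Omega_1$. (1) Let $\iota\in\{0,1\}$ and $\bar\iota=1-\iota$. If $\pi_\iota\in\Pi^{\mathcal E}_\iota$ is level-optimal maximin from side $\iota$ to side $\bar\iota$ and $\pi_{\bar\iota}\in\Pi^{\mathcal E}_{\bar\iota}$ is a proportional response to $\pi_\iota$, then $(\pi_\iota,\pi_{\bar\iota})$ is a universal closest refinement pair, i.e. for every divergence $\mathsf D$ satisfying channel-DPI, $$\mathsf D(\pi_\iota\|\pi_{\bar\iota})=\inf\{\mathsf D(\rho_\iota\|\rho_{\bar\iota}):(\rho_\iota,\rho_{\bar\iota})\in\Pi^{\mathcal E}_\iota\times\Pi^{\mathcal E}_{\bar\iota}\}.$$ (2) Conversely, if $(\pi_\iota,\pi_{\bar\iota})\in\Pi^{\mathcal E}_\iota\times\Pi^{\mathcal E}_{\bar\iota}$ is a universal closest refinement pair, then $\pi_\iota$ is level-optimal maximin from side $\iota$ to side $\bar\iota$, $\pi_{\bar\iota}$ is level-optimal maximin from side $\bar\iota$ to side $\iota$, $\pi_{\bar\iota}$ is a proportional response to $\pi_\iota$, and $\pi_\iota$ is a proportional response to $\pi_{\bar\iota}$.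
   Context: Notation. $\bar\iota=1-\iota$. $\mathcal M_+(\Omega)$ is the set of finite nonnegative measures on a measurable space $\Omega$; $T_\#$ denotes pushforward; $\mathrm{pr}_\iota$ is the projection of $\Omega_0\times\Omega_1$ to $\Omega_\iota$. $N_1(x)=\{y\in\Omega_1:(x,y)\in\mathcal E\}$, $N_0(y)=\{x\in\Omega_0:(x,y)\in\mathcal E\}$. Refinements. $\Pi^{\mathcal E}_\iota=\{\pi\in\mathcal M_+(\Omega_0\times\Omega_1):\pi(\mathcal E^c)=0,\ (\mathrm{pr}_\iota)_\#\pi=\nu_\iota\}$. Level-optimal maximin. For $\pi\in\Pi^{\mathcal E}_\iota$ let $P=(\mathrm{pr}_{\bar\iota})_\#\pi=r\,\nu_{\bar\iota}+P^\perp$ be the Lebesgue decomposition with respect to $\nu_{\bar\iota}$. For $t\ge0$ let $\mathsf{Feas}_{\bar\iota}(t)$ be the set of $\sigma\in\mathcal M_+(\Omega_0\times\Omega_1)$ with $\sigma(\mathcal E^c)=0$, $(\mathrm{pr}_\iota)_\#\sigma\le\nu_\iota$, $(\mathrm{pr}_{\bar\iota})_\#\sigma\le t\,\nu_{\bar\iota}$, and $\mathsf{Fit}_{\bar\iota}(t)=\sup\{\sigma(\Omega_0\times\Omega_1):\sigma\in\mathsf{Feas}_{\bar\iota}(t)\}$. $\pi$ is level-optimal maximin (from side $\iota$ to side $\bar\iota$) if $\int (r\wedge t)\,d\nu_{\bar\iota}=\mathsf{Fit}_{\bar\iota}(t)$ for every $t>0$. Kernel product. For $\eta\in\mathcal M_+(\Omega_{\bar\iota})$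 and a kernel $K:\Omega_{\bar\iota}\times\Sigma_\iota\to[0,\infty)$, $\eta\bowtie K$ is the measure on $\Omega_0\times\Omega_1$ assigning $\int_B K(y,A)\,\eta(dy)$ to the set of pairs whose $\iota$-coordinate is in $A$ and whose $\bar\iota$-coordinate is in $B$. Proportional response. Let $\pi\in\Pi^{\mathcal E}_\iota$, $P=(\mathrm{pr}_{\bar\iota})_\#\pi$, and let $K^{(\pi)}$ be a disintegration kernel, $\pi=P\bowtie K^{(\pi)}$ ($P$-a.e. unique). Let $\nu_{\bar\iota}=(\nu_{\bar\iota})_{\mathrm{ac}}+(\nu_{\bar\iota})_\perp$ be the Lebesgue decomposition of $\nu_{\bar\iota}$ with respect to $P$. A proportional response to $\pi$ is any measure of the form $(\nu_{\bar\iota})_{\mathrm{ac}}\bowtie K^{(\pi)}+(\nu_{\bar\iota})_\perp\bowtie K^{\mathrm{fb}}$, where $K^{\mathrm{fb}}:\Omega_{\bar\iota}\times\Sigma_\iota\to[0,1]$ is a measurable probability kernel with $K^{\mathrm{fb}}(y,\cdot)$ carried by $N_\iota(y)$ for $(\nu_{\bar\iota})_\perp$-a.e. $y$. Such a measure belongs to $\Pi^{\mathcal E}_{\bar\iota}$. Divergences. A divergence $\mathsf D$ is a family of maps $\mathsf D_{(\Omega,\Sigma)}:\mathcal M_+(\Omega)\times\mathcal M_+(\Omega)\to\mathbb R\cup\{\pm\infty\}$ indexed by measurable spaces. It satisfies channel-DPI if for all measurable spaces $\Omega,\Omega'$, every Markov kernel $K$ from $\Omega$ to $\Omega'$ and all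 $P,Q\in\mathcal M_+(\Omega)$, $\mathsf D(K_\#P\|K_\#Q)\le\mathsf D(P\|Q)$, where $(K_\#P)(B)=\int K(x,B)\,P(dx)$. Universal closest refinement pair: a pair $(\pi_\iota,\pi_{\bar\iota})\in\Pi^{\mathcal E}_\iota\times\Pi^{\mathcal E}_{\bar\iota}$ attaining $\inf\{\mathsf D(\rho_\iota\|\rho_{\bar\iota}):(\rho_\iota,\rho_{\bar\iota})\in\Pi^{\mathcal E}_\iota\times\Pi^{\mathcal E}_{\bar\iota}\}$ simultaneously for every divergence $\mathsf D$ satisfying channel-DPI. *)

(* Defs.v *)
From HB Require Import structures.
From mathcomp Require Import all_boot all_order all_algebra.
From mathcomp Require Import all_classical all_reals all_analysis.

Set Implicit Arguments.
Unset Strict Implicit.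
Unset Printing Implicit Defensive.

Import Order.TTheory GRing.Theory Num.Theory.
Import numFieldNormedType.Exports.

Local Open Scope classical_set_scope.
Local Open Scope ring_scope.
Local Open Scope ereal_scope.

Definition separable (T : topologicalType) : Prop :=
  exists2 D : set T, countable D & dense D.

Definition completely_metrizable (R : realType) (T : topologicalType) : Prop :=
  exists (M : metricType R) (f : T -> M) (g : M -> T),
    [/\ cancel f g, cancel g f, continuous f, continuous g &
        forall F : set_system M, ProperFilter F -> cauchy F ->
          exists l : M, F --> l].

Definition polish (R : realType) (T : topologicalType) : Prop :=
  separable T /\ completely_metrizable R T.

Notation borel T := (g_sigma_algebraType (@open T)).

(* The two sides 0 and 1 are indexed by [false] and [true], so that the side
   opposite to [i] is [~~ i]; a pair of spaces is a family over [bool].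
   The spaces are pointed because library measurable types are; they carry
   nonzero measures, hence are nonempty anyway. *)
Notation prodsp Om := (borel (Om false) * borel (Om true))%type.

Definition pr (Om : bool -> ptopologicalType) (i : bool) :
    prodsp Om -> borel (Om i) :=
  match i with false => fst | true => snd end.

Definition pair_at (Om : bool -> ptopologicalType) (i : bool) :
    Om i -> Om (~~ i) -> Om false * Om true :=
  match i with false => fun x y => (x, y) | true => fun y x => (x, y) end.

Definition nbr (Om : bool -> ptopologicalType) (E : set (Om false * Om true))
    (i : bool) (y : Om (~~ i)) : set (Om i) :=
  [set x | E (pair_at x y)].

Section marginal.
Context (R : realType) (Om : bool -> ptopologicalType).

Lemma measurable_pr i : measurable_fun [set: prodsp Om] (@pr Om i).
Proof. by case: i; [exact: measurable_snd | exact: measurable_fst]. Qed.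

Definition marginal i (pi : {finite_measure set (prodsp Om) -> \bar R}) :
  set (borel (Om i)) -> \bar R := pushforward pi (@pr Om i).
Arguments marginal : clear implicits.

Variables (i : bool) (pi : {finite_measure set (prodsp Om) -> \bar R}).

Let mpr (A : set (borel (Om i))) :
  measurable A -> measurable (@pr Om i @^-1` A).
Proof. by move=> mA; rewrite -[X in measurable X]setTI; exact: measurable_pr. Qed.

Let marginal0 : marginal i pi set0 = 0.
Proof. by rewrite /marginal /pushforward preimage_set0 measure0. Qed.

Let marginal_ge0 A : 0 <= marginal i pi A.
Proof. by rewrite /marginal /pushforward. Qed.

Let marginal_sigma_additive : semi_sigma_additive (marginal i pi).
Proof.
move=> F mF tF mUF; rewrite /marginal /pushforward preimage_bigcup.
apply: measure_semi_sigma_additive.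
- by move=> n; exact: mpr.
- apply/trivIsetP => /= a b _ _ ab; rewrite -preimage_setI.
  by move/trivIsetP : tF => /(_ _ _ _ _ ab) -> //; rewrite preimage_set0.
- by rewrite -preimage_bigcup; exact: mpr.
Qed.

HB.instance Definition _ := isMeasure.Build _ _ R (marginal i pi)
  marginal0 marginal_ge0 marginal_sigma_additive.

Let marginal_fin : fin_num_fun (marginal i pi).
Proof. by move=> A mA; apply: fin_num_measure; exact: mpr. Qed.

HB.instance Definition _ :=
  Measure_isFinite.Build _ _ R (marginal i pi) marginal_fin.

End marginal.
Arguments marginal {R Om} i pi.

Definition refinement (R : realType) (Om : bool -> ptopologicalType)
    (E : set (Om false * Om true))
    (nu : forall b, {finite_measure set (borel (Om b)) -> \bar R}) (i : bool) :
    set {finite_measure set (prodsp Om) -> \bar R} :=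
  [set pi : {finite_measure set (prodsp Om) -> \bar R} |
    pi (~` E) = 0 /\ forall A, measurable A -> marginal i pi A = nu i A].

Section lebesgue_decomposition.
Context d (T : measurableType d) (R : realType).
Implicit Types mu nu muac mus : {finite_measure set T -> \bar R}.

Definition mutually_singular mu nu : Prop :=
  exists2 N, measurable N & mu N = 0 /\ nu (~` N) = 0.

Definition lebesgue_decomposition mu nu muac mus : Prop :=
  [/\ forall A, measurable A -> mu A = muac A + mus A,
      muac `<< nu & mutually_singular mus nu].

Definition lebesgue_density mu nu (r : T -> R) : Prop :=
  [/\ forall x, (0 <= r x)%R, measurable_fun setT r &
      exists2 mus, mutually_singular mus nu &
        forall A, measurable A ->
          mu A = \int[nu]_(x in A) (r x)%:E + mus A].

End lebesgue_decomposition.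

Section level_optimal.
Context (R : realType) (Om : bool -> ptopologicalType).
Variables (E : set (Om false * Om true))
  (nu : forall b, {finite_measure set (borel (Om b)) -> \bar R}).

Definition Feas (i : bool) (t : R) :
    set {finite_measure set (prodsp Om) -> \bar R} :=
  [set sigma : {finite_measure set (prodsp Om) -> \bar R} |
    [/\ sigma (~` E) = 0,
     forall A, measurable A -> marginal i sigma A <= nu i A &
     forall B, measurable B ->
       marginal (~~ i) sigma B <= t%:E * nu (~~ i) B]].

Definition Fit (i : bool) (t : R) : \bar R :=
  ereal_sup [set sigma [set: prodsp Om] | sigma in Feas i t].

Definition level_optimal_maximin (i : bool)
    (pi : {finite_measure set (prodsp Om) -> \bar R}) : Prop :=
  exists2 r : borel (Om (~~ i)) -> R,
    lebesgue_density (marginal (~~ i) pi) (nu (~~ i)) r &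
    forall t : R, (0 < t)%R ->
      \int[nu (~~ i)]_y (Num.min (r y) t)%:E = Fit i t.

End level_optimal.

Section proportional_response.
Context (R : realType) (Om : bool -> ptopologicalType).

Definition is_kernel_product (i : bool)
    (eta : {finite_measure set (borel (Om (~~ i))) -> \bar R})
    (K : R.-ftker borel (Om (~~ i)) ~> borel (Om i))
    (mu : {finite_measure set (prodsp Om) -> \bar R}) : Prop :=
  forall A B, measurable A -> measurable B ->
    mu (@pr Om i @^-1` A `&` @pr Om (~~ i) @^-1` B) = \int[eta]_(y in B) K y A.

Definition proportional_response (E : set (Om false * Om true))
    (nu : forall b, {finite_measure set (borel (Om b)) -> \bar R}) (i : bool)
    (pi rho : {finite_measure set (prodsp Om) -> \bar R}) : Prop :=
  exists (K : R.-ftker borel (Om (~~ i)) ~> borel (Om i))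
    (Kfb : R.-pker borel (Om (~~ i)) ~> borel (Om i))
    (nuac nus : {finite_measure set (borel (Om (~~ i))) -> \bar R})
    (rhoac rhos : {finite_measure set (prodsp Om) -> \bar R}),
  [/\ is_kernel_product (marginal (~~ i) pi) K pi,
      lebesgue_decomposition (nu (~~ i)) (marginal (~~ i) pi) nuac nus,
      {ae nus, forall y, Kfb y (~` nbr E y) = 0},
      is_kernel_product nuac K rhoac /\ is_kernel_product nus Kfb rhos &
      forall C, measurable C -> rho C = rhoac C + rhos C].

End proportional_response.

Definition divergence (R : realType) : Type :=
  forall d (T : measurableType d),
    {finite_measure set T -> \bar R} -> {finite_measure set T -> \bar R} ->
    \bar R.

Definition is_kernel_pushforward d d' (X : measurableType d)
    (Y : measurableType d') (R : realType) (K : R.-pker X ~> Y)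
    (P : {finite_measure set X -> \bar R})
    (KP : {finite_measure set Y -> \bar R}) : Prop :=
  forall B, measurable B -> KP B = \int[P]_x K x B.

(* Library measures also take (irrelevant) values on nonmeasurable sets.  The
   pushforward is therefore a relation that only constrains measurable sets:
   with K the identity kernel, the inequality then forces D to depend only on
   the values of its arguments on measurable sets. *)
Definition channel_DPI (R : realType) (D : divergence R) : Prop :=
  forall d d' (X : measurableType d) (Y : measurableType d')
    (K : R.-pker X ~> Y) (P Q : {finite_measure set X -> \bar R})
    (KP KQ : {finite_measure set Y -> \bar R}),
  is_kernel_pushforward K P KP -> is_kernel_pushforward K Q KQ ->
  D _ _ KP KQ <= D _ _ P Q.

Definition universal_closest (R : realType) (Om : bool -> ptopologicalType)
    (E : set (Om false * Om true))
    (nu : forall b, {finite_measure set (borel (Om b)) -> \bar R}) (i : bool)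
    (pi rho : {finite_measure set (prodsp Om) -> \bar R}) : Prop :=
  [/\ refinement E nu i pi, refinement E nu (~~ i) rho &
      forall D : divergence R, channel_DPI D ->
        D _ _ pi rho =
        ereal_inf [set D _ _ p.1 p.2 |
                   p in refinement E nu i `*` refinement E nu (~~ i)]].

(* Main.v *)
Require Import Defs.
From HB Require Import structures.
From mathcomp Require Import all_boot all_order all_algebra.
From mathcomp Require Import all_classical all_reals all_analysis.
From mathcomp Require Import measurable_realfun ring lra.

Set Implicit Arguments.
Unset Strict Implicit.
Unset Printing Implicit Defensive.

Import Order.TTheory GRing.Theory Num.Theory.
Import numFieldNormedType.Exports.

Local Open Scope classical_set_scope.
Local Open Scope ring_scope.
Local Open Scope ereal_scope.

(* For finite measures P, Q and t > 0 let H_t(P, Q) = inf_A (P A + t Q (~` A)),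
   the mass of the largest measure below P and t Q; - H_t is a divergence
   satisfying channel-DPI. Write P for the far marginal of pi. A level-optimal
   pi has H_t(P, nu) = Fit t, while H_t(alpha, beta) <= Fit t for every pair of
   refinements. By the comparison theorem of Blackwell, these inequalities for
   all t yield a kernel carrying (alpha, beta) to (P, nu), and a proportional
   response is precisely a kernel carrying (P, nu) to (pi, rho).
   Blackwell's theorem is obtained for finite partitions of the target by a
   separation argument (the hockey-stick inequalities say that one likelihood
   ratio dominates the other in convex order), then by taking the limit of the
   tests along an ultrafilter.
   Conversely, testing universality against - H_t gives
   H_t(pi, rho) = H_t(P, nu) = Fit t, since any feasible measure extends to a
   refinement. Equality for all t makes the far coordinate sufficient for
   (pi, rho), so that a single kernel disintegrates both. *)

(** * Finite measures and likelihood ratios *)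

(** Likelihood ratios are densities with respect to the sum of the two measures compared: they live
    in [0,1], singular parts need no separate case, and the threshold t > 0 between two measures
    becomes the level u = t / (1 + t) of the ratio. They are handled through inequalities on level
    sets, which survive pull-back, weighting and limits, and which determine the measure. In
    Blackwell's theorem the set of values attainable by tests is not known to be closed, so a finite
    partition is matched only up to an error. Exactness returns in the limit, which must exist for
    the integrals over all measurable sets simultaneously; this is why an ultrafilter replaces a
    subsequence. Kernels into a Polish space are built on the real line, from distribution functions
    at a dense sequence of thresholds, and carried back by a measurable coding of the space in
    [0,1]. The same device yields disintegrations. *)

Section finite_measures.
Context d (T : measurableType d) (R : realType).
Implicit Types (mu eta P Q lam : {finite_measure set T -> \bar R}).

(** Measures are produced existentially with a pointwise equation, so later constructions rely on
    that equation alone and not on a canonical instance. *)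
Lemma ex_fmeasure (m : set T -> \bar R) :
  m set0 = 0 -> (forall A, 0 <= m A) -> semi_sigma_additive m ->
  m setT < +oo ->
  exists mu, forall A, mu A = m A.
Proof.
move=> m0 mge0 msa mT.
have [M HM] : exists M : {measure set T -> \bar R}, forall A, M A = m A.
  pose mixin := isMeasure.Build d T R m m0 mge0 msa.
  by exists (HB.pack_for {measure set T -> \bar R} m mixin).
have MT : M setT < +oo by rewrite HM.
exists (mfrestr measurableT MT : {finite_measure set T -> \bar R}) => A.
by rewrite -HM -[in RHS](setIT A).
Qed.

Lemma fmeasure_lty mu A : measurable A -> mu A < +oo.
Proof. by move=> mA; rewrite ltey_eq fin_num_measure. Qed.

Lemma ex_add_measure P Q : exists mu, forall A, mu A = P A + Q A.
Proof.
have [||||mu Hmu] := @ex_fmeasure (measure_add P Q) => //.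
- exact: measure_semi_sigma_additive.
- by rewrite measure_addE lte_add_pinfty// fmeasure_lty.
by exists mu => A; rewrite Hmu measure_addE.
Qed.

Lemma ex_density_measure mu (g : T -> \bar R) :
  measurable_fun setT g -> (forall x, 0 <= g x) -> \int[mu]_x g x < +oo ->
  exists nu : {finite_measure set T -> \bar R},
    forall A, nu A = \int[mu]_(x in A) g x.
Proof.
move=> mg g0 gfin; apply: ex_fmeasure => //.
- by rewrite integral_set0.
- by move=> A; apply: integral_ge0.
- exact: semi_sigma_additive_nng_induced.
Qed.

(** Hahn decomposition of the charge P - t Q; [A] is its negative set. *)
Lemma hahn_le P Q (t : R) : (0 <= t)%R ->
  exists2 A, measurable A &
    (forall B, measurable B -> B `<=` A -> P B <= t%:E * Q B) /\
    (forall B, measurable B -> B `<=` ~` A -> t%:E * Q B <= P B).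
Proof.
move=> t0.
pose nu : {charge set T -> \bar R} :=
  cadd (charge_of_finite_measure P) (cscale (- t) (charge_of_finite_measure Q)).
have nuE B : nu B = P B - t%:E * Q B by rewrite -mulNe -EFinN.
have [p [n [[mp hp] [mn hn] pn pn0]]] := Hahn_decomposition nu.
exists n => //; split=> B mB Bn.
- by have := hn _ mB Bn; rewrite nuE// sube_le0.
- have Bp : B `<=` p.
    move=> x /Bn nx; have : setT x by []. by rewrite -pn => -[].
  by have := hp _ mB Bp; rewrite nuE// sube_ge0// fin_numM// fin_num_measure.
Qed.

(** Integral-free form of the statement that [s] is a density of [P] with respect to [eta]; for [s]
    with values in [0,1] the two are equivalent ([level_ratio_density], [level_ratioP]). *)
Definition level_ratio (s : T -> R) (P eta : set T -> \bar R) := forall t : R,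
  (0 <= t)%R ->
  (forall B, measurable B -> B `<=` [set x | s x <= t]%R -> P B <= t%:E * eta B)
  /\ (forall B, measurable B -> B `<=` [set x | t < s x]%R ->
      t%:E * eta B <= P B).

Lemma measurable_le_set (s : T -> R) t : measurable_fun setT s ->
  measurable [set x | s x <= t]%R.
Proof.
move=> ms; rewrite -[X in measurable X]setTI.
have := ms measurableT _ (measurable_itv `]-oo, t]).
by congr (measurable (_ `&` _)); apply/seteqP; split => x /=; rewrite in_itv.
Qed.

Lemma measurable_lt_set (s : T -> R) t : measurable_fun setT s ->
  measurable [set x | t < s x]%R.
Proof.
move=> ms; rewrite -[X in measurable X]setTI.
have := ms measurableT _ (measurable_itv `]t, +oo[).
by congr (measurable (_ `&` _)); apply/seteqP; split => x /=; rewrite in_itv/= andbT.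
Qed.

(** Slice [0,1] into n + 1 slabs of equal width. Where a < s <= b, P is at most b eta, which exceeds
    a eta, hence Q, by at most eta / (n + 1). Adding the slabs costs eta A / (n + 1) in all, which
    tends to 0. *)
Lemma level_ratio_le (s : T -> R) P Q eta :
  measurable_fun setT s -> (forall x, 0 <= s x <= 1)%R ->
  level_ratio s P eta -> level_ratio s Q eta ->
  forall A, measurable A -> P A <= Q A.
Proof.
move=> ms s01 hP hQ A mA.
have key n j : P (A `&` [set x | s x <= j%:R / n.+1%:R]%R) <=
    Q (A `&` [set x | s x <= j%:R / n.+1%:R]%R) +
    (n.+1%:R^-1)%:E * eta (A `&` [set x | s x <= j%:R / n.+1%:R]%R).
  elim: j => [|j IH].
    have [h _] := hP 0%R (lexx _).
    apply: (@le_trans _ _ 0); last by rewrite adde_ge0// mule_ge0// lee_fin.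
    have := h (A `&` [set x | s x <= 0%:R / n.+1%:R]%R).
    rewrite mul0e; apply; last by move=> x [_] /=; rewrite mul0r.
    by apply: measurableI => //; exact: measurable_le_set.
  set a := (j%:R / n.+1%:R)%R in IH *; set b := (j.+1%:R / n.+1%:R)%R.
  have a0 : (0 <= a)%R by rewrite divr_ge0.
  have b0 : (0 <= b)%R by rewrite divr_ge0.
  have ab : (b = a + n.+1%:R^-1)%R by rewrite /a /b -natr1 mulrDl mul1r.
  have n0 : (0 <= n.+1%:R^-1 :> R)%R by [].
  pose D := A `&` ([set x | s x <= b]%R `&` [set x | a < s x]%R).
  have mD : measurable D.
    apply: measurableI => //; apply: measurableI.
    - exact: measurable_le_set.
    - exact: measurable_lt_set.
  have mAa : measurable (A `&` [set x | s x <= a]%R).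
    by apply: measurableI => //; exact: measurable_le_set.
  have -> : A `&` [set x | s x <= b]%R = (A `&` [set x | s x <= a]%R) `|` D.
    apply/seteqP; split => x.
    - move=> [Ax /= sb]; have [sa|sa] := leP (s x) a; [left|right] => //.
    - by case=> -[Ax]/= => [sa|[]//]; split => //; rewrite ab (le_trans sa)// lerDl.
  have dis : (A `&` [set x | s x <= a]%R) `&` D = set0.
    apply/seteqP; split => x //= -[[_ h1] [_ [_ h2]]].
    by move: h1 h2 => /= h1; rewrite ltNge h1.
  rewrite !measureU//.
  have hD : P D <= Q D + (n.+1%:R^-1)%:E * eta D.
    apply: (@le_trans _ _ (b%:E * eta D)).
      by apply: (hP b b0).1 => // x [_ []].
    rewrite ab EFinD ge0_muleDl ?lee_fin//.
    apply: leeD => //.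
    by apply: (hQ a a0).2 => // x [_ []].
  rewrite ge0_muleDr// addeACA; apply: leeD => //.
have sT n : [set x | s x <= n.+1%:R / n.+1%:R]%R = setT.
  by apply/seteqP; split => // x _ /=; rewrite divff// (andP (s01 x)).2.
have fE : eta A \is a fin_num by exact: fin_num_measure.
apply/lee_addgt0Pr => e e0.
pose n := Num.truncn (fine (eta A) / e).
have := key n n.+1; rewrite sT setIT => /le_trans; apply.
rewrite leeD2l// -(fineK fE) -EFinM lee_fin mulrC ler_pdivrMr//.
rewrite mulrC -ler_pdivrMr// ltW// truncnS_gt//.
Qed.

Lemma level_ratio_unique (s : T -> R) P Q eta :
  measurable_fun setT s -> (forall x, 0 <= s x <= 1)%R ->
  level_ratio s P eta -> level_ratio s Q eta ->
  forall A, measurable A -> P A = Q A.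
Proof.
move=> ms s01 hP hQ A mA; apply/eqP; rewrite eq_le.
by rewrite (level_ratio_le ms s01 hP hQ)// (level_ratio_le ms s01 hQ hP).
Qed.

Lemma level_ratio_density (s : T -> R) P eta :
  measurable_fun setT s -> (forall x, 0 <= s x)%R ->
  (forall A, measurable A -> P A = \int[eta]_(x in A) (s x)%:E) ->
  level_ratio s P eta.
Proof.
move=> ms s0 h t t0; split => B mB Bs; rewrite h// -integral_cst//.
- apply: ge0_le_integral => //.
  + by move=> x _; rewrite lee_fin.
  + by apply/measurable_EFinP; exact: measurable_funTS.
- apply: ge0_le_integral => //.
  + by apply/measurable_EFinP; exact: measurable_funTS.
  + by move=> x /Bs /= /ltW; rewrite lee_fin.
Qed.

(** The measure with density [s] has the same level ratio, so uniqueness identifies it with [P]. *)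
Lemma level_ratioP (s : T -> R) P eta :
  measurable_fun setT s -> (forall x, 0 <= s x <= 1)%R ->
  level_ratio s P eta ->
  forall A, measurable A -> P A = \int[eta]_(x in A) (s x)%:E.
Proof.
move=> ms s01 h A mA.
have [||| P' HP'] := @ex_density_measure eta (EFin \o s).
- exact/measurable_EFinP.
- by move=> x; rewrite lee_fin (andP (s01 x)).1.
- apply: (@le_lt_trans _ _ (\int[eta]_x (1%:E))).
    apply: ge0_le_integral => //.
    + by move=> x _; rewrite lee_fin (andP (s01 x)).1.
    + exact/measurable_EFinP.
    + by move=> x _; rewrite lee_fin (andP (s01 x)).2.
  by rewrite integral_cst// mul1e fmeasure_lty.
rewrite -HP'; apply: (level_ratio_unique ms s01 h) => //.
apply: level_ratio_density => // x; exact: (andP (s01 x)).1.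
Qed.

(** The Radon-Nikodym derivative is truncated at 1 so that the bounds hold at every point. Levels t
    < 1 do not see the truncation, and for t >= 1 the first inequality is the domination of [P] by
    [eta] while the second concerns an empty level set or one where the derivative exceeds t. *)
Lemma ex_level_ratio P eta : (forall A, measurable A -> P A <= eta A) ->
  exists s : T -> R, [/\ measurable_fun setT s, (forall x, 0 <= s x <= 1)%R &
    level_ratio s P eta].
Proof.
move=> Peta.
have Pdom : P `<< eta.
  apply/null_content_dominatesP => A mA A0; apply/eqP.
  by rewrite eq_le measure_ge0 andbT -A0 Peta.
have [f [f0 intf fP]] := radon_nikodym_finite Pdom.
have mf : measurable_fun setT f by exact: measurable_int intf.
have min0 x : 0 <= mine (f x) 1%:E by rewrite le_min f0 lee01.
have min1 x : mine (f x) 1%:E <= 1 by rewrite ge_min lexx orbT.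
have minE x : (fine (mine (f x) 1%:E))%:E = mine (f x) 1%:E.
  by rewrite fineK// ge0_fin_numE// (le_lt_trans (min1 x))// ltry.
pose s x := fine (mine (f x) 1%:E).
have ms : measurable_fun setT s.
  apply: measurableT_comp => //; apply: measurable_mine => //.
exists s; split => //.
  by move=> x; rewrite -!lee_fin minE min0 min1.
move=> t t0; split => B mB Bs.
- have [t1|t1] := ltP t 1%R; last first.
    rewrite (le_trans (Peta _ mB))// -[X in X <= _]mul1e lee_wpmul2r//.
  rewrite fP// -integral_cst//; apply: ge0_le_integral => //.
  + exact: measurable_funTS.
  + move=> x /Bs /=; rewrite /s -lee_fin minE ge_min => /orP[//|].
    by rewrite lee_fin leNgt t1.
- rewrite fP// -integral_cst//; apply: ge0_le_integral => //.
  + exact: measurable_funTS.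
  + by move=> x /Bs /=; rewrite /s -lte_fin minE lt_min => /andP[/ltW].
Qed.

End finite_measures.

(** * Kernels from distribution functions *)

Section kernel_image.
Context d1 d2 d3 (Z : measurableType d1) (U : measurableType d2)
  (Y : measurableType d3) (R : realType).

(** A copy of [k] indexed by the two proofs, so that kernel instances can be attached to it. *)
Definition kernel_of (k : Z -> {measure set Y -> \bar R})
  (mk : forall B, measurable B -> measurable_fun [set: Z] (k ^~ B))
  (k1 : forall z, k z setT = 1) := k.

Section instances.
Variables (k : Z -> {measure set Y -> \bar R})
  (mk : forall B, measurable B -> measurable_fun [set: Z] (k ^~ B))
  (k1 : forall z, k z setT = 1).
HB.instance Definition _ := isKernel.Build _ _ _ _ _ (kernel_of mk k1) mk.
HB.instance Definition _ :=
  Kernel_isProbability.Build _ _ _ _ _ (kernel_of mk k1) k1.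
End instances.

Lemma ex_pkernel (k : Z -> {measure set Y -> \bar R}) :
  (forall B, measurable B -> measurable_fun [set: Z] (k ^~ B)) ->
  (forall z, k z setT = 1) ->
  exists K : R.-pker Z ~> Y, forall z B, K z B = k z B.
Proof. by move=> mk k1; exists (kernel_of mk k1 : R.-pker Z ~> Y). Qed.

Lemma ex_kernel_image (l : R.-pker Z ~> U) (f : Z * U -> Y) :
  measurable_fun setT f ->
  exists K : R.-pker Z ~> Y, forall z B, measurable B ->
    K z B = l z [set u | B (f (z, u))].
Proof.
move=> mf.
have kE z B : measurable B ->
    (mkcomp l (kdirac mf)) z B = l z [set u | B (f (z, u))].
  move=> mB; rewrite /mkcomp/= /kcomp.
  transitivity (\int[l z]_(x in setT) (\1_[set u | B (f (z, u))] x)%:E).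
    by apply: eq_integral => u _; rewrite /kdirac/= diracE indicE; congr (_%:R%:E);
       apply/idP/idP; rewrite !inE.
  rewrite integral_indic ?setIT//.
  have := measurableT_comp mf (pair1_measurable z).
  by move=> /(_ measurableT B mB); rewrite setTI.
have [|| K HK] := @ex_pkernel (mkcomp l (kdirac mf)).
- by move=> B mB; exact: measurable_kernel.
- move=> z; rewrite kE// -(@prob_kernel _ _ _ _ _ l z); congr (l z _); exact/seteqP.
- by exists K => z B mB; rewrite HK kE.
Qed.

End kernel_image.
Lemma uniform_prob_le (R : realType) (c : R) : (0 <= c <= 1)%R ->
  uniform_prob (@ltr01 R) [set u | u <= c]%R = c%:E.
Proof.
move=> /andP[c0 c1]; rewrite /uniform_prob integral_uniform_pdf.
have -> : [set u | u <= c]%R `&` `[0%R, 1%R]%classic = `[0%R, c]%classic.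
  apply/seteqP; split=> u /=; rewrite !in_itv/=.
    by move=> [-> /andP[->]].
  by move=> /andP[-> uc]; rewrite uc (le_trans uc c1).
rewrite (eq_integral (cst 1)).
  rewrite integral_cst//= mul1e lebesgue_measure_itv/= lte_fin.
  by case: ltP => [_|]; rewrite ?sube0// => c0'; congr _%:E; apply/eqP; rewrite eq_le c0 c0'.
move=> u; rewrite inE/= in_itv/= /uniform_pdf => /andP[-> uc].
by rewrite (le_trans uc c1)/= subr0 invr1.
Qed.

(* The kernel is the law of the quantile function at a uniform variable. *)
Lemma quantile_kernel d (Z : measurableType d) (R : realType) (q : nat -> R)
  (F : nat -> Z -> R) :
  (forall k, measurable_fun setT (F k)) -> (forall k z, 0 <= F k z <= 1)%R ->
  (forall k z, q k <= 0 -> F k z = 0)%R -> (forall k z, 1 < q k -> F k z = 1)%R ->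
  (exists k, 1 < q k)%R ->
  exists l : R.-pker Z ~> (measurableTypeR R), forall z x,
    (forall k, (q k < x)%R -> (F k z)%:E <= l z `]-oo, x[%classic) /\
    (forall c, (0 <= c <= 1)%R -> (forall k, q k < x -> F k z <= c)%R ->
       l z `]-oo, x[%classic <= c%:E).
Proof.
move=> mF F01 F0 F1 [k1 qk1].
(* The infimum over k of [h k (z, u)] is the quantile inf {q k : u <= F k z}. *)
pose h k (p : Z * measurableTypeR R) : \bar R :=
  if (p.2 <= F k p.1)%R then (q k)%:E else +oo.
have mh k : measurable_fun setT (h k).
  apply: measurable_fun_ifT => //; apply: measurable_fun_ler => //.
  exact: measurableT_comp.
pose Q p := fine (einfs (h ^~ p) 0%N).
have mQ : measurable_fun setT Q.
  by apply: measurableT_comp => //; exact: measurable_fun_einfs.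
have hQ z u x : (0 < u <= 1)%R -> (Q (z, u) < x)%R <->
    exists2 k, (q k < x)%R & (u <= F k z)%R.
  move=> /andP[u0 u1].
  have E : einfs (h ^~ (z, u)) 0%N = ereal_inf (range (h ^~ (z, u))).
    by congr ereal_inf; apply/seteqP; split=> y [n _ <-]; exists n.
  have fQ : einfs (h ^~ (z, u)) 0%N = (Q (z, u))%:E.
    rewrite fineK// fin_numElt; apply/andP; split.
      apply: (@lt_le_trans _ _ 0); first by rewrite ltNyr.
      rewrite E; apply: le_ereal_inf_tmp => _ [n _ <-]; rewrite /h/=.
      case: ifPn => // uF; rewrite lee_fin leNgt; apply/negP => /ltW/(F0 _ z) F0'.
      by move: uF; rewrite F0' leNgt u0.
    apply: (@le_lt_trans _ _ (q k1)%:E); last by rewrite ltry.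
    by rewrite E; apply: ereal_inf_lbound; exists k1 => //; rewrite /h/= F1// u1.
  rewrite -lte_fin -fQ E; split.
    move=> /ereal_inf_lt[_ [n _ <-]]; rewrite /h/=; case: ifPn => // uF.
    by rewrite lte_fin => qx; exists n.
  move=> [k qx uF]; apply: (@le_lt_trans _ _ (q k)%:E); last by rewrite lte_fin.
  by apply: ereal_inf_lbound; exists k => //; rewrite /h/= uF.
have [l Hl] := @ex_kernel_image _ _ _ Z (measurableTypeR R) (measurableTypeR R)
  R (kprobability (measurable_cst (uniform_prob (@ltr01 R) : pprobability _ R))) Q mQ.
exists l => z x; rewrite Hl//=.
have mS : measurable [set u : measurableTypeR R | `]-oo, x[%classic (Q (z, u))].
  have := measurableT_comp mQ (pair1_measurable z).
  by move=> /(_ measurableT _ (measurable_itv `]-oo, x[)); rewrite setTI.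
have mle c : measurable [set u : measurableTypeR R | (u <= c)%R].
  by rewrite [X in measurable X](_ : _ = [set` `]-oo, c]%R])//;
    apply/seteqP; split => u /=; rewrite in_itv.
(* The quantile equivalence [hQ] is available only for u in ]0, 1], where the infimum is finite;
   events are compared there, up to a null set. *)
have null : uniform_prob (@ltr01 R) (~` [set` `]0%R, 1%R]%R]) = 0.
  rewrite probability_setC//; apply/eqP.
  have -> : [set` `]0%R, 1%R]%R] = [set u : R | u <= 1]%R `\` [set u : R | u <= 0]%R.
    apply/seteqP; split => u /=; rewrite in_itv/=.
      by move=> /andP[? ->]; split => //; apply/negP; rewrite -ltNge.
    by move=> [-> /negP]; rewrite -ltNge => ->.
  rewrite measureD//= ?setIidr; last 2 first.
  - by move=> u /= /le_trans; apply.
  - by apply: (le_lt_trans (probability_le1 _ _)) => //; rewrite ltry.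
  by rewrite !uniform_prob_le ?lexx ?ler01// sube0 subee.
have red (A B : set (measurableTypeR R)) : measurable A -> measurable B ->
    (forall u, (0 < u <= 1)%R -> A u -> B u) ->
    uniform_prob (@ltr01 R) A <= uniform_prob (@ltr01 R) B.
  move=> mA mB AB.
  apply: (@le_trans _ _ (uniform_prob (@ltr01 R) (B `|` ~` [set` `]0%R, 1%R]%R]))).
    apply: le_measure; rewrite ?inE//.
      by apply: measurableU => //; exact: measurableC.
    move=> u Au; have [u01|u01] := boolP (u \in `]0%R, 1%R]).
      by left; apply: AB => //; move: u01; rewrite in_itv.
    by right => /=; exact/negP.
  have h2 : uniform_prob (@ltr01 R) (B `|` ~` [set` `]0%R, 1%R]%R]) <=
      uniform_prob (@ltr01 R) B + uniform_prob (@ltr01 R) (~` [set` `]0%R, 1%R]%R]).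
    by apply: measureU2 => //; exact: measurableC.
  by rewrite (le_trans h2)// null adde0.
split => [k qx|c c01 Fc].
- rewrite -[leLHS]uniform_prob_le//; apply: red => // u u01 /= uF.
  by rewrite in_itv/=; apply/(hQ _ _ _ u01); exists k.
- rewrite -[leRHS]uniform_prob_le//; apply: red => // u u01 /=.
  by rewrite in_itv/= => /(hQ _ _ _ u01)[k /Fc Fkc] /le_trans; apply.
Qed.

Lemma measure_setT_split d (T : measurableType d) (R : realType)
  (mu : {measure set T -> \bar R}) A : measurable A ->
  mu setT = mu A + mu (~` A).
Proof.
move=> mA; rewrite -(setUv A) measureU ?setICr//; exact: measurableC.
Qed.

(** On the set where f > g the hypothesis makes the integral of f - g nonpositive, so its positive
    part vanishes almost everywhere. *)
Lemma ae_le_density d (T : measurableType d) (R : realType)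
  (eta : {finite_measure set T -> \bar R}) (f g : T -> R) :
  measurable_fun setT f -> measurable_fun setT g ->
  (forall x, 0 <= f x <= 1)%R -> (forall x, 0 <= g x <= 1)%R ->
  (forall A, measurable A -> \int[eta]_(x in A) (f x)%:E <=
                             \int[eta]_(x in A) (g x)%:E) ->
  {ae eta, forall x, (f x <= g x)%R}.
Proof.
move=> mf mg f01 g01 fg.
pose h x := Num.max (f x - g x)%R 0%R.
have mh : measurable_fun setT h.
  by apply: measurable_maxr => //; exact: measurable_funB.
have h0 x : (0 <= h x)%R by rewrite le_max lexx orbT.
pose D := [set x | 0 < h x]%R.
have mD : measurable D by exact: measurable_lt_set.
have DE x : D x -> f x = (g x + h x)%R.
  rewrite /D/= /h lt_max ltxx orbF => fg0; rewrite max_l ?ltW//; ring.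
have fin (u : T -> R) : (forall x, 0 <= u x <= 1)%R -> measurable_fun setT u ->
    \int[eta]_(x in D) (u x)%:E \is a fin_num.
  move=> u01 mu; rewrite ge0_fin_numE; last first.
    by apply: integral_ge0 => x _; rewrite lee_fin (andP (u01 x)).1.
  apply: (@le_lt_trans _ _ (\int[eta]_(x in D) (1%:E))).
    apply: ge0_le_integral => //.
    + by move=> x _; rewrite lee_fin (andP (u01 x)).1.
    + exact/measurable_EFinP/measurable_funTS.
    + by move=> x _; rewrite lee_fin (andP (u01 x)).2.
  by rewrite integral_cst// mul1e fmeasure_lty.
have Dh : \int[eta]_(x in D) (h x)%:E <= 0.
  have := fg D mD.
  have -> : \int[eta]_(x in D) (f x)%:E =
      \int[eta]_(x in D) (g x)%:E + \int[eta]_(x in D) (h x)%:E.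
    rewrite -ge0_integralD//.
    - by apply: eq_integral => x; rewrite inE => /DE ->; rewrite EFinD.
    - by move=> x _; rewrite lee_fin (andP (g01 x)).1.
    - exact/measurable_EFinP/measurable_funTS.
    - by move=> x _; rewrite lee_fin.
    - exact/measurable_EFinP/measurable_funTS.
  by rewrite -[leRHS]adde0 leeD2lE//; exact: fin.
have : ae_eq eta D (EFin \o h) (cst 0).
  apply/(ae_eq_integral_abs eta mD); first exact/measurable_EFinP/measurable_funTS.
  apply/eqP; rewrite eq_le integral_ge0// andbT.
  by under eq_integral do rewrite /= ger0_norm//.
apply: filterS => x hx; rewrite leNgt; apply/negP => gf.
have Dx : D x by rewrite /D/= /h lt_max subr_gt0 gf.
by have := hx Dx => -[hx0]; move: Dx; rewrite /D/= hx0 ltxx.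
Qed.

Definition dense_seq (R : realType) (q : nat -> R) :=
  forall x y : R, (x < y)%R -> exists n, (x < q n < y)%R.

(** The rays with endpoints in a dense sequence are stable under intersection, exhaust the line and
    generate its Borel sets. *)
Lemma dense_ray_measure_unique (R : realType) (q : nat -> R)
  (m1 m2 : {finite_measure set (measurableTypeR R) -> \bar R}) :
  dense_seq q ->
  (forall n, m1 `]-oo, q n[%classic = m2 `]-oo, q n[%classic) ->
  forall A, measurable A -> m1 A = m2 A.
Proof.
move=> dq m12.
pose g n : set (measurableTypeR R) := `]-oo, q n[%classic.
apply: (@measure_unique _ R (measurableTypeR R) (range g) g).
- rewrite [LHS]RGenInftyO.measurableE; apply/seteqP; split.
    apply: smallest_sub; first exact: smallest_sigma_algebra.
    move=> _ [x ->].
    have -> : `]-oo, x[%classic =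
        \bigcup_n (if (q n < x)%R then `]-oo, q n[%classic else set0).
      apply/seteqP; split => y /=.
        rewrite in_itv/= => /dq[n /andP[yq qx]]; exists n => //.
        by rewrite qx/= in_itv.
      move=> [n _]; case: ifPn => // qx; rewrite /= !in_itv/= => /lt_trans; exact.
    apply: sigma_algebra_bigcup => n; case: ifPn => _.
      by apply: sub_sigma_algebra; exists n.
    exact: sigma_algebra0.
  apply: smallest_sub; first exact: smallest_sigma_algebra.
  by move=> _ [n _ <-]; apply: sub_sigma_algebra; exists (q n).
- move=> _ _ [m _ <-] [n _ <-].
  have [mn|nm] := leP (q m) (q n); [exists m|exists n] => //; apply/seteqP;
    split=> y; rewrite /setI /g /= !in_itv/=.
  + by move=> ym; split => //; rewrite (lt_le_trans ym).
  + by case.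
  + by move=> ym; split => //; rewrite (lt_trans ym).
  + by case.
- by move=> n; exists n.
- apply/seteqP; split => // y _.
  have [|n /andP[yq _]] := dq y (y + 1)%R; first by rewrite ltrDl.
  by exists n => //; rewrite /g /= in_itv.
- by move=> _ [n _ <-]; exact: m12.
- by move=> n; apply: fmeasure_lty; exact: measurable_itv.
Qed.

(** The densities of the [L n] with respect to [eta] are, almost everywhere, an increasing family in
    the threshold [q n], hence a conditional distribution function. [G] is its unconditional law;
    being a measure, it supplies the left continuity at each [q n]. *)
Lemma cdf_kernel d (Z : measurableType d) (R : realType) (q : nat -> R)
  (eta : {finite_measure set Z -> \bar R})
  (G : {finite_measure set (measurableTypeR R) -> \bar R})
  (L : nat -> {finite_measure set Z -> \bar R}) :
  dense_seq q ->
  (forall n A, measurable A -> L n A <= eta A) ->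
  (forall m n, (q m <= q n)%R -> forall A, measurable A -> L m A <= L n A) ->
  (forall n, L n setT = G `]-oo, q n[%classic) ->
  (forall n, q n <= 0 -> L n setT = 0)%R ->
  (forall n, (1 < q n)%R -> L n setT = eta setT) ->
  exists l : R.-pker Z ~> (measurableTypeR R), forall n A, measurable A ->
    \int[eta]_(z in A) l z `]-oo, q n[%classic = L n A.
Proof.
move=> dq Leta Lmono LG L0 L1.
have [s Hs] : exists s : nat -> Z -> R, forall n,
    [/\ measurable_fun setT (s n), forall x, (0 <= s n x <= 1)%R &
        level_ratio (s n) (L n) eta].
  have h n := ex_level_ratio (Leta n).
  by exists (fun n => projT1 (cid (h n))) => n; exact: projT2 (cid (h n)).
(* The constants make the boundary conditions of [quantile_kernel] hold at every point; they are
   still densities of [L n] by the last two hypotheses. *)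
pose F n z := if (q n <= 0)%R then 0%R else if (1 < q n)%R then 1%R else s n z.
have mF n : measurable_fun setT (F n).
  by rewrite /F; case: (q n <= 0)%R => //; case: (1 < q n)%R => //; case: (Hs n).
have F01 n z : (0 <= F n z <= 1)%R.
  rewrite /F; case: ifPn => [|_]; first by rewrite lexx ler01.
  case: ifPn => [|_]; first by rewrite lexx ler01.
  by case: (Hs n).
have LF n A : measurable A -> L n A = \int[eta]_(z in A) (F n z)%:E.
  move=> mA; rewrite /F; case: (boolP (q n <= 0)%R) => q0.
    rewrite integral0; apply/eqP; rewrite eq_le measure_ge0 andbT -(L0 n q0).
    by apply: le_measure; rewrite ?inE.
  case: (boolP (1 < q n)%R) => q1; last by case: (Hs n) => h1 h2 h3; exact: level_ratioP.
  rewrite integral_cst// mul1e; apply/eqP; rewrite eq_le Leta//= leNgt; apply/negP => lt.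
  have := L1 n q1; rewrite !(measure_setT_split _ mA).
  apply/eqP; rewrite lt_eqF//; apply: lte_leD => //.
    by rewrite fin_num_measure//; exact: measurableC.
  by apply: Leta; exact: measurableC.
have [|||l Hl] := @quantile_kernel _ Z R q F mF F01.
- by move=> k z; rewrite /F => ->.
- by move=> k z q1; rewrite /F q1 leNgt (lt_trans ltr01 q1).
- by have [|k /andP[]] := dq 1%R 2%R; [rewrite ltr1n|exists k].
exists l => n A mA.
have ml x : measurable_fun setT (fun z => l z `]-oo, x[%classic).
  by apply: measurable_kernel.
have ub B : measurable B -> \int[eta]_(z in B) l z `]-oo, q n[%classic <= L n B.
  move=> mB; rewrite LF//; apply: ae_ge0_le_integral => //.
  - by apply: measurable_funTS.
  - by move=> z _; rewrite lee_fin (andP (F01 n z)).1.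
  - exact/measurable_EFinP/measurable_funTS.
  have : {ae eta, forall z, forall k, q k < q n -> F k z <= F n z}%R.
    apply/ae_foralln => k; have [qk|qk] := ltP (q k) (q n); last first.
      by apply/aeW => z.
    have : {ae eta, forall z, F k z <= F n z}%R.
      apply: ae_le_density => // D mD; rewrite -!LF//; apply: Lmono => //; exact: ltW.
    by apply: filterS.
  apply: filterS => z Fz _; exact: (Hl z (q n)).2.
(* The reverse bound is needed for the total mass only: [G] of the ray is the supremum of its values
   on smaller rays, each below some [L m setT] with q m < q n. *)
have lb : L n setT <= \int[eta]_z l z `]-oo, q n[%classic.
  rewrite LG.
  pose B k := `]-oo, (q n - k.+1%:R^-1)%R[%classic : set R.
  have cB : G (B k) @[k --> \oo] --> G (\bigcup_k B k).
    apply: nondecreasing_cvg_mu.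
    - by move=> k; exact: measurable_itv.
    - by apply: bigcup_measurable => k _; exact: measurable_itv.
    move=> i j ij; apply/subsetPset => x; rewrite /B/= !in_itv/= => /lt_le_trans; apply.
    by rewrite lerB// lef_pV2 ?posrE// ler_nat ltnS.
  have BU : \bigcup_k B k = `]-oo, q n[%classic.
    apply/seteqP; split => x.
      by move=> [k _]; rewrite /B/= !in_itv/= => /lt_le_trans; apply; rewrite gerBl.
    rewrite /= in_itv/= => xq; exists (Num.truncn (q n - x)^-1) => //.
    rewrite /B /= in_itv/= ltrBrDr -ltrBrDl invf_plt ?posrE ?subr_gt0//.
    exact: truncnS_gt.
  have -> : G `]-oo, q n[%classic = lim (G (B k) @[k --> \oo]).
    by rewrite -BU; apply/esym/cvg_lim.
  apply: lime_le.
    by apply/cvg_ex; eexists; exact: cB.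
  apply: nearW => k.
  have [|m /andP[m1 m2]] := dq (q n - k.+1%:R^-1)%R (q n); first by rewrite ltrBlDr ltrDl.
  apply: (@le_trans _ _ (L m setT)).
    rewrite LG; apply: le_measure; rewrite ?inE; try exact: measurable_itv.
    by move=> x; rewrite /B /= !in_itv/= => /lt_trans; apply.
  rewrite LF//; apply: ge0_le_integral => //.
  - by move=> z _; rewrite lee_fin (andP (F01 m z)).1.
  - exact/measurable_EFinP/measurable_funTS.
  - by move=> z _; exact: (Hl z (q n)).1.
(* A strict loss on [A] could not be made up on the complement, where [ub] also holds, and would
   contradict [lb]. *)
apply/eqP; rewrite eq_le ub//= leNgt; apply/negP => lt.
have mAC : measurable (~` A) by exact: measurableC.
have mU : measurable (~` A `|` A) by rewrite setvU.
move: lb; rewrite leNgt => /negP; apply.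
rewrite (measure_setT_split _ mA) -(setUv A) ge0_integral_setU//; last 2 first.
- by rewrite setUv; exact: ml.
- by rewrite disj_set2E setICr.
apply: lte_leD => //; last exact: ub.
rewrite ge0_fin_numE ?(le_lt_trans (ub _ mAC))// ?fmeasure_lty//.
by apply: integral_ge0.
Qed.

(** * Coding Polish spaces by real numbers *)

Section ternary_code.
Context d (W : measurableType d) (R : realType) (b : nat -> W -> bool).
Hypothesis mb : forall j, measurable_fun setT (b j).

Let term j w : R := ((b j w)%:R * (2 / 3 ^+ j.+1))%R.

Let term_ge0 j w : (0 <= term j w)%R.
Proof. by rewrite /term mulr_ge0// divr_ge0. Qed.

Let tail m w : \bar R := \sum_(m <= j <oo) (term j w)%:E.

Let tail_ge0 m w : 0 <= tail m w.
Proof. by apply: nneseries_ge0 => j _ _; rewrite lee_fin. Qed.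

Let tail_le m w : tail m w <= (3 ^- m)%:E.
Proof.
apply: lime_le; first by apply: is_cvg_nneseries => j _ _; rewrite lee_fin.
apply: nearW => n.
have [nm|mn] := leqP n m; first by rewrite big_geq// lee_fin invr_ge0.
rewrite sumEFin lee_fin -(subnKC (ltnW mn)).
(* The full series with all digits 2 telescopes, each term 2 / 3 ^ (j + 1) being 3 ^ (- j) - 3 ^ (-
   (j + 1)). *)
apply: (@le_trans _ _ (3 ^- m - 3 ^- (m + (n - m)))%R); last by rewrite gerBl.
elim: (n - m)%N => [|k IH]; first by rewrite addn0 big_geq// subrr.
rewrite addnS big_nat_recr/=; last by rewrite leq_addr.
apply: (le_trans (lerD IH (lexx _))).
rewrite -addrA lerD2l /term exprS.
have p0 : (0 < 3 ^+ (m + k) :> R)%R by [].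
have e0 : (0 < (3 ^+ (m + k))^-1 :> R)%R by rewrite invr_gt0.
rewrite invfM; set x := ((3 ^+ (m + k))^-1)%R in e0 *.
by case: (b _ _) => /=; lra.
Qed.

Let tail_rec m w : tail m w = (term m w)%:E + tail m.+1 w.
Proof.
rewrite /tail (@nneseries_split _ _ m 1); last by move=> k _; rewrite lee_fin.
by rewrite addn1 big_nat1.
Qed.

Let tail_fin m w : tail m w \is a fin_num.
Proof. by rewrite ge0_fin_numE ?tail_ge0// (le_lt_trans (tail_le m w))// ltry. Qed.

(** What is left of [x] after reading m ternary digits in {0, 2}; on a code it is the tail of the
    series. *)
Fixpoint ternary_rest (m : nat) (x : R) : R :=
  if m is k.+1 then
    (ternary_rest k x - ((3 ^- k / 2 < ternary_rest k x)%R : bool)%:R * (2 / 3 ^+ k.+1))%R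
  else x.

Let measurable_rest m : measurable_fun setT (ternary_rest m).
Proof.
elim: m => [|m IH] //=; apply: measurable_funB => //.
apply: measurable_funM => //.
have -> : (fun x : R => ((3 ^- m / 2 < ternary_rest m x)%R : bool)%:R : R) =
    \1_[set x | 3 ^- m / 2 < ternary_rest m x]%R.
  by apply/funext => x; rewrite indicE; congr ((nat_of_bool _)%:R); apply/idP/idP; rewrite inE.
by apply: measurable_indic; exact: measurable_lt_set.
Qed.

(** If the digit is present the tail is at least 2/3 of 3 ^ (- m), otherwise at most 1/3 of it; one
    half separates the cases. *)
Let tail_digit m w : (3 ^- m / 2 < fine (tail m w))%R = b m w.
Proof.
have := tail_le m.+1 w; have := tail_ge0 m.+1 w; rewrite (tail_rec m).
rewrite -(fineK (tail_fin m.+1 w)) -EFinD !lee_fin /= /term => h1 h2.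
have e0 : (0 < 3 ^- m :> R)%R by rewrite invr_gt0.
move: h2; rewrite exprS invfM => h2; rewrite /tail in h1 h2 *.
move: h1 h2 e0; set x := (3 ^- m)%R; set y := fine _ => h1 h2 e0.
case: (b m w) h1 h2 => /= h1 h2; [apply/idP => /=; lra|apply/negbTE; rewrite -leNgt; lra].
Qed.

(** The Cantor code. In base three with digits 0 and 2 there is a gap at every digit, so decoding is
    a measurable threshold without the ambiguity of dyadic expansions. *)
Lemma ternary_code : exists (phi : W -> R) (digit : nat -> R -> bool),
  [/\ measurable_fun setT phi, forall w, (0 <= phi w <= 1)%R,
      forall j, measurable [set x | digit j x] &
      forall j w, digit j (phi w) = b j w].
Proof.
exists (fun w => fine (tail 0 w)), (fun j x => 3 ^- j / 2 < ternary_rest j x)%R.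
split.
- apply: measurableT_comp => //; apply: ge0_emeasurable_sum => [j w _ _|j _]; first by rewrite lee_fin.
  apply/measurable_EFinP; apply: measurable_funM => //.
  have -> : (fun w => (b j w)%:R : R) = \1_[set w | b j w].
    by apply/funext => x; rewrite indicE; congr ((nat_of_bool _)%:R); apply/idP/idP; rewrite inE.
  apply: measurable_indic; rewrite -[X in measurable X]setTI.
  exact: mb.
- move=> w; rewrite fine_ge0//=; have := tail_le 0 w.
  by rewrite -{1}(fineK (tail_fin 0 w)) lee_fin expr0 invr1.
- by move=> j; exact: measurable_lt_set.
- move=> j w; rewrite -tail_digit; congr (_ < _)%R.
  elim: j => [//|j IH] /=; rewrite IH tail_digit.
  by rewrite [in LHS]tail_rec -(fineK (tail_fin j.+1 w))/=  -/(term j w) [X in (X - _)%R]addrC addrK.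
Qed.

End ternary_code.

Lemma measurable_forall d (T : measurableType d) (P : nat -> T -> Prop) :
  (forall n, measurable [set x | P n x]) -> measurable [set x | forall n, P n x].
Proof.
move=> mP.
rewrite [X in measurable X](_ : _ = \bigcap_n [set x | P n x]).
  exact: bigcap_measurable.
by apply/seteqP; split => x /= h n => [_|]; apply: h.
Qed.

Lemma measurable_exists d (T : measurableType d) (P : nat -> T -> Prop) :
  (forall n, measurable [set x | P n x]) -> measurable [set x | exists n, P n x].
Proof.
move=> mP.
rewrite [X in measurable X](_ : _ = \bigcup_n [set x | P n x]).
  exact: bigcup_measurable.
by apply/seteqP; split => x /= [n]; [exists n|move=> _; exists n].
Qed.

Lemma measurable_preimage_nat d (T : measurableType d) (N : T -> nat) S :
  (forall n, measurable [set x | N x = n]) -> measurable [set x | S (N x)].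
Proof.
move=> mN.
rewrite [X in measurable X](_ : _ = \bigcup_(n in S) [set x | N x = n]).
  exact: bigcup_measurable.
by apply/seteqP; split => x /=; [exists (N x)|move=> [n Sn /= ->]].
Qed.

(** A complete separable metric transported to [T] along a homeomorphism, so that balls are subsets
    of [T] itself and completeness speaks of sequences. *)
Record separating_metric (R : realType) (T : topologicalType)
    (rho : T -> T -> R) (e : nat -> T) : Prop := {
  smetric_sym : forall x y, rho x y = rho y x;
  smetric_triangle : forall x y z, (rho x z <= rho x y + rho y z)%R;
  smetric_ball_open : forall x (r : R), open [set y | rho x y < r]%R;
  smetric_open_ball : forall U : set T, open U -> forall x, U x ->
    exists2 r : R, (0 < r)%R & forall y, (rho x y < r)%R -> U y;
  smetric_eq0 : forall x y, (forall r : R, 0 < r -> rho x y < r)%R -> x = y;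
  smetric_dense : forall x (r : R), (0 < r)%R -> exists n, (rho x (e n) < r)%R;
  smetric_complete : forall u : nat -> T,
    (forall r : R, (0 < r)%R -> exists N, forall m n, (N <= m)%N -> (N <= n)%N ->
       (rho (u m) (u n) < r)%R) ->
    exists l, forall r, (0 < r)%R -> exists N, forall n, (N <= n)%N ->
       (rho (u n) l < r)%R }.

Lemma polish_separating_metric (R : realType) (T : ptopologicalType) :
  Defs.polish R T -> exists (rho : T -> T -> R) (e : nat -> T),
    separating_metric rho e.
Proof.
move=> [[D cD dD] [M [f [g [fK gK cf cg compl]]]]].
have [e eD] : exists e : nat -> T, set_surj setT D e by apply/pcard_surjP.
have rho_open x r : open [set y | mdist (f x) (f y) < r]%R.
  rewrite openE => y /= xyr.
  have r0 : (0 < r - mdist (f x) (f y))%R by rewrite subr_gt0.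
  rewrite /interior /=.
  have nb : nbhs y (f @^-1` ball (f y) (r - mdist (f x) (f y))%R).
    exact: (cf y _ (nbhsx_ballx (f y) _ r0)).
  apply: filterS nb => z; rewrite ballEmdist/= => yz.
  apply: (le_lt_trans (metric_triangle _ (f y) _)).
  by rewrite -ltrBrDl.
have rho0 x : (mdist (f x) (f x) = 0)%R by exact: mdistxx.
exists (fun x y => mdist (f x) (f y)), e; split.
- by move=> x y; exact: metric_sym.
- by move=> x y z; exact: metric_triangle.
- exact: rho_open.
- move=> U oU x Ux.
  have : nbhs (f x) (g @^-1` U).
    by apply: cg; rewrite fK; exact: open_nbhs_nbhs.
  move=> /nbhs_ballP[r /= r0 rU]; exists r => // y xy.
  by rewrite -(fK y); apply: rU; rewrite ballEmdist.
- move=> x y xy; apply: (can_inj fK); apply: mdist_positivity; apply/eqP.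
  rewrite eq_le mdist_ge0 andbT; apply/ler_addgt0Pl => r r0.
  by rewrite addr0 ltW// xy.
- move=> x r r0.
  have [|y [yB /eD[n _ ny]]] := dD _ _ (rho_open x r).
    by exists x => /=; rewrite rho0.
  by exists n; rewrite ny.
- move=> u cu.
  have [|l ul] := compl (f \o u @ \oo) _.
    apply/cauchy_ballP => r r0.
    have [N hN] := cu r r0.
    exists ([set z | exists2 n, (N <= n)%N & z = f (u n)],
            [set z | exists2 n, (N <= n)%N & z = f (u n)]).
      by split; exists N => // n /= Nn; exists n.
    move=> [a b] [/= [m Nm ->] [n Nn ->]]; rewrite ballEmdist/=; exact: hN.
  exists (g l) => r r0.
  have := cvg_ball ul r0 => -[N _ hN]; exists N => n Nn.
  by rewrite gK metric_sym; have := hN n Nn; rewrite ballEmdist.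
Qed.

Lemma open_measurable_borel (T : ptopologicalType) (U : set T) :
  open U -> measurable (U : set (borel T)).
Proof. by move=> oU; apply: sub_sigma_algebra. Qed.

(* A point is coded by the digits of a real number listing the balls, centred at
   the dense sequence, that contain it; decoding follows the first ball of each
   radius and takes the limit of the centres. *)
Lemma separating_metric_code (R : realType) (T : ptopologicalType)
  (rho : T -> T -> R) (e : nat -> T) : separating_metric rho e ->
  exists (phi : borel T -> R) (psi : R -> borel T),
  [/\ measurable_fun setT phi, measurable_fun setT psi, cancel phi psi &
      forall w, (0 <= phi w <= 1)%R].
Proof.
move=> [sym tri bopen openb eq0 dns compl].
pose b j (w : borel T) := if @unpickle (nat * nat)%type j is Some kn
  then (rho (e kn.2) w < kn.1.+1%:R^-1)%R else false.
have mb j : measurable_fun setT (b j).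
  apply: (measurable_fun_bool true); rewrite setTI /b.
  case: (unpickle j) => [[k n]|].
    rewrite [X in measurable X](_ : _ = [set w | rho (e n) w < k.+1%:R^-1]%R).
      exact: (open_measurable_borel (bopen (e n) (k.+1%:R^-1)%R)).
    by apply/seteqP; split.
  by rewrite [X in measurable X](_ : _ = set0)//; apply/seteqP; split.
have [phi [digit [mphi phi01 mdigit digitE]]] := ternary_code R mb.
pose dg (k n : nat) x := digit (pickle (k, n)) x.
have dgE k n w : dg k n (phi w) = (rho (e n) w < k.+1%:R^-1)%R.
  by rewrite /dg digitE /b pickleK.
(* Index of the first ball of radius 1 / (k + 1) announced by the digits. A real that codes no point
   may announce none, and then the index is 0. *)
have exN k x : exists m, (dg k m x /\ forall i, (i < m)%N -> ~~ dg k i x) \/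
   (m = 0%N /\ forall i, ~~ dg k i x).
  have [[n nx]|no] := pselect (exists n, dg k n x).
    exists (@ex_minn (fun n => dg k n x) (ex_intro _ n nx)); left; case: ex_minnP => m mx hm.
    split => // i im; apply/negP => /hm; by rewrite leqNgt im.
  by exists 0%N; right; split => // i; apply/negP => ix; apply: no; exists i.
pose N k x := projT1 (cid (exN k x)).
have NP k x := projT2 (cid (exN k x)).
have mdg k n : measurable [set x | dg k n x] by exact: mdigit.
have mdgC k n : measurable [set x | ~~ dg k n x].
  rewrite [X in measurable X](_ : _ = ~` [set x | dg k n x]).
    exact/measurableC.
  by apply/seteqP; split => x /= /negP.
have mN k m : measurable [set x : R | N k x = m].
  rewrite [X in measurable X](_ : _ =
     ([set x | dg k m x] `&` [set x | forall i, (i < m)%N -> ~~ dg k i x])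
     `|` (if m == 0%N then [set x | forall i, ~~ dg k i x] else set0)).
    apply: measurableU; first apply: measurableI => //.
      apply: measurable_forall => i; case: (i < m)%N.
        rewrite [X in measurable X](_ : _ = [set x | ~~ dg k i x])//.
        by apply/seteqP; split => x /=; [exact|].
      by rewrite [X in measurable X](_ : _ = setT)//; apply/seteqP; split.
    by case: ifPn => // _; exact: measurable_forall.
  apply/seteqP; split => x /=.
    move=> <-; case: (NP k x) => [[h1 h2]|[h1 h2]]; first by left.
    by right; rewrite /N h1 eqxx.
  have := NP k x; rewrite -/(N k x).
  case: (eqVneq m 0%N) => [->|m0].
    move=> [[h1 h2]|[h1 h2]] [[h3 h4]|h3] //.
    - by apply/eqP; rewrite -leqn0 leqNgt; apply/negP => /h2; rewrite h3.
    - by move: (h3 (N k x)); rewrite h1.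
  move=> [[h1 h2]|[h1 h2]] [[h3 h4]|h3] //; last by move: (h2 m); rewrite h3.
  apply/eqP; rewrite eqn_leq; apply/andP; split; rewrite leqNgt; apply/negP.
  - by move=> /h2; rewrite h3.
  - by move=> /h4; rewrite h1.
(* The reals whose chosen centres form a Cauchy sequence; it contains every code. Off it the decoder
   returns [point]. *)
pose C := [set x : R | forall j, exists M, forall m n, (M <= m)%N -> (M <= n)%N ->
  (rho (e (N m x)) (e (N n x)) < j.+1%:R^-1)%R].
have mC : measurable C.
  apply: measurable_forall => j; apply: measurable_exists => M.
  apply: measurable_forall => m; apply: measurable_forall => n.
  rewrite [X in measurable X](_ : _ = if (M <= m)%N && (M <= n)%N then
    [set x | exists a, N m x = a /\ (rho (e a) (e (N n x)) < j.+1%:R^-1)%R]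
    else setT).
    case: ifP => // _; apply: measurable_exists => a.
    apply: (measurableI [set x | N m x = a]
      [set x | (rho (e a) (e (N n x)) < j.+1%:R^-1)%R]) => //.
    apply: (@measurable_preimage_nat _ _ (N n)
      (fun c => (rho (e a) (e c) < j.+1%:R^-1)%R)) => //.
  apply/seteqP; split => x /=.
    by case: ifP => // /andP[h1 h2] /(_ h1 h2) h; exists (N m x).
  case: ifP => [/andP[h1 h2] [a [<-]]//|].
  by move=> /negP h _ h1 h2; exfalso; apply: h; rewrite h1.
have smallN (r : R) : (0 < r)%R -> exists j : nat, (j.+1%:R^-1 < r)%R.
  move=> r0; exists (Num.truncn r^-1); rewrite invf_plt ?posrE//.
  exact: truncnS_gt.
have exl x : exists l : T, C x -> forall r, (0 < r)%R -> exists M, forall n, (M <= n)%N ->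
     (rho (e (N n x)) l < r)%R.
  have [Cx|nCx] := pselect (C x); last by exists point.
  have [|l hl] := compl (fun n => e (N n x)).
    move=> r /smallN[j jr]; have [M hM] := Cx j; exists M => m n Mm Mn.
    exact: lt_trans (hM _ _ Mm Mn) jr.
  by exists l.
pose psi x : borel T := if x \in C then projT1 (cid (exl x)) else point.
have psiP x : C x -> forall r, (0 < r)%R -> exists M, forall n, (M <= n)%N ->
     (rho (e (N n x)) (psi x) < r)%R.
  by move=> Cx; rewrite /psi mem_set//; exact: (projT2 (cid (exl x))).
exists phi, psi; split => //.
- apply: (@measurability _ _ R (borel T) setT psi (@open T)); first by [].
  move=> _ [U oU <-]; rewrite setTI.
  (* The limit of the centres lies in the open set [U] exactly when, for some j, the centres are
     eventually in [V j]; this is a countable condition on their indices. *)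
  pose V j := [set y | forall z, (rho y z < j.+1%:R^-1)%R -> U z].
  rewrite [X in measurable X](_ : _ =
    (C `&` [set x | exists j M, forall n, (M <= n)%N -> V j (e (N n x))]) `|`
    (~` C `&` [set x | U point])).
    apply: measurableU.
      apply: measurableI => //; apply: measurable_exists => j.
      apply: measurable_exists => M; apply: measurable_forall => n.
      exact: (@measurable_preimage_nat _ _ (N n) (fun c => (M <= n)%N -> V j (e c))).
    apply: measurableI; first exact: measurableC.
    have [Up|nUp] := pselect (U point).
      by rewrite [X in measurable X](_ : _ = setT)//; apply/seteqP; split.
    by rewrite [X in measurable X](_ : _ = set0)//; apply/seteqP; split.
  apply/seteqP; split => x /=.
    have [Cx|nCx] := pselect (C x); last first.
      by rewrite /psi memNset// => Up; right.
    move=> Upsi; left; split => //.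
    have [r r0 hr] := openb U oU _ Upsi.
    have [|j jr] := smallN (r / 2)%R; first by rewrite divr_gt0.
    have [|M hM] := psiP x Cx (r / 2)%R; first by rewrite divr_gt0.
    exists j, M => n Mn z nz; apply: hr.
    apply: (le_lt_trans (tri _ (e (N n x)) _)).
    by rewrite (sym (psi x)) [ltRHS]splitr ltrD ?hM// (lt_trans nz).
  move=> [[Cx [j [M hM]]]|[nCx Up]]; last by rewrite /psi memNset.
  have [|M' hM'] := psiP x Cx (j.+1%:R^-1)%R; first by rewrite invr_gt0.
  apply: (hM (maxn M M')); first exact: leq_maxl.
  by apply: hM'; exact: leq_maxr.
- move=> w.
  have close k : (rho (e (N k (phi w))) w < k.+1%:R^-1)%R.
    have := NP k (phi w); rewrite -/(N k (phi w)) => -[[h _]|[_ h]].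
      by rewrite -dgE.
    have [|n] := dns w (k.+1%:R^-1)%R; first by rewrite invr_gt0.
    by rewrite sym => hn; have := h n; rewrite dgE hn.
  have inv_le m n : (m <= n)%N -> (n.+1%:R^-1 <= m.+1%:R^-1 :> R)%R.
    by move=> mn; rewrite lef_pV2 ?posrE// ler_nat ltnS.
  have Cw : C (phi w).
    move=> j; have [|i ij] := smallN (j.+1%:R^-1 / 2)%R.
      by rewrite divr_gt0// invr_gt0.
    exists i => m n im inn; apply: (le_lt_trans (tri _ w _)).
    rewrite [ltRHS]splitr ltrD//.
      by rewrite (lt_trans _ ij)// (lt_le_trans (close m))// inv_le.
    by rewrite sym (lt_trans _ ij)// (lt_le_trans (close n))// inv_le.
  apply: eq0 => r r0.
  have [|M hM] := psiP _ Cw (r / 2)%R; first by rewrite divr_gt0.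
  have [|i ir] := smallN (r / 2)%R; first by rewrite divr_gt0.
  apply: (le_lt_trans (tri _ (e (N (maxn M i) (phi w))) _)).
  rewrite [ltRHS]splitr ltrD//; first by rewrite sym hM// leq_maxl.
  by rewrite (lt_trans _ ir)// (lt_le_trans (close _))// inv_le// leq_maxr.
Qed.

(** * Disintegration *)

Lemma ex_dense_seq (R : realType) : exists q : nat -> R, dense_seq q.
Proof.
exists (fun n => ratr (odflt 0%R (@unpickle rat n))) => x y xy.
have [r] := rat_in_itvoo xy.
by rewrite in_itv/= => rxy; exists (pickle r); rewrite pickleK.
Qed.

(** Take the countably many products of basic balls contained in [G]. Applied to the complement of
    the edge set, this makes it measurable for the product of the two Borel sigma-algebras. *)
Lemma open_bigcup_rectangles (R : realType) (T1 T2 : topologicalType)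
  (rho1 : T1 -> T1 -> R) (e1 : nat -> T1) (rho2 : T2 -> T2 -> R) (e2 : nat -> T2)
  (G : set (T1 * T2)) :
  separating_metric rho1 e1 -> separating_metric rho2 e2 -> open G ->
  exists (U : nat -> set T1) (V : nat -> set T2),
    [/\ forall n, open (U n), forall n, open (V n) & G = \bigcup_n (U n `*` V n)].
Proof.
move=> m1 m2 oG.
pose B1 (p : nat * nat * nat) := [set y | rho1 (e1 p.1.1) y < p.2.+1%:R^-1]%R.
pose B2 (p : nat * nat * nat) := [set y | rho2 (e2 p.1.2) y < p.2.+1%:R^-1]%R.
pose ok p := `[< B1 p `*` B2 p `<=` G >].
pose pick n := @unpickle (nat * nat * nat)%type n.
exists (fun n => if pick n is Some p then if ok p then B1 p else set0 else set0).
exists (fun n => if pick n is Some p then B2 p else set0).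
split.
- move=> n; case: (pick n) => [p|]; last exact: open0.
  by case: ifP => _; [exact: smetric_ball_open m1 _ _|exact: open0].
- move=> n; case: (pick n) => [p|]; last exact: open0.
  exact: smetric_ball_open m2 _ _.
apply/seteqP; split=> [[x y] Gxy|[x y] [n _]]; last first.
  case: (pick n) => [p|]; last by case.
  by case: ifPn => [/asboolP h xy|_ []//]; exact: h.
have : nbhs (x, y) G by exact: open_nbhs_nbhs.
move=> [[U V] /= [Ux Vy] UV].
have [r1 r10 hr1] : exists2 r : R, (0 < r)%R & forall z, (rho1 x z < r)%R -> U z.
  move: Ux; rewrite nbhsE => -[Q [oQ Qx] QU].
  have [r r0 hr] := smetric_open_ball m1 oQ Qx.
  by exists r => // z /hr /QU.
have [r2 r20 hr2] : exists2 r : R, (0 < r)%R & forall z, (rho2 y z < r)%R -> V z.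
  move: Vy; rewrite nbhsE => -[Q [oQ Qy] QV].
  have [r r0 hr] := smetric_open_ball m2 oQ Qy.
  by exists r => // z /hr /QV.
pose r := Num.min r1 r2.
have r0 : (0 < r / 2)%R by rewrite divr_gt0// lt_min r10.
pose k := Num.truncn (r / 2)^-1.
have kr : (k.+1%:R^-1 < r / 2)%R by rewrite invf_plt ?posrE//; exact: truncnS_gt.
have k0 : (0 < k.+1%:R^-1 :> R)%R by rewrite invr_gt0.
have [a ha] := smetric_dense m1 x k0.
have [b hb] := smetric_dense m2 y k0.
have okp : ok (a, b, k).
  apply/asboolP => -[z w] /= [hz hw]; apply: UV; split => /=.
    apply: hr1; apply: (@lt_le_trans _ _ r); last by rewrite ge_min lexx.
    apply: (le_lt_trans (smetric_triangle m1 _ (e1 a) _)).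
    by rewrite [ltRHS]splitr ltrD// (lt_trans _ kr).
  apply: hr2; apply: (@lt_le_trans _ _ r); last by rewrite ge_min lexx orbT.
  apply: (le_lt_trans (smetric_triangle m2 _ (e2 b) _)).
  by rewrite [ltRHS]splitr ltrD// (lt_trans _ kr).
exists (pickle (a, b, k)) => //; rewrite /pick pickleK okp; split => /=.
- by rewrite /B1/= (smetric_sym m1).
- by rewrite /B2/= (smetric_sym m2).
Qed.

Lemma ex_kernel_integral d1 d2 (Y : measurableType d1) (X : measurableType d2)
  (R : realType) (eta : {finite_measure set Y -> \bar R}) (l : R.-pker Y ~> X) B :
  measurable B ->
  exists m : {finite_measure set X -> \bar R},
    forall A, m A = \int[eta]_(y in B) l y A.
Proof.
move=> mB; apply: ex_fmeasure.
- by rewrite integral0_eq// => y _; rewrite measure0.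
- by move=> A; exact: integral_ge0.
- move=> F mF tF mUF; rewrite [X in _ --> X](_ : _ =
    \int[eta]_(y in B) (\sum_(n <oo) l y (F n))); last first.
    apply: eq_integral => y _.
    by apply/esym/cvg_lim => //; exact/measure_semi_sigma_additive.
  apply/cvg_closeP; split.
    by apply: is_cvg_nneseries => n _ _; exact: integral_ge0.
  rewrite closeE// integral_nneseries// => n.
  apply: measurable_funTS; exact/measurable_kernel.
- apply: (@le_lt_trans _ _ (\int[eta]_(y in B) (cst 1 y))).
    apply: ge0_le_integral => //.
    + by apply: measurable_funTS; exact: measurable_kernel.
    + by move=> y _; rewrite prob_kernel.
  by rewrite integral_cst// mul1e fmeasure_lty.
Qed.

(** [X] is a measurable retract of the line with code in [0,1]: kernels into the line can be pushed
    to [X] by [psi]. *)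
Definition codable (R : realType) d (X : measurableType d) :=
  exists (phi : X -> R) (psi : R -> X),
  [/\ measurable_fun setT phi, measurable_fun setT psi, cancel phi psi &
      forall w, (0 <= phi w <= 1)%R].

Lemma ex_map_kernel d1 d2 d3 (Z : measurableType d1) (U : measurableType d2)
  (Y : measurableType d3) (R : realType) (l : R.-pker Z ~> U) (psi : U -> Y) :
  measurable_fun setT psi ->
  exists K : R.-pker Z ~> Y, forall z B, measurable B ->
    K z B = l z (psi @^-1` B).
Proof.
move=> mpsi.
have [|K HK] := @ex_kernel_image _ _ _ _ _ _ _ l (psi \o snd).
  exact: measurableT_comp.
by exists K => z B mB; rewrite HK.
Qed.

Lemma ex_pushforward d1 d2 (W : measurableType d1) (X : measurableType d2)
  (R : realType) (tau : {finite_measure set W -> \bar R}) (f : W -> X) :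
  measurable_fun setT f ->
  exists m : {finite_measure set X -> \bar R}, forall A, m A = tau (f @^-1` A).
Proof.
move=> mf.
have mfA A : measurable A -> measurable (f @^-1` A).
  by move=> mA; rewrite -[X in measurable X]setTI; exact: mf.
apply: ex_fmeasure.
- by rewrite preimage_set0 measure0.
- by move=> A.
- exact: (@measure_semi_sigma_additive _ _ _ (pushforward tau f)).
- by rewrite preimage_setT fmeasure_lty.
Qed.

Lemma ex_restr d (T : measurableType d) (R : realType)
  (mu : {finite_measure set T -> \bar R}) D : measurable D ->
  exists m : {finite_measure set T -> \bar R}, forall A, m A = mu (A `&` D).
Proof.
move=> mD.
exists (mfrestr mD (fmeasure_lty mu mD) : {finite_measure set T -> \bar R}).
by [].
Qed.

(** [cdf_kernel] is fed the measures B |-> tau (g in B, phi f < q n). Its kernel on the line agrees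
    with tau on rays, hence on all Borel sets, and [psi] brings it to [X]. *)
Lemma disintegration d1 d2 d3 (W : measurableType d1) (X : measurableType d2)
  (Y : measurableType d3) (R : realType) (tau : {finite_measure set W -> \bar R})
  (eta : {finite_measure set Y -> \bar R}) (f : W -> X) (g : W -> Y) :
  codable R X -> measurable_fun setT f -> measurable_fun setT g ->
  (forall B, measurable B -> eta B = tau (g @^-1` B)) ->
  exists K : R.-pker Y ~> X, forall A B, measurable A -> measurable B ->
    tau (f @^-1` A `&` g @^-1` B) = \int[eta]_(y in B) K y A.
Proof.
move=> [phi [psi [mphi mpsi phiK phi01]]] mf mg Heta.
have [q dq] := ex_dense_seq R.
have mfA A : measurable A -> measurable (f @^-1` A).
  by move=> mA; rewrite -[X in measurable X]setTI; exact: mf.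
have mgB B : measurable B -> measurable (g @^-1` B).
  by move=> mB; rewrite -[X in measurable X]setTI; exact: mg.
have mphiC (C : set (measurableTypeR R)) : measurable C -> measurable (phi @^-1` C).
  by move=> mC; rewrite -[X in measurable X]setTI; exact: mphi.
have mpsiA A : measurable A -> measurable (psi @^-1` A : set (measurableTypeR R)).
  by move=> mA; rewrite -[X in measurable X]setTI; exact: mpsi.
have [G HG] := @ex_pushforward _ _ W (measurableTypeR R) R tau (phi \o f)
  (measurableT_comp mphi mf).
have exL n : exists m : {finite_measure set Y -> \bar R}, forall B,
    m B = tau (g @^-1` B `&` f @^-1` (phi @^-1` `]-oo, q n[%classic)).
  have [|t Ht] := @ex_restr _ _ _ tau (f @^-1` (phi @^-1` `]-oo, q n[%classic)).
    exact/mfA/mphiC.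
  have [m Hm] := ex_pushforward t mg.
  by exists m => B; rewrite Hm Ht.
pose L n := projT1 (cid (exL n)).
have HL n B : L n B = tau (g @^-1` B `&` f @^-1` (phi @^-1` `]-oo, q n[%classic)).
  exact: projT2 (cid (exL n)) B.
have mL n B : measurable B ->
    measurable (g @^-1` B `&` f @^-1` (phi @^-1` `]-oo, q n[%classic)).
  by move=> mB; apply: measurableI; [exact: mgB|exact/mfA/mphiC].
have [|||||l Hl] := @cdf_kernel _ Y R q eta G L dq.
- move=> n B mB; rewrite HL Heta//; apply: le_measure; rewrite ?inE//.
  + exact: mL.
  + exact: mgB.
- move=> m n mn B mB; rewrite !HL; apply: le_measure; rewrite ?inE//.
  + exact: mL.
  + exact: mL.
  + apply: setIS => w /=; rewrite !in_itv/= => /lt_le_trans; exact.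
- by move=> n; rewrite HL HG preimage_setT setTI.
- move=> n q0; rewrite HL -(measure0 tau); congr (tau _).
  apply/seteqP; split => // w [_] /=; rewrite in_itv/= => /lt_le_trans /(_ q0).
  by rewrite ltNge (andP (phi01 _)).1.
- move=> n q1; rewrite HL Heta//; congr (tau _).
  apply/seteqP; split => // w _; split => //=; rewrite in_itv/=.
  by rewrite (le_lt_trans (andP (phi01 _)).2).
have [K HK] := ex_map_kernel l mpsi.
exists K => A B mA mB.
have [m1 Hm1] := ex_kernel_integral eta l mB.
have [|t Ht] := @ex_restr _ _ _ tau (g @^-1` B); first exact: mgB.
have [m2 Hm2] := @ex_pushforward _ _ W (measurableTypeR R) R t (phi \o f)
  (measurableT_comp mphi mf).
have m12 : forall C, measurable C -> m1 C = m2 C.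
  apply: (dense_ray_measure_unique dq) => n.
  by rewrite Hm1 Hl// HL Hm2 Ht setIC.
transitivity (m2 (psi @^-1` A)).
  rewrite Hm2 Ht; congr (tau (_ `&` _)).
  by apply/seteqP; split => w /=; rewrite phiK.
rewrite -m12; last exact: mpsiA.
by rewrite Hm1; apply: eq_integral => y _; rewrite HK.
Qed.

(** * Mass of the meet of two measures *)

Section meet_mass.
Context d (T : measurableType d) (R : realType).
Implicit Types P Q nu : {finite_measure set T -> \bar R}.

Definition meet_mass (t : R) P Q : \bar R :=
  ereal_inf [set P A + t%:E * Q (~` A) | A in measurable].

Lemma meet_mass_le t P Q A : measurable A ->
  meet_mass t P Q <= P A + t%:E * Q (~` A).
Proof. by move=> mA; apply: ereal_inf_lbound; exists A. Qed.

(** Cut the space along [A] and a competitor [B]. They price two of the four pieces alike, and on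
    the other two [A] takes the cheaper of P and t Q. *)
Lemma meet_mass_hahn t P Q A : (0 <= t)%R -> measurable A ->
  (forall B, measurable B -> B `<=` A -> P B <= t%:E * Q B) ->
  (forall B, measurable B -> B `<=` ~` A -> t%:E * Q B <= P B) ->
  meet_mass t P Q = P A + t%:E * Q (~` A).
Proof.
move=> t0 mA h1 h2; apply/eqP; rewrite eq_le meet_mass_le//=.
apply: le_ereal_inf_tmp => _ [B mB <-].
have mC (C : set T) : measurable C -> measurable (~` C) by exact: measurableC.
have eP : P B = P (B `&` A) + P (B `&` ~` A).
  rewrite -measureU//; try by apply: measurableI => //; exact: mC.
    by rewrite -setIUr setUv setIT.
  by rewrite setIACA setICr setI0.
have eQ : Q (~` B) = Q (~` B `&` A) + Q (~` B `&` ~` A).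
  rewrite -measureU//; try by apply: measurableI => //; exact: mC.
    by rewrite -setIUr setUv setIT.
  by rewrite setIACA setICr setI0.
have eP' : P A = P (B `&` A) + P (~` B `&` A).
  rewrite -measureU//; try by apply: measurableI => //; exact: mC.
    by rewrite -setIUl setUv setTI.
  by rewrite setIACA setICr set0I.
have eQ' : Q (~` A) = Q (B `&` ~` A) + Q (~` B `&` ~` A).
  rewrite -measureU//; try by apply: measurableI => //; exact: mC.
    by rewrite -setIUl setUv setTI.
  by rewrite setIACA setICr set0I.
rewrite eP eQ eP' eQ' !ge0_muleDr// -!addeA leeD2l// addeCA leeD//.
  by apply: h2; [apply: measurableI => //; exact: mC|move=> x []].
by rewrite leeD2r//; apply: h1; [apply: measurableI => //; exact: mC|move=> x []].
Qed.

Lemma le_integral_le_measure (t : R) P Q A (g : T -> \bar R) : (0 <= t)%R ->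
  measurable A -> (forall B, measurable B -> B `<=` A -> P B <= t%:E * Q B) ->
  measurable_fun setT g -> (forall x, 0 <= g x) ->
  \int[P]_(x in A) g x <= t%:E * \int[Q]_(x in A) g x.
Proof.
move=> t0 mA PQ mg g0.
have [PA HPA] := ex_restr P mA.
have [QA HQA] := ex_restr Q mA.
rewrite (@eq_measure_integral _ _ _ _ PA); last first.
  by move=> B mB BA; rewrite /= HPA setIidl.
rewrite [in leRHS](@eq_measure_integral _ _ _ _ QA); last first.
  by move=> B mB BA; rewrite /= HQA setIidl.
rewrite -(@ge0_integral_mscale _ _ _ QA _ mA (NngNum t0) g)//; last first.
  exact: measurable_funTS.
apply: ge0_le_measure_integral => // S mS.
change (PA S <= t%:E * QA S).
by rewrite HPA HQA; apply: PQ => //; exact: measurableI.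
Qed.

Lemma ge_integral_ge_measure (t : R) P Q A (g : T -> \bar R) : (0 <= t)%R ->
  measurable A -> (forall B, measurable B -> B `<=` A -> t%:E * Q B <= P B) ->
  measurable_fun setT g -> (forall x, 0 <= g x) ->
  t%:E * \int[Q]_(x in A) g x <= \int[P]_(x in A) g x.
Proof.
move=> t0 mA PQ mg g0.
have [PA HPA] := ex_restr P mA.
have [QA HQA] := ex_restr Q mA.
rewrite [in leRHS](@eq_measure_integral _ _ _ _ PA); last first.
  by move=> B mB BA; rewrite /= HPA setIidl.
rewrite [in leLHS](@eq_measure_integral _ _ _ _ QA); last first.
  by move=> B mB BA; rewrite /= HQA setIidl.
rewrite -(@ge0_integral_mscale _ _ _ QA _ mA (NngNum t0) g)//; last first.
  exact: measurable_funTS.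
apply: ge0_le_measure_integral => // S mS.
change (t%:E * QA S <= PA S).
by rewrite HPA HQA; apply: PQ => //; exact: measurableI.
Qed.

(** With s the ratio of P to P + nu, the absolutely continuous part is P on {s < 1}: where s <= 1 -
    1/(k+1), a nu-null set B satisfies P B <= (1 - 1/(k+1)) P B. On {s = 1} the measures P and P +
    nu agree, so nu vanishes there. *)
Lemma ex_lebesgue_decomposition P nu :
  exists Pac Ps, lebesgue_decomposition P nu Pac Ps.
Proof.
have [eta Heta] := ex_add_measure P nu.
have [|s [ms s01 sP]] := @ex_level_ratio _ _ _ P eta.
  by move=> A mA; rewrite Heta leeDl.
have sD := level_ratioP ms s01 sP.
pose N := ~` [set x | 1 <= s x]%R.
have mNC : measurable [set x | 1 <= s x]%R.
  rewrite [X in measurable X](_ : _ = ~` [set x | s x <= 1]%R `|` (s @^-1` [set 1%R])).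
    apply: measurableU; first exact/measurableC/measurable_le_set.
    by rewrite -[X in measurable X]setTI; exact: ms.
  apply/seteqP; split => x /=.
    by rewrite le_eqVlt => /orP[/eqP<-|]; [right|left; apply/negP; rewrite -ltNge].
  by move=> [/negP|->//]; rewrite -ltNge => /ltW.
have mN : measurable N by exact: measurableC.
have [Pac HPac] := ex_restr P mN.
have [Ps HPs] := ex_restr P mNC.
have split_ (mu : {finite_measure set T -> \bar R}) A : measurable A ->
    mu A = mu (A `&` N) + mu (A `&` [set x | 1 <= s x]%R).
  move=> mA; rewrite -measureU//; try exact: measurableI.
    by rewrite -setIUr setvU setIT.
  by rewrite setIACA setICl setI0.
exists Pac, Ps; split.
- by move=> A mA; rewrite HPac HPs -split_.
- apply/null_content_dominatesP => A mA nuA; rewrite HPac.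
  have -> : A `&` N = \bigcup_k (A `&` [set x | s x <= 1 - k.+1%:R^-1]%R).
    rewrite -setI_bigcupr; congr (_ `&` _); apply/seteqP; split => x /=.
      move=> /negP; rewrite -ltNge => sx; exists (Num.truncn (1 - s x)^-1) => //=.
      rewrite lerBrDr -lerBrDl ltW// invf_plt ?posrE ?subr_gt0//.
      exact: truncnS_gt.
    by move=> [k _] /= /le_lt_trans h; apply/negP; rewrite -ltNge; apply: h; rewrite gtrBl.
  have mAk k : measurable (A `&` [set x | s x <= 1 - k.+1%:R^-1]%R).
    by apply: measurableI => //; exact: measurable_le_set.
  apply/negligibleP; first exact: bigcup_measurable.
  apply: negligible_bigcup => k; apply/negligibleP; first exact: mAk.
  set B := A `&` _.
  pose t : R := (1 - k.+1%:R^-1)%R.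
  have t0 : (0 <= t)%R by rewrite subr_ge0 invf_le1// ler1n.
  have t1 : (t < 1)%R by rewrite gtrBl.
  have := (sP t t0).1 B (mAk k) (@subIsetr _ _ _).
  have nuB : nu B = 0.
    apply/eqP; rewrite eq_le measure_ge0 andbT -nuA; apply: le_measure; rewrite ?inE//.
      exact: (mAk k).
    by move=> x [].
  rewrite Heta nuB adde0.
  have Bfin : P B \is a fin_num by rewrite fin_num_measure//; exact: mAk.
  rewrite -(fineK Bfin) -EFinM lee_fin => h.
  have P0 : (0 <= fine (P B))%R by rewrite fine_ge0.
  change (P B = 0); rewrite -(fineK Bfin); congr _%:E; apply/eqP; rewrite eq_le P0 andbT; nra.
- exists N => //; rewrite HPs setICl measure0; split => //.
  have e1 : \int[eta]_(x in [set x | 1 <= s x]%R) (s x)%:E = eta [set x | 1 <= s x]%R.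
    rewrite (eq_integral (cst 1)); first by rewrite integral_cst// mul1e.
    move=> x; rewrite inE/= => h; congr _%:E; apply/eqP; rewrite eq_le h.
    by rewrite (andP (s01 x)).2.
  rewrite setCK; have := sD _ mNC; rewrite e1 Heta.
  have f1 : P [set x | 1 <= s x]%R \is a fin_num by exact: fin_num_measure.
  have f2 : nu [set x | 1 <= s x]%R \is a fin_num by exact: fin_num_measure.
  rewrite -(fineK f1) -(fineK f2) -EFinD => -[h]; congr _%:E; lra.
Qed.

Lemma ex_lebesgue_density P nu : exists r, Defs.lebesgue_density P nu r.
Proof.
have [Pac [Ps [Pdec Pdom Psing]]] := ex_lebesgue_decomposition P nu.
have [f [f0 intf fP]] := radon_nikodym_finite Pdom.
have mf : measurable_fun setT f by exact: measurable_int intf.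
exists (fine \o f); split.
- by move=> x; rewrite /= fine_ge0.
- exact: measurableT_comp.
exists Ps => // A mA; rewrite Pdec// fP//; congr (_ + _).
apply: ae_eq_integral => //.
- exact: measurable_funTS.
- by apply: measurable_funTS; apply/measurable_EFinP; exact: measurableT_comp.
have := integrable_ae measurableT intf; apply: filterS => x h _.
by rewrite /= fineK// h.
Qed.

(** Identifies the left side of level-optimality with H_t. The infimum is attained at {r <= t}
    intersected with [N], which avoids the singular part of P and is conull for nu. *)
Lemma integral_min_density P nu r t : Defs.lebesgue_density P nu r -> (0 < t)%R ->
  \int[nu]_y (Num.min (r y) t)%:E = meet_mass t P nu.
Proof.
move=> [r0 mr [Ps [N mN [PsN nuN]] HP]] t0.
have mm : measurable_fun setT (fun y => (Num.min (r y) t)%:E).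
  by apply/measurable_EFinP; apply: measurable_minr.
have m0 y : 0 <= (Num.min (r y) t)%:E by rewrite lee_fin le_min r0 ltW.
have sp A : measurable A -> \int[nu]_y (Num.min (r y) t)%:E =
    \int[nu]_(y in A) (Num.min (r y) t)%:E + \int[nu]_(y in ~` A) (Num.min (r y) t)%:E.
  move=> mA; rewrite -[in LHS](setUv A) ge0_integral_setU//.
  - exact: measurableC.
  - by rewrite setUv.
  - by rewrite disj_set2E setICr.
have mEr : measurable_fun setT (EFin \o r) by exact/measurable_EFinP.
apply/eqP; rewrite eq_le; apply/andP; split.
  apply: le_ereal_inf_tmp => _ [A mA <-]; rewrite (sp A mA) HP// leeD//.
    apply: (@le_trans _ _ (\int[nu]_(x in A) (r x)%:E)); last by rewrite leeDl.
    apply: ge0_le_integral => //.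
    + exact: measurable_funTS.
    + exact: measurable_funTS.
    + by move=> x _; rewrite lee_fin ge_min lexx.
  rewrite -integral_cst; last exact: measurableC.
  apply: ge0_le_integral => //.
  + exact: measurableC.
  + exact: measurable_funTS.
  + by move=> x _; rewrite lee_fin ge_min lexx orbT.
pose A := [set x | r x <= t]%R `&` N.
have mA : measurable A by apply: measurableI => //; exact: measurable_le_set.
rewrite (le_trans (meet_mass_le t P nu mA))// (sp A mA) leeD//.
  have PsA : Ps A = 0.
    apply/eqP; rewrite eq_le measure_ge0 andbT -PsN; apply: le_measure; rewrite ?inE//.
    exact: subIsetr.
  rewrite HP// PsA adde0 le_eqVlt; apply/orP; left; apply/eqP.
  apply: eq_integral => x; rewrite inE => -[/= rt _].
  by rewrite min_l.
pose D := [set x | t < r x]%R.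
have mD : measurable D by exact: measurable_lt_set.
have AD : ~` A = D `|` ~` N.
  rewrite setCI; congr (_ `|` _); apply/seteqP; split => x /=.
    by move=> /negP; rewrite -ltNge.
  by move=> tr; apply/negP; rewrite -ltNge.
have nuAD : nu (~` A) <= nu D.
  have h : nu (D `|` ~` N) <= nu D + nu (~` N).
    by apply: measureU2 => //; exact: measurableC.
  by rewrite AD (le_trans h)// nuN adde0.
apply: (@le_trans _ _ (t%:E * nu D)); first by rewrite lee_wpmul2l// lee_fin ltW.
rewrite -integral_cst//.
apply: (@le_trans _ _ (\int[nu]_(y in D) (Num.min (r y) t)%:E)).
  apply: ge0_le_integral => //.
  + by move=> x _; rewrite lee_fin ltW.
  + exact: measurable_funTS.
  + by move=> x /ltW tr; rewrite /= lee_fin min_r.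
apply: ge0_subset_integral => //.
- exact: measurableC.
- exact: measurable_funTS.
- by rewrite AD; left.
Qed.

End meet_mass.

Definition meet_divergence (R : realType) (t : R) : divergence R :=
  fun d T P Q => - meet_mass t P Q.

Lemma meet_divergence_DPI (R : realType) (t : R) : (0 <= t)%R ->
  channel_DPI (meet_divergence t).
Proof.
move=> t0 d d' X Y K P Q KP KQ hP hQ; rewrite /meet_divergence leeN2.
have [A mA [h1 h2]] := hahn_le P Q t0.
have mAC : measurable (~` A) by exact: measurableC.
apply: le_ereal_inf_tmp => _ [B mB <-].
have mBC : measurable (~` B) by exact: measurableC.
rewrite (le_trans (meet_mass_le t P Q mA))// hP// hQ//.
have mK C : measurable C -> measurable_fun setT (K ^~ C).
  by move=> mC; exact: measurable_kernel.
have sp (mu : {finite_measure set X -> \bar R}) C : measurable C ->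
    \int[mu]_x K x C = \int[mu]_(x in A) K x C + \int[mu]_(x in ~` A) K x C.
  move=> mC; rewrite -[in LHS](setUv A) ge0_integral_setU//.
  - by rewrite setUv; exact: mK.
  - by rewrite disj_set2E setICr.
have one (mu : {finite_measure set X -> \bar R}) D : measurable D ->
    mu D = \int[mu]_(x in D) K x B + \int[mu]_(x in D) K x (~` B).
  move=> mD; rewrite -ge0_integralD//; try by apply: measurable_funTS; exact: mK.
  rewrite -[LHS]mul1e -integral_cst//; apply: eq_integral => x _.
  by rewrite -measure_setT_split// prob_kernel.
rewrite !sp// ge0_muleDr ?integral_ge0// addeACA leeD//.
  rewrite (one P A mA) leeD//.
  by apply: le_integral_le_measure => //; exact: mK.
rewrite (one Q (~` A) mAC) ge0_muleDr ?integral_ge0// leeD//.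
by apply: ge_integral_ge_measure => //; exact: mK.
Qed.

(** * Convex order of likelihood ratios *)

Section bounded_measurable.
Context d (T : measurableType d) (R : realType).
Implicit Types (mu : {finite_measure set T -> \bar R}) (f g : T -> R).

Definition bounded_measurable g :=
  measurable_fun setT g /\ exists M : R, forall x, (`|g x| <= M)%R.

Lemma bounded_measurable_integrable mu g : bounded_measurable g ->
  mu.-integrable setT (EFin \o g).
Proof.
move=> [mg [M gM]]; apply: measurable_bounded_integrable => //.
  exact: fmeasure_lty.
exists M; split; first exact: num_real.
by move=> x Mx y _ /=; rewrite (le_trans (gM y))// ltW.
Qed.

Lemma bounded_measurable_cst (c : R) : bounded_measurable (fun=> c).
Proof. by split=> //; exists `|c|%R. Qed.

Lemma bounded_measurableD f g : bounded_measurable f -> bounded_measurable g ->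
  bounded_measurable (fun x => f x + g x)%R.
Proof.
move=> [mf [M fM]] [mg [N gN]]; split; first exact: measurable_funD.
by exists (M + N)%R => x; rewrite (le_trans (ler_normD _ _))// lerD.
Qed.

Lemma bounded_measurableM f g : bounded_measurable f -> bounded_measurable g ->
  bounded_measurable (fun x => f x * g x)%R.
Proof.
move=> [mf [M fM]] [mg [N gN]]; split; first exact: measurable_funM.
by exists (M * N)%R => x; rewrite normrM ler_pM.
Qed.

Lemma bounded_measurableZ c f : bounded_measurable f ->
  bounded_measurable (fun x => c * f x)%R.
Proof. by move=> bf; apply: bounded_measurableM => //; exact: bounded_measurable_cst. Qed.

Lemma bounded_measurableB f g : bounded_measurable f -> bounded_measurable g ->
  bounded_measurable (fun x => f x - g x)%R.
Proof.
move=> bf [mg [N gN]]; apply: bounded_measurableD => //.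
split; first exact: measurableT_comp.
by exists N => x; rewrite normrN.
Qed.

Lemma bounded_measurable_sum (I : Type) (r : seq I) (p : pred I) (F : I -> T -> R) :
  (forall i, p i -> bounded_measurable (F i)) ->
  bounded_measurable (fun x => \sum_(i <- r | p i) F i x)%R.
Proof.
move=> bF; elim: r => [|i r IH].
  rewrite [X in bounded_measurable X](_ : _ = fun=> 0%R).
    exact: bounded_measurable_cst.
  by apply/funext => x; rewrite big_nil.
have [pi|pi] := boolP (p i); last first.
  rewrite [X in bounded_measurable X](_ : _ = fun x => \sum_(i <- r | p i) F i x)%R//.
  by apply/funext => x; rewrite big_cons (negbTE pi).
rewrite [X in bounded_measurable X](_ : _ =
  fun x => F i x + \sum_(i <- r | p i) F i x)%R.
  exact: bounded_measurableD (bF i pi) IH.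
by apply/funext => x; rewrite big_cons pi.
Qed.

Lemma bounded_measurable01 g : measurable_fun setT g ->
  (forall x, 0 <= g x <= 1)%R -> bounded_measurable g.
Proof.
by move=> mg g01; split=> //; exists 1%R => x; rewrite ger0_norm; case/andP: (g01 x).
Qed.

Lemma bounded_measurable_indic A : measurable A ->
  bounded_measurable (\1_A : T -> R).
Proof.
move=> mA; apply: bounded_measurable01; first exact: measurable_indic.
by move=> x; rewrite indicE ler0n lern1 leq_b1.
Qed.

Lemma Rint_add mu f g : bounded_measurable f -> bounded_measurable g ->
  Rintegral mu setT (fun x => f x + g x)%R =
  (Rintegral mu setT f + Rintegral mu setT g)%R.
Proof. by move=> bf bg; rewrite RintegralD//; exact: bounded_measurable_integrable. Qed.

Lemma Rint_sub mu f g : bounded_measurable f -> bounded_measurable g ->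
  Rintegral mu setT (fun x => f x - g x)%R =
  (Rintegral mu setT f - Rintegral mu setT g)%R.
Proof. by move=> bf bg; rewrite RintegralB//; exact: bounded_measurable_integrable. Qed.

Lemma Rint_scale mu c f : bounded_measurable f ->
  Rintegral mu setT (fun x => c * f x)%R = (c * Rintegral mu setT f)%R.
Proof. by move=> bf; rewrite RintegralZl//; exact: bounded_measurable_integrable. Qed.

Lemma Rint_le mu f g : bounded_measurable f -> bounded_measurable g ->
  (forall x, f x <= g x)%R -> (Rintegral mu setT f <= Rintegral mu setT g)%R.
Proof. by move=> bf bg fg; apply: le_Rintegral => //; exact: bounded_measurable_integrable. Qed.

Lemma Rint_cst mu c : Rintegral mu setT (fun=> c) = (c * fine (mu setT))%R.
Proof. exact: Rintegral_cst. Qed.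

Lemma Rint_indic mu A : measurable A -> Rintegral mu setT (\1_A : T -> R) = fine (mu A).
Proof. by move=> mA; rewrite /Rintegral integral_indic// setIT. Qed.

Lemma Rint_sum mu (I : Type) (r : seq I) (p : pred I) (F : I -> T -> R) :
  (forall i, p i -> bounded_measurable (F i)) ->
  Rintegral mu setT (fun x => \sum_(i <- r | p i) F i x)%R =
  (\sum_(i <- r | p i) Rintegral mu setT (F i))%R.
Proof.
move=> bF; elim: r => [|i r IH].
  rewrite big_nil -[RHS](mul0r (fine (mu setT))) -Rint_cst.
  by apply: eq_Rintegral => x _; rewrite big_nil.
rewrite big_cons; case: ifPn => pi; last first.
  by rewrite -IH; apply: eq_Rintegral => x _; rewrite big_cons (negbTE pi).
rewrite -IH -Rint_add//; last 2 first.
- exact: bF.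
- exact: bounded_measurable_sum.
by apply: eq_Rintegral => x _; rewrite big_cons pi.
Qed.

(** Change of measure by uniqueness: g alpha and (g a) eta both have level ratio [a] with respect to
    g eta. *)
Lemma Rint_density (a : T -> R) (alpha eta : {finite_measure set T -> \bar R}) g :
  measurable_fun setT a -> (forall x, 0 <= a x <= 1)%R -> level_ratio a alpha eta ->
  measurable_fun setT g -> (forall x, 0 <= g x <= 1)%R ->
  Rintegral alpha setT g = Rintegral eta setT (fun x => g x * a x)%R.
Proof.
move=> ma a01 ha mg g01.
have fin (mu : {finite_measure set T -> \bar R}) (f : T -> R) : measurable_fun setT f ->
   (forall x, 0 <= f x <= 1)%R -> exists nu : {finite_measure set T -> \bar R},
   forall A, nu A = \int[mu]_(x in A) (f x)%:E.
  move=> mf f01; apply: ex_density_measure; first exact/measurable_EFinP.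
    by move=> x; rewrite lee_fin (andP (f01 x)).1.
  apply: (@le_lt_trans _ _ (\int[mu]_x (1%:E))).
    apply: ge0_le_integral => //.
    + by move=> x _; rewrite lee_fin (andP (f01 x)).1.
    + exact/measurable_EFinP.
    + by move=> x _; rewrite lee_fin (andP (f01 x)).2.
  by rewrite integral_cst// mul1e fmeasure_lty.
have mga : measurable_fun setT (fun x => g x * a x)%R by exact: measurable_funM.
have ga01 x : (0 <= g x * a x <= 1)%R.
  have /andP[g0 g1] := g01 x; have /andP[a0 a1] := a01 x.
  by rewrite mulr_ge0//= mulr_ile1.
have [l1 H1] := fin alpha g mg g01.
have [l2 H2] := fin eta _ mga ga01.
have [e He] := fin eta g mg g01.
have mEg : measurable_fun setT (EFin \o g) by exact/measurable_EFinP.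
have g0 x : 0 <= (EFin \o g) x by rewrite lee_fin (andP (g01 x)).1.
rewrite /Rintegral -H1 -H2; congr fine.
apply: (level_ratio_unique ma a01 (eta := e)) => // t t0; have [h1 h2] := ha t t0.
- split => B mB Bt; rewrite H1 He.
  + apply: le_integral_le_measure => // C mC CB; apply: h1 => //.
    exact: subset_trans CB Bt.
  + apply: ge_integral_ge_measure => // C mC CB; apply: h2 => //.
    exact: subset_trans CB Bt.
have sc B : measurable B -> t%:E * e B = \int[eta]_(x in B) (t%:E * (EFin \o g) x).
  by move=> mB; rewrite He ge0_integralZl//; exact: measurable_funTS.
have mt B : measurable B -> measurable_fun B (fun x => t%:E * (EFin \o g) x).
  by move=> mB; apply: measurable_funTS; exact: emeasurable_funM.
have mEga B : measurable B -> measurable_fun B (fun x => (g x * a x)%:E).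
  by move=> mB; apply: measurable_funTS; exact/measurable_EFinP.
split => B mB Bt; rewrite H2 sc//; apply: ge0_le_integral => //.
- by move=> x _; rewrite lee_fin (andP (ga01 x)).1.
- exact: mEga.
- exact: mt.
- move=> x Bx; rewrite /= -EFinM lee_fin mulrC ler_wpM2r ?(andP (g01 x)).1//.
  exact: Bt.
- by move=> x _; rewrite mule_ge0// lee_fin.
- exact: mt.
- exact: mEga.
- move=> x Bx; rewrite /= -EFinM lee_fin [leRHS]mulrC ler_wpM2r ?(andP (g01 x)).1//.
  exact/ltW/Bt.
Qed.

End bounded_measurable.

Section hockey_stick.
Context d (T : measurableType d) (R : realType).
Variables (alpha beta eta : {finite_measure set T -> \bar R}) (a : T -> R).
Hypothesis etaE : forall A, eta A = alpha A + beta A.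
Hypothesis ma : measurable_fun setT a.
Hypothesis a01 : forall x, (0 <= a x <= 1)%R.
Hypothesis ha : level_ratio a alpha eta.

(** The hockey-stick divergence of alpha from u eta, written as an integral of the ratio. At u = 0
    it is the mass of alpha. *)
Definition hockey (u : R) := Rintegral eta setT (fun x => Num.max (a x - u) 0)%R.

Lemma bounded_measurable_hockey u :
  bounded_measurable (fun x => Num.max (a x - u) 0)%R.
Proof.
split; first by apply: measurable_maxr => //; exact: measurable_funB.
exists (1 + `|u|)%R => x; rewrite ger0_norm ?le_max ?lexx ?orbT// ge_max.
rewrite addr_ge0// andbT lerD//; first by case/andP: (a01 x).
by rewrite -normrN ler_norm.
Qed.

Lemma hockeyE u : hockey u = (fine (alpha [set x | u < a x]%R) -
  u * fine (eta [set x | u < a x]%R))%R.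
Proof.
have mA : measurable [set x | u < a x]%R by exact: measurable_lt_set.
rewrite -(Rint_indic alpha mA) -(Rint_indic eta mA).
rewrite (Rint_density ma a01 ha); last 2 first.
- exact: measurable_indic.
- by move=> x; rewrite indicE ler0n lern1 leq_b1.
have bi := bounded_measurable_indic R mA.
rewrite -Rint_scale// -Rint_sub//; last 2 first.
- by apply: bounded_measurableM => //; exact: bounded_measurable01.
- exact: bounded_measurableZ.
apply: eq_Rintegral => x _; rewrite indicE.
have [xA|xA] := boolP (x \in [set x | u < a x]%R).
  by move: (xA); rewrite inE/= => ux; rewrite max_l ?subr_ge0 ?ltW// mul1r mulr1.
move: (xA); rewrite notin_setE/= => /negP; rewrite -leNgt => ux.
by rewrite max_r ?subr_le0// mul0r mulr0 subrr.
Qed.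

Lemma hockey0 : hockey 0 = fine (alpha setT).
Proof.
have mA : measurable [set x | 0 < a x]%R by exact: measurable_lt_set.
have e0 : alpha (~` [set x | 0 < a x]%R) = 0.
  apply/eqP; rewrite eq_le measure_ge0 andbT.
  have := (ha (lexx 0%R)).1 (~` [set x | 0 < a x]%R); rewrite mul0e; apply.
    exact: measurableC.
  by move=> x /= /negP; rewrite -leNgt.
have -> : alpha setT = alpha [set x | 0 < a x]%R + alpha (~` [set x | 0 < a x]%R).
  exact: measure_setT_split.
by rewrite e0 adde0 hockeyE mul0r subr0.
Qed.

Lemma hockey1 : hockey 1 = 0%R.
Proof.
rewrite -[RHS](mul0r (fine (eta setT))) -Rint_cst; apply: eq_Rintegral => x _.
by rewrite max_r// subr_le0; case/andP: (a01 x).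
Qed.

(** Since eta = alpha + beta, alpha <= u eta on a set amounts to alpha <= u / (1 - u) beta, so {a <=
    u} is a Hahn set for this t. *)
Lemma meet_mass_hockey u : (0 < u < 1)%R ->
  meet_mass (u / (1 - u)) alpha beta =
  (fine (alpha setT) - (1 - u)^-1 * hockey u)%:E.
Proof.
move=> /andP[u0 u1]; have u1' : (0 < 1 - u)%R by rewrite subr_gt0.
pose A := [set x | a x <= u]%R.
have mA : measurable A by exact: measurable_le_set.
have mAC : measurable (~` A) by exact: measurableC.
have fin (mu : {finite_measure set T -> \bar R}) B : measurable B ->
    mu B = (fine (mu B))%:E by move=> mB; rewrite fineK// fin_num_measure.
have fE B : measurable B -> fine (eta B) = (fine (alpha B) + fine (beta B))%R.
  by move=> mB; rewrite etaE fineD// fin_num_measure.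
rewrite (@meet_mass_hahn _ _ _ _ _ _ A)//.
- have AC : ~` A = [set x | u < a x]%R.
    by apply/seteqP; split => x /=; rewrite ltNge => /negP.
  rewrite hockeyE -AC fE// (measure_setT_split _ mA).
  rewrite fineD ?fin_num_measure// [in LHS]fin// [beta _]fin// -EFinM -EFinD.
  congr _%:E; have ne : (1 - u != 0)%R by rewrite gt_eqF.
  by field.
- by rewrite divr_ge0// ltW.
- move=> B mB BA; rewrite fin// [beta _]fin// -EFinM lee_fin mulrAC.
  rewrite ler_pdivlMr//; have := (ha (ltW u0)).1 B mB BA.
  by rewrite fin// [eta _]fin// fE// -EFinM lee_fin => h; lra.
- move=> B mB BA; rewrite [alpha _]fin// [beta _]fin// -EFinM lee_fin mulrAC.
  have BA' : B `<=` [set x | u < a x]%R.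
    by move=> x /BA /= /negP; rewrite -ltNge.
  rewrite ler_pdivrMr//; have := (ha (ltW u0)).2 B mB BA'.
  by rewrite [eta _]fin// [alpha _]fin// fE// -EFinM lee_fin => h; lra.
Qed.

End hockey_stick.

(** The levels 0 and 1 correspond to no t > 0: at 0 equality of the masses of [al] and [P] decides,
    at 1 both sides vanish. *)
Lemma hockey_le_of_meet_mass d1 d2 (T1 : measurableType d1) (T2 : measurableType d2)
  (R : realType) (al be eta : {finite_measure set T1 -> \bar R})
  (P nu m : {finite_measure set T2 -> \bar R}) (a : T1 -> R) (s : T2 -> R) :
  (forall A, eta A = al A + be A) -> (forall A, m A = P A + nu A) ->
  measurable_fun setT a -> measurable_fun setT s ->
  (forall x, 0 <= a x <= 1)%R -> (forall x, 0 <= s x <= 1)%R ->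
  level_ratio a al eta -> level_ratio s P m ->
  al setT = P setT ->
  (forall t : R, (0 < t)%R -> meet_mass t al be <= meet_mass t P nu) ->
  forall u : R, (0 <= u <= 1)%R -> (hockey m s u <= hockey eta a u)%R.
Proof.
move=> etaE mE ma ms a01 s01 ha hs tot mm u /andP[].
rewrite le_eqVlt => /predU1P[<- _|u0].
  by rewrite (hockey0 ma a01 ha) (hockey0 ms s01 hs) tot.
rewrite le_eqVlt => /predU1P[->|u1]; first by rewrite !hockey1.
have u1' : (0 < 1 - u)%R by rewrite subr_gt0.
have := mm (u / (1 - u))%R (divr_gt0 u0 u1').
rewrite (meet_mass_hockey etaE ma a01 ha) ?u0// (meet_mass_hockey mE ms s01 hs) ?u0//.
by rewrite lee_fin tot lerD2l lerN2 ler_pM2l// invr_gt0.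
Qed.

Section convex_order.
Context d1 d2 (T1 : measurableType d1) (T2 : measurableType d2) (R : realType).
Variables (eta : {finite_measure set T1 -> \bar R})
  (m : {finite_measure set T2 -> \bar R}) (a : T1 -> R) (s : T2 -> R).
Hypotheses (ma : measurable_fun setT a) (ms : measurable_fun setT s)
  (a01 : forall x, (0 <= a x <= 1)%R) (s01 : forall x, (0 <= s x <= 1)%R)
  (tot : eta setT = m setT)
  (hle : forall u : R, (0 <= u <= 1)%R -> (hockey m s u <= hockey eta a u)%R)
  (h0 : hockey m s 0 = hockey eta a 0).
Variables (f : R -> R) (L : R).
Hypotheses (bfa : bounded_measurable (f \o a)) (bfs : bounded_measurable (f \o s))
  (fL : forall x y, (`|f x - f y| <= L * `|x - y|)%R)
  (fconv : forall x h, (f x *+ 2 <= f (x + h) + f (x - h))%R).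

Let L0 : (0 <= L)%R.
Proof.
by have := fL 1 0; rewrite subr0 normr1 mulr1; apply: le_trans.
Qed.

(* [interp N n] interpolates [f] linearly at the points [j / N], [j <= n], and is
   constant after [n / N]. *)
Let pos (x : R) : R := Num.max x 0%R.
Let Delta N j : R := (f (j.+1%:R / N%:R) - f (j%:R / N%:R))%R.
Let interp N n x : R := (f 0 + \sum_(j < n) Delta N j * N%:R *
   (pos (x - j%:R / N%:R) - pos (x - j.+1%:R / N%:R)))%R.

(** Induction on the number of nodes. Only the last cell is new; there the value and the linear
    increment each differ from a node value by at most L / N. *)
Let interp_approx N n (x : R) : (0 < N)%N -> (0 <= x)%R ->
  (n%:R / N%:R <= x -> interp N n x = f (n%:R / N%:R))%R /\
  (x <= n%:R / N%:R -> `|interp N n x - f x| <= 2 * L / N%:R)%R.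
Proof.
move=> N0 x0; have N0' : (0 < N%:R :> R)%R by rewrite ltr0n.
elim: n => [|n [IH1 IH2]].
  rewrite /interp big_ord0 addr0 mul0r; split => // xle.
  have -> : x = 0%R by apply/eqP; rewrite eq_le xle.
  by rewrite subrr normr0 divr_ge0// mulr_ge0.
have rec : interp N n.+1 x = (interp N n x + Delta N n * N%:R *
   (pos (x - n%:R / N%:R) - pos (x - n.+1%:R / N%:R)))%R.
  by rewrite /interp big_ord_recr/= addrA.
have nn : (n.+1%:R / N%:R = n%:R / N%:R + N%:R^-1 :> R)%R.
  by rewrite -natr1 mulrDl mul1r.
have i0 : (0 < N%:R^-1 :> R)%R by rewrite invr_gt0.
split=> xn.
  have xn' : (n%:R / N%:R <= x)%R by lra.
  rewrite rec IH1// /pos !max_l ?subr_ge0// /Delta nn.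
  have ne : (N%:R != 0 :> R)%R by rewrite gt_eqF.
  have -> : (x - n%:R / N%:R - (x - (n%:R / N%:R + N%:R^-1)) = N%:R^-1)%R by ring.
  by rewrite -mulrA divff// mulr1 addrC subrK.
have [xn'|/ltW xn'] := leP x (n%:R / N%:R)%R.
  rewrite rec /pos !max_r ?subr_le0// subrr mulr0 addr0; exact: IH2.
rewrite rec IH1// /pos max_l ?subr_ge0// max_r ?subr_le0// subr0.
set y := (n%:R / N%:R)%R in nn xn' *.
have -> : (f y + Delta N n * N%:R * (x - y) - f x =
  (f y - f x) + Delta N n * (N%:R * (x - y)))%R by ring.
apply: (le_trans (ler_normD _ _)).
have -> : (2 * L / N%:R = L / N%:R + L / N%:R :> R)%R by ring.
have xy : (x - y <= N%:R^-1)%R by lra.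
apply: lerD.
  rewrite (le_trans (fL _ _))// ler_wpM2l// distrC ger0_norm ?subr_ge0//.
rewrite normrM (ger0_norm (x := (N%:R * _)%R)) ?mulr_ge0 ?subr_ge0//.
apply: (@le_trans _ _ `|Delta N n|%R).
  by rewrite -[leRHS]mulr1 ler_wpM2l// mulrC -ler_pdivlMr// mul1r.
rewrite /Delta -/y (le_trans (fL _ _))// nn addrAC subrr add0r.
by rewrite gtr0_norm.
Qed.

Let bounded_measurable_pos d (T : measurableType d) (g : T -> R) u :
  measurable_fun setT g -> (forall x, 0 <= g x <= 1)%R ->
  bounded_measurable (fun x => pos (g x - u)).
Proof. by move=> mg g01; exact: bounded_measurable_hockey. Qed.

Let Rint_interp d (T : measurableType d) (mu : {finite_measure set T -> \bar R})
  (g : T -> R) N : measurable_fun setT g -> (forall x, 0 <= g x <= 1)%R ->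
  bounded_measurable (interp N N \o g) /\
  Rintegral mu setT (interp N N \o g) = (f 0 * fine (mu setT) + \sum_(j < N)
    Delta N j * N%:R * (hockey mu g (j%:R / N%:R) - hockey mu g (j.+1%:R / N%:R)))%R.
Proof.
move=> mg g01.
have bp u : bounded_measurable (fun x => pos (g x - u)).
  exact: bounded_measurable_pos.
have bt (j : 'I_N) : bounded_measurable (fun x => Delta N j * N%:R *
   (pos (g x - j%:R / N%:R) - pos (g x - j.+1%:R / N%:R)))%R.
  by apply: bounded_measurableZ; exact: bounded_measurableB.
have bs : bounded_measurable (fun x => \sum_(j < N) Delta N j * N%:R *
   (pos (g x - j%:R / N%:R) - pos (g x - j.+1%:R / N%:R)))%R.
  by apply: bounded_measurable_sum => j _.
split.
  by apply: (bounded_measurableD (bounded_measurable_cst T (f 0%R)) bs).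
rewrite /interp Rint_add//; last exact: bounded_measurable_cst.
rewrite Rint_cst Rint_sum; last by move=> j _.
congr (_ + _)%R; apply: eq_bigr => j _.
rewrite Rint_scale; last exact: bounded_measurableB.
by rewrite Rint_sub.
Qed.

(** Summation by parts: the difference of the integrals is a sum of increments of slopes,
    nonnegative by convexity, times hockey-stick gaps. The boundary terms vanish because the gap is
    0 at both ends. *)
Let interp_le N : (0 < N)%N ->
  (Rintegral m setT (interp N N \o s) <= Rintegral eta setT (interp N N \o a))%R.
Proof.
move=> N0; rewrite (Rint_interp m N ms s01).2 (Rint_interp eta N ma a01).2 tot lerD2l.
have N0' : (0 < N%:R :> R)%R by rewrite ltr0n.
pose e j := (hockey eta a (j%:R / N%:R) - hockey m s (j%:R / N%:R))%R.
rewrite -subr_ge0 -sumrB.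
(* The boundary term is kept in the partial sums to make the induction close; at n = N - 1 it
   contains [e N] = 0. *)
suff key n : (n < N)%N -> (- (Delta N n * N%:R * e n.+1) <= \sum_(j < n.+1)
    (Delta N j * N%:R * (hockey eta a (j%:R / N%:R) - hockey eta a (j.+1%:R / N%:R)) -
     Delta N j * N%:R * (hockey m s (j%:R / N%:R) - hockey m s (j.+1%:R / N%:R))))%R.
  have := key N.-1; rewrite prednK// leqnn => /(_ isT); apply: le_trans.
  by rewrite /e divff ?gt_eqF// !hockey1// subrr mulr0 oppr0.
elim: n => [|n IH] nN.
  rewrite big_ord_recl big_ord0 addr0 /= /e mul0r h0; lra.
rewrite big_ord_recr/=; apply: le_trans (lerD (IH (ltnW nN)) (lexx _)).
have en : (0 <= e n.+1)%R.
  rewrite subr_ge0 hle// divr_ge0//= ler_pdivrMr// mul1r ler_nat; exact: ltnW.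
have D2 : (Delta N n <= Delta N n.+1)%R.
  rewrite /Delta; have := fconv (n.+1%:R / N%:R)%R (N%:R^-1)%R.
  have -> : (n.+1%:R / N%:R + N%:R^-1 = n.+2%:R / N%:R :> R)%R.
    by rewrite -[in RHS]natr1 mulrDl mul1r.
  have -> : (n.+1%:R / N%:R - N%:R^-1 = n%:R / N%:R :> R)%R.
    by rewrite -[in LHS]natr1 mulrDl mul1r addrK.
  by rewrite mulr2n => h; lra.
have D3 : (0 <= (Delta N n.+1 - Delta N n) * N%:R * e n.+1)%R.
  by rewrite mulr_ge0// mulr_ge0 ?subr_ge0// ltW.
rewrite -subr_ge0; apply: le_trans D3 _; rewrite le_eqVlt; apply/orP; left; apply/eqP.
by rewrite /e; ring.
Qed.

(** Equal masses and equal means ([tot], [h0]) settle the affine part of f, the hockey-stick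
    inequalities its kinks; a Lipschitz f is a uniform limit of its interpolations on [0,1]. *)
Lemma convex_order_le :
  (Rintegral m setT (f \o s) <= Rintegral eta setT (f \o a))%R.
Proof.
set H := fine (eta setT).
have H0 : (0 <= H)%R by rewrite fine_ge0.
have err d (T : measurableType d) (mu : {finite_measure set T -> \bar R}) (g : T -> R) N :
    measurable_fun setT g -> (forall x, 0 <= g x <= 1)%R ->
    bounded_measurable (f \o g) -> fine (mu setT) = H -> (0 < N)%N ->
    (`|Rintegral mu setT (interp N N \o g) - Rintegral mu setT (f \o g)| <=
    2 * L / N%:R * H)%R.
  move=> mg g01 bfg muH N0.
  have [bi _] := Rint_interp mu N mg g01.
  have N0' : (N%:R != 0 :> R)%R by rewrite pnatr_eq0 -lt0n.
  have ap x : (`|interp N N (g x) - f (g x)| <= 2 * L / N%:R)%R.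
    have /andP[g0 g1] := g01 x.
    by apply: (interp_approx N N0 g0).2; rewrite divff.
  rewrite -Rint_sub// -muH -Rint_cst ler_norml; apply/andP; split.
    rewrite -mulN1r -Rint_scale; last exact: bounded_measurable_cst.
    apply: Rint_le; [exact/bounded_measurableZ/bounded_measurable_cst|
      exact: bounded_measurableB|] => x.
    by have := ap x; rewrite mulN1r ler_norml => /andP[].
  apply: Rint_le; [exact: bounded_measurableB|exact: bounded_measurable_cst|] => x.
  by have := ap x; rewrite ler_norml => /andP[].
apply/ler_addgt0Pl => e e0.
(* Two interpolation errors, each at most 2 L H / N, must fit in e. *)
pose N := (Num.truncn (4 * L * H / e)).+1.
have N0 : (0 < N)%N by [].
have N0' : (0 < N%:R :> R)%R by rewrite ltr0n.
have := err _ _ eta a N ma a01 bfa erefl N0.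
have tot' : fine (m setT) = H by rewrite -tot.
have := err _ _ m s N ms s01 bfs tot' N0.
have := interp_le N0.
have : (2 * L / N%:R * H + 2 * L / N%:R * H <= e)%R.
  have -> : (2 * L / N%:R * H + 2 * L / N%:R * H = 4 * L * H / N%:R)%R by ring.
  rewrite ler_pdivrMr// -ler_pdivrMl// [leLHS]mulrC; apply/ltW; exact: truncnS_gt.
rewrite !ler_norml => h1 h2 /andP[h3 h4] /andP[h5 h6]; lra.
Qed.

End convex_order.

(** * Comparison of dichotomies *)

Section tests.
Context d (T : measurableType d) (R : realType) (K : finType).

Definition is_test (phi : K -> T -> R) :=
  [/\ forall k, measurable_fun setT (phi k), forall k x, (0 <= phi k x)%R &
      forall x, (\sum_k phi k x = 1)%R].

Lemma test01 phi k x : is_test phi -> (0 <= phi k x <= 1)%R.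
Proof.
move=> [_ p0 p1]; rewrite p0 -(p1 x) (bigD1 k)//= lerDl sumr_ge0//.
Qed.

Lemma test_bounded phi k : is_test phi -> bounded_measurable (phi k).
Proof.
move=> tp; apply: bounded_measurable01; first by case: tp.
by move=> x; exact: test01.
Qed.

Lemma is_test_mix phi psi (th : R) : (0 <= th <= 1)%R -> is_test phi ->
  is_test psi -> is_test (fun k x => (1 - th) * phi k x + th * psi k x)%R.
Proof.
move=> /andP[t0 t1] [mp p0 p1] [mq q0 q1]; split.
- by move=> k; apply: measurable_funD; apply: measurable_funM.
- by move=> k x; rewrite addr_ge0// mulr_ge0// subr_ge0.
- by move=> x; rewrite big_split/= -!mulr_sumr p1 q1 !mulr1 subrK.
Qed.

Lemma is_test_indic (c : T -> K) : (forall k, measurable [set x | c x = k]) ->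
  is_test (fun k => \1_[set x | c x = k]).
Proof.
move=> mc; split.
- by move=> k; exact: measurable_indic.
- by move=> k x; rewrite indicE.
- move=> x; rewrite (bigD1 (c x))//= big1 => [|k kc]; rewrite indicE.
    by rewrite mem_set// addr0.
  by rewrite memNset//= => ck; move: kc; rewrite ck eqxx.
Qed.

Variables (alpha eta : {finite_measure set T -> \bar R}) (a : T -> R).
Hypotheses (ma : measurable_fun setT a) (a01 : forall x, (0 <= a x <= 1)%R)
  (ha : level_ratio a alpha eta).

Lemma test_value phi (c e : K -> R) : is_test phi ->
  (\sum_k (c k * Rintegral alpha setT (phi k) + e k * Rintegral eta setT (phi k)) =
   Rintegral eta setT (fun x => \sum_k phi k x * (c k * a x + e k)))%R.
Proof.
move=> tp; have bp k := test_bounded k tp.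
have ba : bounded_measurable a by exact: bounded_measurable01.
rewrite Rint_sum => [|k _]; last first.
  apply: bounded_measurableM => //; apply: bounded_measurableD.
    exact: bounded_measurableZ.
  exact: bounded_measurable_cst.
apply: eq_bigr => k _; rewrite (Rint_density ma a01 ha); last 2 first.
- by case: tp.
- by move=> x; exact: test01.
rewrite -!Rint_scale//; last exact: bounded_measurableM.
rewrite -Rint_add; last 2 first.
- by apply: bounded_measurableZ; exact: bounded_measurableM.
- exact: bounded_measurableZ.
by apply: eq_Rintegral => x _; ring.
Qed.

End tests.

(** * Approximate simulation of a finite partition by tests *)

Section finite_target.
Context d1 d2 (T1 : measurableType d1) (T2 : measurableType d2) (R : realType).
Variables (alpha eta : {finite_measure set T1 -> \bar R})
  (P m : {finite_measure set T2 -> \bar R}) (a : T1 -> R) (s : T2 -> R).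
Hypotheses (ma : measurable_fun setT a) (ms : measurable_fun setT s)
  (a01 : forall x, (0 <= a x <= 1)%R) (s01 : forall x, (0 <= s x <= 1)%R)
  (ha : level_ratio a alpha eta) (hs : level_ratio s P m).
Hypothesis cx : forall (f : R -> R) (L : R), bounded_measurable (f \o a) ->
  bounded_measurable (f \o s) ->
  (forall x y, (`|f x - f y| <= L * `|x - y|)%R) ->
  (forall x h, (f x *+ 2 <= f (x + h) + f (x - h))%R) ->
  (Rintegral m setT (f \o s) <= Rintegral eta setT (f \o a))%R.
Variables (K : finType) (k0 : K) (c : T2 -> K).
Hypothesis mc : forall k, measurable [set y | c y = k].

Section best_response.
Variables (u v : K -> R).

Let l k x := (u k * x + v k)%R.
Let isbest x k := [forall j, (l j x <= l k x)%R].

Let exbest x : {k | isbest x k}.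
Proof.
exists [arg max_(k > k0) l k x]%O; apply/forallP => j.
by case: arg_maxP => // i _ h; exact: h.
Qed.

(** Ties are broken by least rank, so that {best = k} is a finite Boolean combination of closed
    conditions and hence measurable. *)
Let best x := [arg min_(k < sval (exbest x) | isbest x k) enum_rank k].

Let bestP x k : (best x = k) <->
  (isbest x k /\ forall j, isbest x j -> (enum_rank k <= enum_rank j)%N).
Proof.
rewrite /best; case: arg_minnP => [|i bi hi]; first exact: (proj2_sig (exbest x)).
split=> [<-//|[bk hk]]; apply: enum_rank_inj; apply: ord_inj; apply/eqP.
by rewrite eqn_leq hi// hk.
Qed.

Let best_max x j : (l j x <= l (best x) x)%R.
Proof. by have [/forallP] := (bestP x (best x)).1 erefl. Qed.

Let measurable_l k : measurable_fun setT (l k).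
Proof. by apply: measurable_funD => //; exact: measurable_funM. Qed.

Let measurable_isbest k : measurable [set x : R | isbest x k].
Proof.
rewrite [X in measurable X](_ : _ = \bigcap_(j in [set: K]) [set x | l j x <= l k x]%R).
  apply: fin_bigcap_measurable; first exact: finite_finset.
  move=> j _.
  have h : measurable_fun setT (fun x : R => l j x - l k x)%R.
    by apply: measurable_funB.
  have := measurable_le_set 0%R h; congr (measurable _).
  by apply/seteqP; split => x /=; rewrite subr_le0.
apply/seteqP; split => x /=; first by move=> /forallP h j _; exact: h.
by move=> h; apply/forallP => j; exact: h.
Qed.

Let measurable_best k : measurable [set x : R | best x = k].
Proof.
rewrite [X in measurable X](_ : _ = [set x | isbest x k] `&`
   \bigcap_(j in [set j | ~~ (enum_rank k <= enum_rank j)%N]) ~` [set x | isbest x j]).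
  apply: measurableI => //; apply: fin_bigcap_measurable; first exact: finite_finset.
  by move=> j _; exact: measurableC.
apply/seteqP; split => x /=.
  move=> /bestP[bk hk]; split => // j /= /negP kj bj; exact/kj/hk.
by move=> [bk hk]; apply/bestP; split=> // j bj; apply: contrapT => /negP /hk; exact.
Qed.

Let f x := l (best x) x.

Let fE d (T : measurableType d) (g : T -> R) x :
  f (g x) = (\sum_k \1_[set y | best (g y) = k] x * (u k * g x + v k))%R.
Proof.
rewrite (bigD1 (best (g x)))//= big1 => [|k kb]; rewrite indicE.
  by rewrite mem_set// addr0 mul1r.
by rewrite memNset ?mul0r//= => bk; move: kb; rewrite bk eqxx.
Qed.

Let bounded_f d (T : measurableType d) (g : T -> R) : measurable_fun setT g ->
  (forall x, 0 <= g x <= 1)%R ->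
  (forall k, measurable [set x | best (g x) = k]) /\ bounded_measurable (f \o g).
Proof.
move=> mg g01.
have mb k : measurable [set x | best (g x) = k].
  by have := mg measurableT _ (measurable_best k); rewrite setTI.
split=> //; rewrite [X in bounded_measurable X](_ : _ = (fun x =>
  \sum_k \1_[set y | best (g y) = k] x * (u k * g x + v k))%R).
  apply: bounded_measurable_sum => k _; apply: bounded_measurableM.
    exact: bounded_measurable_indic.
  apply: bounded_measurableD; last exact: bounded_measurable_cst.
  by apply: bounded_measurableZ; exact: bounded_measurable01.
by apply/funext => x; exact: fE.
Qed.

(** For given prices the partition earns at most the integral of the maximum of the affine functions
    u k x + v k. That maximum is convex and Lipschitz, so the convex order bounds it by its integral
    over [T1], which the test picking a maximizer earns. Thus no linear functional separates the
    partition from the tests. *)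
Lemma best_response : exists psi : K -> T1 -> R, is_test psi /\
  (\sum_k (u k * fine (P [set y | c y = k]) + v k * fine (m [set y | c y = k])) <=
   \sum_k (u k * Rintegral alpha setT (psi k) + v k * Rintegral eta setT (psi k)))%R.
Proof.
have [mba bfa] := bounded_f ma a01.
have [mbs bfs] := bounded_f ms s01.
exists (fun k => \1_[set x | best (a x) = k]); split; first exact: is_test_indic.
rewrite (test_value ma a01 ha); last exact: is_test_indic.
have -> : (\sum_k (u k * fine (P [set y | c y = k]) + v k * fine (m [set y | c y = k])) =
  Rintegral m setT (fun y => \sum_k \1_[set y | c y = k] y * (u k * s y + v k)))%R.
  rewrite -(test_value ms s01 hs); last exact: is_test_indic.
  by apply: eq_bigr => k _; rewrite !Rint_indic.
apply: (@le_trans _ _ (Rintegral m setT (f \o s))).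
  apply: Rint_le => //.
    apply: bounded_measurable_sum => k _; apply: bounded_measurableM.
      exact: bounded_measurable_indic.
    apply: bounded_measurableD; last exact: bounded_measurable_cst.
    by apply: bounded_measurableZ; exact: bounded_measurable01.
  move=> y; rewrite (bigD1 (c y))//= big1 => [|k kc]; rewrite indicE.
    by rewrite mem_set// addr0 mul1r; exact: best_max.
  by rewrite memNset ?mul0r//= => ck; move: kc; rewrite ck eqxx.
apply: (@le_trans _ _ (Rintegral eta setT (f \o a))); last first.
  by rewrite le_eqVlt; apply/orP; left; apply/eqP/eq_Rintegral => x _; exact: fE.
have L0 : (0 <= \sum_k `|u k|)%R by exact: sumr_ge0.
have lip x y : (f x - f y <= (\sum_k `|u k|) * `|x - y|)%R.
  apply: (@le_trans _ _ (l (best x) x - l (best x) y)%R).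
    by rewrite lerB// best_max.
  have -> : (l (best x) x - l (best x) y = u (best x) * (x - y))%R by rewrite /l; ring.
  rewrite (le_trans (ler_norm _))// normrM ler_wpM2r//.
  by rewrite (bigD1 (best x))//= lerDl sumr_ge0.
apply: (cx (L := (\sum_k `|u k|)%R)) => //.
- by move=> x y; rewrite ler_norml lip andbT lerNl opprB distrC lip.
- move=> x h; rewrite mulr2n.
  apply: (@le_trans _ _ (l (best x) (x + h) + l (best x) (x - h))%R).
    by rewrite /f /l le_eqVlt; apply/orP; left; apply/eqP; ring.
  by rewrite lerD// best_max.
Qed.

End best_response.

Let p k := fine (P [set y | c y = k]).
Let q k := fine (m [set y | c y = k]).
Let err (phi : K -> T1 -> R) : R :=
  (\sum_k ((Rintegral alpha setT (phi k) - p k) ^+ 2 +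
           (Rintegral eta setT (phi k) - q k) ^+ 2))%R.

Let H : R := (fine (alpha setT) + fine (eta setT))%R.

Let Rint_test (mu : {finite_measure set T1 -> \bar R}) (phi : K -> T1 -> R) k : is_test phi ->
  (fine (mu setT) <= H -> 0 <= Rintegral mu setT (phi k) <= H)%R.
Proof.
move=> tp muH; apply/andP; split.
  by apply: Rintegral_ge0 => x _; case/andP: (test01 k x tp).
rewrite (le_trans _ muH)// -[leRHS]mul1r -Rint_cst; apply: Rint_le.
- exact: test_bounded.
- exact: bounded_measurable_cst.
- by move=> x; case/andP: (test01 k x tp).
Qed.

(* One step of the Frank-Wolfe descent of the squared error. *)
Let err_step (phi : K -> T1 -> R) (th : R) : (0 <= th <= 1)%R -> is_test phi ->
  exists2 psi, is_test psi &
    (err psi <= (1 - 2 * th) * err phi + th ^+ 2 * (\sum_(k : K) H ^+ 2 *+ 2))%R.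
Proof.
move=> th01 tp.
pose x k := (Rintegral alpha setT (phi k) - p k)%R.
pose y k := (Rintegral eta setT (phi k) - q k)%R.
(* The prices are the negative gradient of the squared error, up to a factor 2. The response makes
   the cross term nonpositive in the exact expansion of the error of the mixture. *)
have [psi [tpsi hpsi]] := best_response (fun k => - x k)%R (fun k => - y k)%R.
exists (fun k z => (1 - th) * phi k z + th * psi k z)%R; first exact: is_test_mix.
have mix (mu : {finite_measure set T1 -> \bar R}) k :
    Rintegral mu setT (fun z => (1 - th) * phi k z + th * psi k z)%R =
    ((1 - th) * Rintegral mu setT (phi k) + th * Rintegral mu setT (psi k))%R.
  have b1 := test_bounded k tp; have b2 := test_bounded k tpsi.
  by rewrite Rint_add ?Rint_scale//; exact: bounded_measurableZ.
pose A k := Rintegral alpha setT (psi k).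
pose B k := Rintegral eta setT (psi k).
have crossle : (\sum_k (x k * (A k - p k) + y k * (B k - q k)) <= 0)%R.
  rewrite -oppr_ge0 -sumrN; move: hpsi; rewrite -subr_ge0 -sumrB.
  by move=> /le_trans; apply; rewrite le_eqVlt; apply/orP; left; apply/eqP;
    apply: eq_bigr => k _; rewrite /A /B /p /q; ring.
have -> : err (fun k z => (1 - th) * phi k z + th * psi k z)%R =
  ((1 - 2 * th) * err phi + 2 * th * \sum_k (x k * (A k - p k) + y k * (B k - q k)) +
   th ^+ 2 * \sum_k ((A k - Rintegral alpha setT (phi k)) ^+ 2 +
                     (B k - Rintegral eta setT (phi k)) ^+ 2))%R.
  rewrite /err !mulr_sumr -!big_split/=; apply: eq_bigr => k _.
  by rewrite !mix /x /y /A /B; ring.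
have th0 : (0 <= th)%R by case/andP: th01.
have aH : (fine (alpha setT) <= H)%R by rewrite /H lerDl fine_ge0.
have eH : (fine (eta setT) <= H)%R by rewrite /H lerDr fine_ge0.
have sq (mu : {finite_measure set T1 -> \bar R}) k : (fine (mu setT) <= H)%R ->
   ((Rintegral mu setT (psi k) - Rintegral mu setT (phi k)) ^+ 2 <= H ^+ 2)%R.
  move=> muH; have /andP[h1 h2] := Rint_test k tp muH.
  have /andP[h3 h4] := Rint_test k tpsi muH; nra.
have c1 : (2 * th * \sum_k (x k * (A k - p k) + y k * (B k - q k)) <= 0)%R.
  by rewrite mulr_ge0_le0// mulr_ge0.
have c2 : (th ^+ 2 * \sum_k ((A k - Rintegral alpha setT (phi k)) ^+ 2 +
    (B k - Rintegral eta setT (phi k)) ^+ 2) <=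
    th ^+ 2 * (\sum_(k : K) H ^+ 2 *+ 2))%R.
  rewrite ler_wpM2l ?sqr_ge0//; apply: ler_sum => k _.
  by rewrite mulr2n lerD// sq.
lra.
Qed.

Let err_ge0 (phi : K -> T1 -> R) : (0 <= err phi)%R.
Proof. by apply: sumr_ge0 => k _; rewrite addr_ge0// sqr_ge0. Qed.

Lemma approx_tests (e : R) : (0 < e)%R -> exists2 phi : K -> T1 -> R, is_test phi &
  (\sum_k ((Rintegral alpha setT (phi k) - fine (P [set y | c y = k])) ^+ 2 +
           (Rintegral eta setT (phi k) - fine (m [set y | c y = k])) ^+ 2) < e)%R.
Proof.
move=> e0.
pose E := [set err phi | phi in @is_test _ T1 R K].
have E0 : E !=set0.
  exists (err (fun k => \1_[set x : T1 | k0 = k])); exists (fun k => \1_[set x : T1 | k0 = k]) => //.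
  apply: (@is_test_indic _ T1 R K (fun=> k0)) => k.
  have [->|kk] := eqVneq k0 k.
    by rewrite [X in measurable X](_ : _ = setT)//; apply/seteqP; split.
  rewrite [X in measurable X](_ : _ = set0)//; apply/seteqP; split => // x /=.
  exact/eqP.
have hinf : has_inf E.
  by split=> //; exists 0%R => _ [phi _ <-]; exact: err_ge0.
have [dle|dgt] := leP (inf E) 0%R.
  have [_ [phi tp <-] h] := inf_adherent e0 hinf.
  exists phi => //; rewrite (lt_le_trans h)//; lra.
set D := inf E in dgt.
pose M := (\sum_(k : K) H ^+ 2 *+ 2)%R.
have M0 : (0 <= M)%R by apply: sumr_ge0 => k _; rewrite mulrn_wge0// sqr_ge0.
(* Starting within th ^ 2 of the infimum D, a step gains 2 th D and loses at most th ^ 2 (1 + M) <=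
   th D, so it would go below D. The bound 1/2 keeps 1 - 2 th nonnegative. *)
pose th := Num.min (1 / 2)%R (D / (1 + M))%R.
have th0 : (0 < th)%R by rewrite lt_min divr_gt0//= divr_gt0// ltr_wpDr.
have th1 : (th <= 1 / 2)%R by rewrite ge_min lexx.
have thD : (th * (1 + M) <= D)%R.
  by rewrite -ler_pdivlMr ?ltr_wpDr// ge_min lexx orbT.
have t20 : (0 < th ^+ 2)%R by rewrite exprn_gt0.
have [_ [phi tp <-] h] := inf_adherent t20 hinf.
have th01 : (0 <= th <= 1)%R by rewrite ltW//=; lra.
have [psi tpsi hpsi] := err_step th01 tp.
have Dle : (D <= err psi)%R.
  by apply: inf_lbound; [case: hinf|exists psi].
exfalso; rewrite -/D -/M in h hpsi.
have : (D <= (1 - 2 * th) * (D + th ^+ 2) + th ^+ 2 * M)%R.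
  apply: (le_trans Dle); apply: (le_trans hpsi); rewrite lerD2r ler_wpM2l//; lra.
nra.
Qed.

End finite_target.

Section threshold_tests.
Context d1 d2 (T1 : measurableType d1) (T2 : measurableType d2) (R : realType).
Variables (alpha eta : {finite_measure set T1 -> \bar R})
  (P m : {finite_measure set T2 -> \bar R}) (a : T1 -> R) (s : T2 -> R).
Hypotheses (ma : measurable_fun setT a) (ms : measurable_fun setT s)
  (a01 : forall x, (0 <= a x <= 1)%R) (s01 : forall x, (0 <= s x <= 1)%R)
  (ha : level_ratio a alpha eta) (hs : level_ratio s P m).
Hypothesis cx : forall (f : R -> R) (L : R), bounded_measurable (f \o a) ->
  bounded_measurable (f \o s) ->
  (forall x y, (`|f x - f y| <= L * `|x - y|)%R) ->
  (forall x h, (f x *+ 2 <= f (x + h) + f (x - h))%R) ->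
  (Rintegral m setT (f \o s) <= Rintegral eta setT (f \o a))%R.
Variables (phi : T2 -> R) (q : nat -> R).
Hypothesis mphi : measurable_fun setT phi.

(** The first n thresholds cut [T2] into atoms; each [F i] adds up the tests simulating the atoms
    below [q i]. *)
Lemma threshold_tests (n : nat) : exists F : nat -> T1 -> R,
  [/\ forall i, measurable_fun setT (F i), forall i x, (0 <= F i x <= 1)%R,
      forall i j, (q i <= q j)%R -> forall x, (F i x <= F j x)%R,
      forall i, (i < n)%N ->
        (`|Rintegral alpha setT (F i) - fine (P [set y | phi y < q i]%R)| <= n.+1%:R^-1)%R &
      forall i, (i < n)%N ->
        (`|Rintegral eta setT (F i) - fine (m [set y | phi y < q i]%R)| <= n.+1%:R^-1)%R].
Proof.
pose K := {ffun 'I_n -> bool}.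
pose c y : K := [ffun i : 'I_n => (phi y < q i)%R].
have mlt i : measurable [set y | phi y < q i]%R.
  rewrite [X in measurable X](_ : _ = phi @^-1` `]-oo, q i[%classic).
    by rewrite -[X in measurable X]setTI; exact: mphi.
  by apply/seteqP; split => y /=; rewrite in_itv.
have mc k : measurable [set y | c y = k].
  rewrite [X in measurable X](_ : _ = \bigcap_(i in [set: 'I_n])
    (if k i then [set y | phi y < q i]%R else ~` [set y | phi y < q i]%R)).
    apply: fin_bigcap_measurable; first exact: finite_finset.
    by move=> i _; case: ifP => _ //; exact: measurableC.
  apply/seteqP; split => y /=.
    move=> <- i _; rewrite /c ffunE; case: ifPn => //= /negP; exact.
  move=> h; apply/ffunP => i; rewrite ffunE; have := h i I.
  by case: (k i) => //= /negP/negbTE.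
(* Not simply the i-th bit of k: this form is monotone in [q i] also for i >= n and for bit patterns
   that no point realizes, and agrees with the i-th bit on realized patterns. *)
pose S i (k : K) := [exists j : 'I_n, (q j <= q i)%R && k j].
have Sc i y : (i < n)%N -> S i (c y) = (phi y < q i)%R.
  move=> iN; apply/existsP/idP => [[j]|h].
    by rewrite ffunE => /andP[qji] /lt_le_trans; apply.
  by exists (Ordinal iN); rewrite ffunE/= lexx.
have n0 : (0 < n.+1%:R^-1 :> R)%R by rewrite invr_gt0.
(* An error of 1 / ((n + 1) N) per atom sums to at most 1 / (n + 1) over any set of atoms; the
   successor keeps N positive. *)
pose N : R := (#|K|.+1)%:R.
have N0 : (0 < N)%R by rewrite ltr0n.
have e0 : (0 < (n.+1%:R^-1 / N) ^+ 2 :> R)%R by rewrite exprn_gt0// divr_gt0.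
have [psi tpsi herr] := approx_tests ma ms a01 s01 ha hs cx [ffun=> true] mc e0.
have bpsi k : bounded_measurable (psi k) by exact: test_bounded.
exists (fun i x => \sum_(k | S i k) psi k x)%R.
have sqb (x : K -> R) : (forall k, x k ^+ 2 <= (n.+1%:R^-1 / N) ^+ 2)%R -> forall p : pred K,
    (`|\sum_(k | p k) x k| <= n.+1%:R^-1)%R.
  move=> hx p; apply: (le_trans (ler_norm_sum _ _ _)).
  apply: (@le_trans _ _ (\sum_(k : K) n.+1%:R^-1 / N)%R).
    rewrite big_mkcond/=; apply: ler_sum => k _; case: ifP => _; last first.
      by rewrite divr_ge0// ltW.
    rewrite -(ler_pXn2r (n := 2))// ?nnegrE//; last by apply/ltW/divr_gt0.
    by rewrite real_normK ?num_real//; exact: hx.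
  rewrite sumr_const -[leLHS]mulr_natl mulrA ler_pdivrMr// mulrC; apply: ler_wpM2l; first exact: ltW.
  by rewrite /N ler_nat.
have err (al : {finite_measure set T1 -> \bar R}) (Q : {finite_measure set T2 -> \bar R}) :
    (forall k, (Rintegral al setT (psi k) - fine (Q [set y | c y = k])) ^+ 2 <=
       (n.+1%:R^-1 / N) ^+ 2)%R ->
    forall i, (i < n)%N -> (`|Rintegral al setT (fun x => \sum_(k | S i k) psi k x)%R -
       fine (Q [set y | phi y < q i]%R)| <= n.+1%:R^-1)%R.
  move=> hx i iN; rewrite Rint_sum//.
  have -> : fine (Q [set y | phi y < q i]%R) = (\sum_(k | S i k) fine (Q [set y | c y = k]))%R.
    transitivity (\sum_(k | S i k) Rintegral Q setT (\1_[set y | c y = k]))%R; last first.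
      by apply: eq_bigr => k _; rewrite Rint_indic.
    rewrite -Rint_sum => [|k _]; last exact: bounded_measurable_indic.
    rewrite -Rint_indic//; apply: eq_Rintegral => y _.
    have [yq|yq] := boolP (phi y < q i)%R.
      rewrite (bigD1 (c y)) ?Sc//= big1 => [|k /andP[_ kc]]; rewrite !indicE.
        by rewrite !mem_set// addr0.
      by rewrite memNset//= => ck; move: kc; rewrite ck eqxx.
    rewrite memNset; last exact/negP.
    apply/esym/big1 => k Sk; rewrite indicE memNset//= => ck.
    by move: Sk; rewrite -ck Sc// (negbTE yq).
  by rewrite -sumrB; exact: sqb.
have hk k : ((Rintegral alpha setT (psi k) - fine (P [set y | c y = k])) ^+ 2 +
           (Rintegral eta setT (psi k) - fine (m [set y | c y = k])) ^+ 2 <=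
           (n.+1%:R^-1 / N) ^+ 2)%R.
  apply: le_trans (ltW herr); rewrite [leRHS](bigD1 k)//= lerDl.
  by apply: sumr_ge0 => j _; rewrite addr_ge0// sqr_ge0.
split.
- by move=> i; have [] := @bounded_measurable_sum _ T1 R _ (index_enum K) (S i) psi (fun k _ => bpsi k).
- move=> i x; have [_ p0 p1] := tpsi; rewrite sumr_ge0//= -(p1 x).
  rewrite [leRHS](bigID (S i))/= lerDl; exact: sumr_ge0.
- move=> i j ij x; have [_ p0 _] := tpsi.
  rewrite big_mkcond [leRHS]big_mkcond; apply: ler_sum => k _.
  case: ifPn => [|_]; last by case: ifP.
  move=> /existsP[l /andP[ql kl]]; rewrite ifT//; apply/existsP; exists l.
  by rewrite (le_trans ql ij) kl.
- apply: err => k; apply: le_trans (hk k); by rewrite lerDl sqr_ge0.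
- apply: err => k; apply: le_trans (hk k); by rewrite lerDr sqr_ge0.
Qed.

End threshold_tests.

(** * Limits of tests along an ultrafilter and the comparison theorem *)

Lemma bounded_ultra_cvg (R : realType) (U : set_system nat) (u : nat -> R) (M : R) :
  UltraFilter U -> (forall n, (`|u n| <= M)%R) ->
  exists l : R, u x @[x --> U] --> l.
Proof.
move=> UU uM.
have PU : ProperFilter U by exact: ultra_proper.
have [|l [_ cl]] := @segment_compact R (- M) M (u x @[x --> U]) _.
  by apply: nearW => n /=; rewrite in_itv/= -ler_norml.
exists l => A nA; have [//|UA] := in_ultra_setVsetC (u @^-1` A) UU.
have [x []] := cl (~` A) A UA nA.
by [].
Qed.

(* Finite additivity suffices below a finite measure, whose continuity at the
   empty set is inherited. *)
Lemma ex_dominated_measure d (T : measurableType d) (R : realType)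
  (eta : {finite_measure set T -> \bar R}) (l : set T -> R) :
  (forall A, measurable A -> 0 <= l A <= fine (eta A))%R ->
  (forall A B, measurable A -> measurable B -> A `&` B = set0 ->
     l (A `|` B) = l A + l B)%R ->
  exists mu : {finite_measure set T -> \bar R},
    forall A, measurable A -> mu A = (l A)%:E.
Proof.
move=> lb ladd.
pose m A : \bar R := if `[< measurable A >] then (l A)%:E else 0.
have mE A : measurable A -> m A = (l A)%:E by move=> mA; rewrite /m asboolT.
have l0 : l set0 = 0%R.
  have := ladd set0 set0 measurable0 measurable0 (setI0 _).
  by rewrite setU0 => h; lra.
have [||||mu Hmu] := @ex_fmeasure _ T R m; last first.
  by exists mu => A mA; rewrite Hmu mE.
- by rewrite mE// ltry.
- move=> F mF tF mUF.
  have mB n : measurable (\big[setU/set0]_(i < n) F i) by exact: bigsetU_measurable.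
  have lsum n : (l (\big[setU/set0]_(i < n) F i) = \sum_(i < n) l (F i))%R.
    elim: n => [|n IH]; first by rewrite !big_ord0.
    rewrite !big_ord_recr/= ladd ?IH//; first exact: (mB n).
    rewrite -bigcup_mkord setI_bigcupl; apply: bigcup0 => i /= iN.
    by move/trivIsetP : tF; apply => //; rewrite neq_ltn iN.
  have Em n : \sum_(0 <= i < n) m (F i) = (\sum_(i < n) l (F i))%:E.
    by rewrite big_mkord -sumEFin; apply: eq_bigr => i _; rewrite mE.
  under eq_fun do rewrite Em.
  rewrite mE//; apply: cvg_EFin; first by apply: nearW.
  have eUfin : eta (\bigcup_n F n) = (fine (eta (\bigcup_n F n)))%:E.
    by rewrite fineK// fin_num_measure.
  have cv : fine (\sum_(0 <= i < n) eta (F i)) @[n --> \oo] --> fine (eta (\bigcup_n F n)).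
    apply: fine_cvg; rewrite -eUfin; exact: measure_semi_sigma_additive.
  have tail n : (l (\bigcup_n F n) - \sum_(i < n) l (F i) <=
       fine (eta (\bigcup_n F n)) - fine (\sum_(0 <= i < n) eta (F i)))%R.
    pose D := \bigcup_n F n `\` \big[setU/set0]_(i < n) F i.
    have mD : measurable D by exact: measurableD.
    have sub : \big[setU/set0]_(i < n) F i `<=` \bigcup_n F n.
      by move=> x; rewrite -bigcup_mkord => -[i _ Fx]; exists i.
    have UD : \bigcup_n F n = \big[setU/set0]_(i < n) F i `|` D.
      by rewrite /D setDUK.
    have dis : \big[setU/set0]_(i < n) F i `&` D = set0 by rewrite /D setDIK.
    have e1 : l (\bigcup_n F n) = (\sum_(i < n) l (F i) + l D)%R.
      by rewrite {1}UD ladd// lsum.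
    have e2 : eta (\bigcup_n F n) = \sum_(0 <= i < n) eta (F i) + eta D.
      rewrite {1}UD measureU// big_mkord; congr (_ + _).
      apply: measure_semi_additive_ord_I => //; exact: sub_trivIset tF.
    have f1 : \sum_(0 <= i < n) eta (F i) \is a fin_num.
      by apply/sum_fin_numP => i _ _; exact: fin_num_measure.
    rewrite e1 e2 fineD// ?fin_num_measure//.
    by have /andP[_] := lb D mD; lra.
  have up n : (\sum_(i < n) l (F i) <= l (\bigcup_n F n))%R.
    pose D := \bigcup_n F n `\` \big[setU/set0]_(i < n) F i.
    have mD : measurable D by exact: measurableD.
    have sub : \big[setU/set0]_(i < n) F i `<=` \bigcup_n F n.
      by move=> x; rewrite -bigcup_mkord => -[i _ Fx]; exists i.
    have UD : \bigcup_n F n = \big[setU/set0]_(i < n) F i `|` D.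
      by rewrite /D setDUK.
    have dis : \big[setU/set0]_(i < n) F i `&` D = set0 by rewrite /D setDIK.
    rewrite {1}UD ladd// lsum lerDl; by case/andP: (lb D mD).
  apply: (@squeeze_cvgr _ _ _ _ (fun n => l (\bigcup_n F n) -
     (fine (eta (\bigcup_n F n)) - fine (\sum_(0 <= i < n) eta (F i))))%R
     (fun=> l (\bigcup_n F n))).
  + by apply: nearW => n; rewrite up andbT /=; have := tail n; lra.
  + rewrite -[X in _ --> X]subr0; apply: cvgB; first exact: cvg_cst.
    rewrite -(subrr (fine (eta (\bigcup_n F n)))); apply: cvgB => //; exact: cvg_cst.
  + exact: cvg_cst.
- by move=> A; rewrite /m; case: asboolP => // mA; rewrite lee_fin; case/andP: (lb A mA).
- by rewrite mE// l0.
Qed.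

Lemma adde_fin_inj (R : realType) (x y z : \bar R) : x \is a fin_num ->
  x + y = x + z -> y = z.
Proof. by move=> fx h; rewrite -(addeK y fx) [y + x]addeC h [x + z]addeC addeK. Qed.

(** The limits of the threshold tests, weighted by eta = alpha + beta, form the family from which
    [cdf_kernel] makes a kernel. It transports eta to P + nu by construction and alpha to P through
    the likelihood ratio; beta follows by subtraction. *)
Lemma blackwell d1 d2 (T1 : measurableType d1) (T2 : measurableType d2)
  (R : realType) (alpha beta : {finite_measure set T1 -> \bar R})
  (P nu : {finite_measure set T2 -> \bar R}) :
  codable R T2 -> alpha setT = P setT -> beta setT = nu setT ->
  (forall t : R, (0 < t)%R -> meet_mass t alpha beta <= meet_mass t P nu) ->
  exists K : R.-pker T1 ~> T2,
    (forall B, measurable B -> P B = \int[alpha]_x K x B) /\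
    (forall B, measurable B -> nu B = \int[beta]_x K x B).
Proof.
move=> [phi [psi [mphi mpsi phiK phi01]]] totP totnu hmeet.
have [eta etaE] := ex_add_measure alpha beta.
have [m mE] := ex_add_measure P nu.
have [|a [ma a01 ha]] := @ex_level_ratio _ _ _ alpha eta.
  by move=> A mA; rewrite etaE leeDl.
have [|s [ms s01 hs]] := @ex_level_ratio _ _ _ P m.
  by move=> A mA; rewrite mE leeDl.
have tot : eta setT = m setT by rewrite etaE mE totP totnu.
have hle := hockey_le_of_meet_mass etaE mE ma ms a01 s01 ha hs totP hmeet.
have h0 : hockey m s 0 = hockey eta a 0.
  by rewrite (hockey0 ma a01 ha) (hockey0 ms s01 hs) totP.
have cx (f : R -> R) (L : R) : bounded_measurable (f \o a) ->
  bounded_measurable (f \o s) ->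
  (forall x y, (`|f x - f y| <= L * `|x - y|)%R) ->
  (forall x h, (f x *+ 2 <= f (x + h) + f (x - h))%R) ->
  (Rintegral m setT (f \o s) <= Rintegral eta setT (f \o a))%R.
  by move=> *; apply: (convex_order_le ma ms a01 s01 tot hle h0 (L := L)).
have [q dq] := ex_dense_seq R.
have thr n := threshold_tests ma ms a01 s01 ha hs cx q mphi n.
pose F n := projT1 (cid (thr n)).
have FP n := projT2 (cid (thr n)).
have mF n i : measurable_fun setT (F n i) by case: (FP n) => h _ _ _ _; exact: h.
have F01 n i x : (0 <= F n i x <= 1)%R by case: (FP n) => _ h _ _ _; exact: h.
have Fmono n i j : (q i <= q j)%R -> forall x, (F n i x <= F n j x)%R.
  by case: (FP n) => _ _ h _ _; exact: h.
(* Refining the filter of cofinite sets, the ultrafilter gives every bounded sequence a limit and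
   keeps the ordinary limits, used for the total masses in [Ltot]. *)
have [U [UU oU]] := ultraFilterLemma eventually_filter.
have PU : ProperFilter U by exact: ultra_proper.
pose g n i A x : R := (F n i x * \1_A x)%R.
have g01 n i A x : (0 <= g n i A x <= 1)%R.
  have /andP[f0 f1] := F01 n i x.
  rewrite /g indicE; case: (x \in A); rewrite ?mulr1 ?mulr0 ?lexx ?ler01 ?f0 ?f1//.
have mg n i A : measurable A -> measurable_fun setT (g n i A).
  by move=> mA; apply: measurable_funM => //; exact: measurable_indic.
have bg n i A : measurable A -> bounded_measurable (g n i A).
  by move=> mA; apply: bounded_measurable01 => //; exact: mg.
pose x (mu : {finite_measure set T1 -> \bar R}) i A n := Rintegral mu setT (g n i A).
have x0 mu i A n : (0 <= x mu i A n)%R.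
  by apply: Rintegral_ge0 => z _; case/andP: (g01 n i A z).
have xle mu i A n : measurable A -> (x mu i A n <= fine (mu A))%R.
  move=> mA; rewrite -Rint_indic//; apply: Rint_le.
  - exact: bg.
  - exact: bounded_measurable_indic.
  - move=> z; rewrite /g indicE; case: (z \in A); rewrite ?mulr0// mulr1.
    by case/andP: (F01 n i z).
have exl mu i A : exists l : R, measurable A -> x mu i A @ U --> l.
  have [mA|nA] := pselect (measurable A); last by exists 0%R.
  have [|l hl] := @bounded_ultra_cvg _ U (x mu i A) (fine (mu A)) UU.
    by move=> n; rewrite ger0_norm ?xle.
  by exists l.
pose l mu i A := projT1 (cid (exl mu i A)).
have cl mu i A : measurable A -> x mu i A @ U --> l mu i A.
  exact: projT2 (cid (exl mu i A)).
have exL mu i : exists L : {finite_measure set T1 -> \bar R},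
    forall A, measurable A -> L A = (l mu i A)%:E.
  apply: (@ex_dominated_measure _ T1 R mu) => [A mA|A B mA mB AB].
    apply/andP; split.
      apply: (ler_cvg_to (cvg_cst 0%R) (cl mu i A mA)); exact: nearW.
    apply: (ler_cvg_to (cl mu i A mA) (cvg_cst (fine (mu A)))).
    by apply: nearW => n; exact: xle.
  apply: (cvg_unique (@norm_hausdorff _ _) (cl mu i _ (measurableU _ _ mA mB))) => /=.
  have -> : x mu i (A `|` B) = (fun n => x mu i A n + x mu i B n)%R.
    apply/funext => n; rewrite /x -Rint_add; [|exact: bg|exact: bg].
    apply: eq_Rintegral => z _; rewrite /g -mulrDr; congr (_ * _)%R.
    rewrite !indicE in_setU; case: (boolP (z \in A)) => zA /=; last by rewrite add0r.
    rewrite memNset ?addr0// => zB.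
    have : (A `&` B) z by split=> //; exact: set_mem.
    by rewrite AB.
  by apply: cvgD; exact: cl.
pose L mu i := projT1 (cid (exL mu i)).
have LE mu i A : measurable A -> L mu i A = (l mu i A)%:E.
  exact: projT2 (cid (exL mu i)) A.
have Lle mu i A : measurable A -> L mu i A <= mu A.
  move=> mA; rewrite LE// -(fineK (fin_num_measure mu A mA)) lee_fin.
  apply: (ler_cvg_to (cl mu i A mA) (cvg_cst (fine (mu A)))).
  by apply: nearW => n; exact: xle.
have mlt i : measurable [set y | phi y < q i]%R.
  rewrite [X in measurable X](_ : _ = phi @^-1` `]-oo, q i[%classic).
    by rewrite -[X in measurable X]setTI; exact: mphi.
  by apply/seteqP; split => y /=; rewrite in_itv.
have Ltot (mu : {finite_measure set T1 -> \bar R}) (Q : {finite_measure set T2 -> \bar R}) i :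
    (forall n, (i < n)%N -> (`|Rintegral mu setT (F n i) -
      fine (Q [set y | phi y < q i]%R)| <= n.+1%:R^-1)%R) ->
    L mu i setT = Q [set y | phi y < q i]%R.
  move=> hF; rewrite LE// -[RHS]fineK ?fin_num_measure//; congr _%:E.
  apply: (cvg_unique (@norm_hausdorff _ _) (cl mu i _ measurableT)) => /=.
  have -> : x mu i setT = (fun n => Rintegral mu setT (F n i)).
    apply/funext => n; apply: eq_Rintegral => z _.
    by rewrite /g indicE in_setT mulr1.
  apply: cvg_trans; first exact: (cvg_app _ oU).
  apply/cvgrPdist_le => e e0.
  exists (maxn i.+1 (Num.truncn e^-1)) => // n /=.
  rewrite geq_max => /andP[iN eN]; rewrite distrC (le_trans (hF n iN))//.
  rewrite invf_ple ?posrE//; apply/ltW; apply: (lt_le_trans (truncnS_gt _)).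
  by rewrite ler_nat.
have La i : L alpha i setT = P [set y | phi y < q i]%R.
  by apply: Ltot => n iN; case: (FP n) => _ _ _ h _; exact: h.
have Le i : L eta i setT = m [set y | phi y < q i]%R.
  by apply: Ltot => n iN; case: (FP n) => _ _ _ _ h; exact: h.
(* The weights [F n i] multiply alpha and eta alike, so the level inequalities hold before the limit
   and pass to it. *)
have Lratio i : level_ratio a (L alpha i) (L eta i).
  have xa B n : measurable B -> x alpha i B n =
      Rintegral eta setT (fun z => g n i B z * a z)%R.
    by move=> mB; apply: (Rint_density ma a01 ha) => //; exact: mg.
  have ba : bounded_measurable a by exact: bounded_measurable01.
  move=> t t0; split=> B mB Bt; rewrite !LE// -EFinM lee_fin.
  - apply: (ler_cvg_to (cl alpha i B mB) (cvgM (cvg_cst t) (cl eta i B mB))).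
    apply: nearW => n /=; rewrite xa// /x -Rint_scale; last exact: bg.
    apply: Rint_le.
    + by apply: bounded_measurableM => //; exact: bg.
    + by apply: bounded_measurableZ; exact: bg.
    + move=> z; rewrite mulrC /g indicE; case: (boolP (z \in B)) => zB; last by rewrite !mulr0.
      rewrite !mulr1 ler_wpM2r//; first by case/andP: (F01 n i z).
      exact/Bt/set_mem.
  - apply: (ler_cvg_to (cvgM (cvg_cst t) (cl eta i B mB)) (cl alpha i B mB)).
    apply: nearW => n /=; rewrite xa// /x -Rint_scale; last exact: bg.
    apply: Rint_le.
    + by apply: bounded_measurableZ; exact: bg.
    + by apply: bounded_measurableM => //; exact: bg.
    + move=> z; rewrite [leRHS]mulrC /g indicE; case: (boolP (z \in B)) => zB; last by rewrite !mulr0.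
      rewrite !mulr1 ler_wpM2r//; first by case/andP: (F01 n i z).
      exact/ltW/Bt/set_mem.
have [G HG] := @ex_pushforward _ _ T2 (measurableTypeR R) R m phi mphi.
have rayE i : phi @^-1` `]-oo, q i[%classic = [set y | phi y < q i]%R.
  by apply/seteqP; split => y /=; rewrite in_itv.
have [|||||k Hk] := @cdf_kernel _ T1 R q eta G (L eta) dq.
- by move=> i A mA; exact: Lle.
- move=> i j ij A mA; rewrite !LE// lee_fin.
  apply: (ler_cvg_to (cl eta i A mA) (cl eta j A mA)); apply: nearW => n.
  apply: Rint_le; [exact: bg|exact: bg|] => z.
  by rewrite /g ler_wpM2r// ?indicE//; exact: Fmono.
- by move=> i; rewrite Le HG rayE.
- move=> i q0; rewrite Le -(measure0 m); congr (m _).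
  apply/seteqP; split => // y /= /lt_le_trans /(_ q0).
  by rewrite ltNge (andP (phi01 _)).1.
- move=> i q1; rewrite Le tot; congr (m _).
  by apply/seteqP; split => // y _ /=; rewrite (le_lt_trans (andP (phi01 y)).2).
have mk C : measurable C -> measurable_fun setT (fun z => k z C).
  by move=> mC; exact: measurable_kernel.
(* [k] was built from eta only. Its integral against alpha and [L alpha i] both have level ratio [a]
   with respect to [L eta i], so they coincide. *)
have Hka i : \int[alpha]_z k z `]-oo, q i[%classic = L alpha i setT.
  have [|||D HD] := @ex_density_measure _ T1 R alpha (fun z => k z `]-oo, q i[%classic).
  - exact: mk.
  - by [].
  - apply: (@le_lt_trans _ _ (\int[alpha]_z (cst 1 z))).
      apply: ge0_le_integral => //; first exact: mk.
      by move=> z _; rewrite /= -(@prob_kernel _ _ _ _ _ k z) le_measure ?inE.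
    by rewrite integral_cst// mul1e fmeasure_lty.
  rewrite -HD; apply: (level_ratio_unique ma a01 (eta := L eta i)) => // t t0.
  have [h1 h2] := ha t t0; split => B mB Bt; rewrite HD -(Hk i)//.
  - apply: le_integral_le_measure => //; last exact: mk.
    by move=> C mC CB; apply: h1 => //; exact: subset_trans CB Bt.
  - apply: ge_integral_ge_measure => //; last exact: mk.
    by move=> C mC CB; apply: h2 => //; exact: subset_trans CB Bt.
have [K HK] := ex_map_kernel k mpsi.
have main (al : {finite_measure set T1 -> \bar R}) (Q : {finite_measure set T2 -> \bar R}) :
    (forall i, \int[al]_z k z `]-oo, q i[%classic = Q [set y | phi y < q i]%R) ->
    forall B, measurable B -> Q B = \int[al]_z K z B.
  move=> hal B mB.
  have [m1 Hm1] := ex_kernel_integral al k (@measurableT _ T1).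
  have [m2 Hm2] := @ex_pushforward _ _ T2 (measurableTypeR R) R Q phi mphi.
  have m12 : forall C, measurable C -> m1 C = m2 C.
    by apply: (dense_ray_measure_unique dq) => i; rewrite Hm1 hal Hm2 rayE.
  have mpB : measurable (psi @^-1` B : set (measurableTypeR R)).
    by rewrite -[X in measurable X]setTI; exact: mpsi.
  transitivity (m2 (psi @^-1` B)).
    rewrite Hm2; congr (Q _).
    by apply/seteqP; split => y /=; rewrite phiK.
  by rewrite -m12// Hm1; apply: eq_integral => z _; rewrite HK.
have hP : forall B, measurable B -> P B = \int[alpha]_z K z B.
  by apply: main => i; rewrite Hka La.
have hm : forall B, measurable B -> m B = \int[eta]_z K z B.
  by apply: main => i; rewrite Hk.
exists K; split => // B mB.
have e1 : \int[eta]_z K z B = \int[alpha]_z K z B + \int[beta]_z K z B.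
  rewrite -ge0_integral_measure_add//; last exact: measurable_kernel.
  by apply: eq_measure_integral => A mA _; exact: etrans (etaE A) (esym (measure_addE alpha beta A)).
have fP : \int[alpha]_z K z B \is a fin_num by rewrite -hP// fin_num_measure.
have := hm B mB; rewrite mE (hP B mB) e1.
exact: adde_fin_inj.
Qed.

(** * Measures on the product space *)

Lemma ex_scale_measure d (T : measurableType d) (R : realType)
  (mu : {finite_measure set T -> \bar R}) (c : R) : (0 <= c)%R ->
  exists m : {finite_measure set T -> \bar R}, forall A, m A = c%:E * mu A.
Proof.
move=> c0.
have [||||m Hm] := @ex_fmeasure _ T R (mscale (NngNum c0) mu) => //.
- exact: measure_semi_sigma_additive.
- by rewrite /mscale/= lte_mul_pinfty ?lee_fin// fmeasure_lty.
by exists m.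
Qed.

(** Glue P on a Hahn set to t Q on its complement. *)
Lemma ex_meet_measure d (T : measurableType d) (R : realType)
  (P Q : {finite_measure set T -> \bar R}) (t : R) : (0 <= t)%R ->
  exists m : {finite_measure set T -> \bar R},
    [/\ forall A, measurable A -> m A <= P A,
        forall A, measurable A -> m A <= t%:E * Q A &
        m setT = meet_mass t P Q].
Proof.
move=> t0; have [A mA [h1 h2]] := hahn_le P Q t0.
have mAC : measurable (~` A) by exact: measurableC.
have [P1 HP1] := ex_restr P mA.
have [tQ HtQ] := ex_scale_measure Q t0.
have [Q1 HQ1] := ex_restr tQ mAC.
have [m Hm] := ex_add_measure P1 Q1.
have sp (mu : {finite_measure set T -> \bar R}) B : measurable B ->
    mu B = mu (B `&` A) + mu (B `&` ~` A).
  move=> mB; rewrite -measureU//; try exact: measurableI.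
    by rewrite -setIUr setUv setIT.
  by rewrite setIACA setICr setI0.
exists m; split.
- move=> B mB; rewrite Hm HP1 HQ1 HtQ (sp P B mB) leeD2l//.
  by apply: h2; [exact: measurableI|move=> x []].
- move=> B mB; rewrite Hm HP1 HQ1 HtQ (sp Q B mB) ge0_muleDr// leeD2r//.
  by apply: h1; [exact: measurableI|move=> x []].
- rewrite Hm HP1 HQ1 HtQ !setTI; apply/esym; exact: meet_mass_hahn.
Qed.

(** Converse of [meet_mass_hahn]: moving B across the boundary of a minimizer cannot lower the
    value, which is the inequality sought on B. *)
Lemma meet_mass_minimizer d (T : measurableType d) (R : realType)
  (P Q : {finite_measure set T -> \bar R}) (t : R) A : (0 <= t)%R ->
  measurable A -> P A + t%:E * Q (~` A) = meet_mass t P Q ->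
  (forall B, measurable B -> B `<=` A -> P B <= t%:E * Q B) /\
  (forall B, measurable B -> B `<=` ~` A -> t%:E * Q B <= P B).
Proof.
move=> t0 mA eqm.
have mAC : measurable (~` A) by exact: measurableC.
have fin (mu : {finite_measure set T -> \bar R}) B : measurable B ->
    mu B = (fine (mu B))%:E by move=> mB; rewrite fineK// fin_num_measure.
have le C : measurable C -> (fine (P A) + t * fine (Q (~` A)) <=
    fine (P C) + t * fine (Q (~` C)))%R.
  move=> mC; have := meet_mass_le t P Q mC; rewrite -eqm.
  rewrite (fin P A mA) (fin P C mC) (fin Q _ mAC) (fin Q (~` C)); last exact: measurableC.
  by rewrite -!EFinM -!EFinD lee_fin.
have addf (mu : {finite_measure set T -> \bar R}) B C : measurable B -> measurable C ->
    B `<=` C -> fine (mu C) = (fine (mu B) + fine (mu (C `\` B)))%R.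
  move=> mB mC BC; have mD : measurable (C `\` B) by exact: measurableD.
  rewrite -fineD ?fin_num_measure// -measureU// ?setDIK//.
  by rewrite setDUK.
split => B mB BA; rewrite (fin P B mB) (fin Q B mB) -EFinM lee_fin.
- have mD : measurable (A `\` B) by exact: measurableD.
  have := le _ mD; rewrite (addf P B A)// (addf Q (~` A) (~` (A `\` B)))//; last 2 first.
  - exact: measurableC.
  - by apply: subsetC => x [].
  have -> : ~` (A `\` B) `\` ~` A = B.
    apply/seteqP; split => x /=.
      by move=> [h /contrapT Ax]; apply: contrapT => nB; exact: h.
    by move=> Bx; split; [move=> []|apply; exact: BA].
  by rewrite mulrDr; lra.
- have mU : measurable (A `|` B) by exact: measurableU.
  have := le _ mU; rewrite (addf P A (A `|` B) mA mU (@subsetUl _ _ _)).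
  have mUC : measurable (~` (A `|` B)) by exact: measurableC.
  rewrite (addf Q _ _ mUC mAC (subsetC (@subsetUl _ A B))).
  have -> : (A `|` B) `\` A = B.
    apply/seteqP; split => x /=; first by move=> [[]].
    by move=> Bx; split; [right|exact: BA].
  have -> : ~` A `\` ~` (A `|` B) = B.
    apply/seteqP; split => x /=.
      by move=> [nA /contrapT[]].
    by move=> Bx; split; [exact: BA|apply; right].
  by rewrite mulrDr; lra.
Qed.

Section product_space.
Context (R : realType) (Om : bool -> ptopologicalType).
Implicit Types (mu pi rho : {finite_measure set (prodsp Om) -> \bar R}).

Definition rect i (A : set (borel (Om i))) (B : set (borel (Om (~~ i)))) :
  set (prodsp Om) := @pr Om i @^-1` A `&` @pr Om (~~ i) @^-1` B.

Lemma measurable_pr_preimage i (A : set (borel (Om i))) : measurable A ->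
  measurable (@pr Om i @^-1` A).
Proof. by move=> mA; rewrite -[X in measurable X]setTI; exact: measurable_pr. Qed.

Lemma measurable_rect i A B : measurable A -> measurable B ->
  measurable (@rect i A B).
Proof. by move=> mA mB; apply: measurableI; exact: measurable_pr_preimage. Qed.

(** The far coordinate comes first because it is the source of the kernels, as in
    [ex_kernel_image]. *)
Definition join i (p : borel (Om (~~ i)) * borel (Om i)) : prodsp Om :=
  @pair_at Om i p.2 p.1.

Lemma measurable_join i : measurable_fun setT (@join i).
Proof.
by case: i; apply: measurable_fun_pair.
Qed.

Lemma pr_join i x y : @pr Om i (join (y, x)) = x.
Proof. by case: i x y. Qed.

Lemma pr_neg_join i (x : Om i) y : @pr Om (~~ i) (join (y, x)) = y.
Proof. by case: i x y. Qed.

Lemma rect_measure_unique i mu pi :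
  (forall A B, measurable A -> measurable B -> mu (@rect i A B) = pi (@rect i A B)) ->
  forall C, measurable C -> mu C = pi C.
Proof.
move=> h; apply: (@measure_unique _ R _
  [set C | exists A B, [/\ measurable A, measurable B & C = @rect i A B]] (fun=> setT)).
- rewrite measurable_prod_measurableType; apply/seteqP; split.
    apply: smallest_sub; first exact: smallest_sigma_algebra.
    move=> _ [A mA [B mB <-]]; apply: sub_sigma_algebra.
    case: i h => _; [exists B, A|exists A, B]; split => //=;
      by apply/seteqP; split => -[x y] //= [].
  apply: smallest_sub; first exact: smallest_sigma_algebra.
  move=> _ [A [B [mA mB ->]]]; apply: sub_sigma_algebra.
  by case: i h A B mA mB => _ A B mA mB; [exists B => //; exists A => //|
    exists A => //; exists B => //]; apply/seteqP; split => -[x y] //= [].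
- move=> _ _ [A [B [mA mB ->]]] [A' [B' [mA' mB' ->]]].
  exists (A `&` A'), (B `&` B'); split; [exact: measurableI|exact: measurableI|].
  by rewrite /rect !preimage_setI setIACA.
- by move=> _; exists setT, setT; split => //; rewrite /rect !preimage_setT setIT.
- by rewrite bigcup_const//; exists 0%N.
- by move=> _ [A [B [mA mB ->]]]; exact: h.
- by move=> _; exact: fmeasure_lty.
Qed.

(** The kernel keeps y and draws the other coordinate from [K y]; integrating it against eta gives
    the kernel product of eta and K. *)
Lemma ex_kernel_join i (K : R.-pker borel (Om (~~ i)) ~> borel (Om i)) :
  exists Kap : R.-pker borel (Om (~~ i)) ~> prodsp Om,
    forall (eta : {finite_measure set (borel (Om (~~ i))) -> \bar R}) A B,
      measurable A -> measurable B ->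
      \int[eta]_y Kap y (@rect i A B) = \int[eta]_(y in B) K y A.
Proof.
have [Kap HKap] := ex_kernel_image K (@measurable_join i).
exists Kap => eta A B mA mB.
rewrite [RHS]integral_mkcond; apply: eq_integral => y _.
rewrite HKap; last exact: measurable_rect.
rewrite patchE; case: ifPn => yB.
  congr (K y _); apply/seteqP; split => x; rewrite /rect /= pr_join pr_neg_join.
    by case.
  by move=> Ax; split => //; exact: set_mem.
transitivity (K y set0); last exact: measure0.
congr (K y _); apply/seteqP; split => // x.
rewrite /rect /= pr_join pr_neg_join => -[_ By].
by move/negP: yB; apply; exact: mem_set.
Qed.

Lemma integral_pr i pi (g : borel (Om i) -> \bar R) B :
  measurable B -> measurable_fun setT g -> (forall y, 0 <= g y) ->
  \int[pi]_(z in @pr Om i @^-1` B) g (@pr Om i z) = \int[marginal i pi]_(y in B) g y.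
Proof.
move=> mB mg g0.
rewrite (ge0_integral_pushforward (@measurable_pr Om i))//; exact: measurable_funTS.
Qed.

End product_space.
Arguments rect {Om} i.
Arguments join {Om} i.

(** * Refinements *)

Section refinements.
Context (R : realType) (Om : bool -> ptopologicalType)
  (E : set (Om false * Om true))
  (nu : forall b, {finite_measure set (borel (Om b)) -> \bar R}).
Hypotheses (polish_Om : forall b : bool, Defs.polish R (Om b)) (closed_E : closed E).

Lemma codable_Om b : codable R (borel (Om b)).
Proof.
have [rho [e sm]] := polish_separating_metric (polish_Om b).
exact: separating_metric_code sm.
Qed.

(** Besides measurability, this reduces being carried by neighborhoods to countably many conditions
    on rectangles. *)
Lemma setC_edges_rect i : exists (A : nat -> set (borel (Om i)))
  (B : nat -> set (borel (Om (~~ i)))),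
  [/\ forall n, measurable (A n), forall n, measurable (B n) &
      ~` E = \bigcup_n rect i (A n) (B n)].
Proof.
have [rho0 [e0 sm0]] := polish_separating_metric (polish_Om false).
have [rho1 [e1 sm1]] := polish_separating_metric (polish_Om true).
have [U [V [oU oV EUV]]] := open_bigcup_rectangles sm0 sm1 (closed_openC closed_E).
have mU n : measurable (U n : set (borel (Om false))) by exact: open_measurable_borel.
have mV n : measurable (V n : set (borel (Om true))) by exact: open_measurable_borel.
case: i; [exists V, U|exists U, V]; split => //; rewrite EUV;
  by apply/seteqP; split => -[x y] [n _ []]; exists n.
Qed.

Lemma measurable_setC_edges : measurable (~` E : set (prodsp Om)).
Proof.
have [A [B [mA mB ->]]] := setC_edges_rect false.
by apply: bigcup_measurable => n _; exact: measurable_rect.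
Qed.

Lemma marginal_setT i (mu : {finite_measure set (prodsp Om) -> \bar R}) :
  marginal i mu setT = mu setT.
Proof. by rewrite /marginal /pushforward preimage_setT. Qed.

(** The meet of alpha and t beta is itself feasible at level t. *)
Lemma meet_mass_le_Fit i (alpha beta : {finite_measure set (prodsp Om) -> \bar R})
  (t : R) : (0 < t)%R -> refinement E nu i alpha -> refinement E nu (~~ i) beta ->
  meet_mass t alpha beta <= Fit E nu i t.
Proof.
move=> t0 [alE almu] [beE benu].
have [sigma [s1 s2 <-]] := ex_meet_measure alpha beta (ltW t0).
apply: ereal_sup_ubound; exists sigma => //; split.
- apply/eqP; rewrite eq_le measure_ge0 andbT -alE s1//; exact: measurable_setC_edges.
- by move=> A mA; rewrite -almu//; apply: s1; exact: measurable_pr_preimage.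
- by move=> A mA; rewrite -benu//; apply: s2; exact: measurable_pr_preimage.
Qed.

(** With s the density of the marginal of sigma, the missing mass (1 - s) nu is distributed as [pi]
    distributes nu, hence along edges. *)
Lemma extend_refinement i (sigma pi : {finite_measure set (prodsp Om) -> \bar R}) :
  sigma (~` E) = 0 -> (forall A, measurable A -> marginal i sigma A <= nu i A) ->
  refinement E nu i pi ->
  exists2 alpha, refinement E nu i alpha &
    forall C, measurable C -> sigma C <= alpha C.
Proof.
move=> sE smu [piE pimu].
have [s [ms s01 hs]] := @ex_level_ratio _ _ _ (marginal i sigma) (nu i) smu.
have sD := level_ratioP ms s01 hs.
pose g y := (1 - s y)%:E.
have g0 y : 0 <= g y by rewrite lee_fin subr_ge0; case/andP: (s01 y).
have mg : measurable_fun setT g.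
  by apply/measurable_EFinP; apply: measurable_funB.
have mgp : measurable_fun setT (g \o @pr Om i).
  by apply: measurableT_comp => //; exact: measurable_pr.
have gint A : measurable A -> \int[marginal i pi]_(y in A) g y + marginal i sigma A = nu i A.
  move=> mA; rewrite (@eq_measure_integral _ _ _ _ (nu i)); last first.
    by move=> B mB _; exact: pimu.
  rewrite sD// -ge0_integralD//.
  - rewrite -[RHS]mul1e -integral_cst//; apply: eq_integral => y _.
    by rewrite /g -EFinD subrK.
  - exact: measurable_funTS.
  - by move=> y _; rewrite lee_fin; case/andP: (s01 y).
  - by apply: measurable_funTS; exact/measurable_EFinP.
have [||rest Hrest] := @ex_density_measure _ _ R pi (g \o @pr Om i) mgp.
- by move=> z; exact: g0.
- have := integral_pr pi measurableT mg g0; rewrite preimage_setT => ->.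
  have := gint setT measurableT; have := fmeasure_lty (nu i) measurableT.
  by move=> + h; rewrite -h; apply: le_lt_trans; rewrite leeDl.
have [alpha Halpha] := ex_add_measure sigma rest.
exists alpha; last by move=> C _; rewrite Halpha leeDl.
split.
- rewrite Halpha sE add0e Hrest; apply: null_set_integral => //.
  + exact: measurable_setC_edges.
  + exact: measurable_funTS.
- move=> A mA; rewrite -gint// -integral_pr// -Hrest addeC.
  exact: Halpha.
Qed.

(** Extend a feasible sigma on side i to alpha and sigma / t on the other side to beta. Then sigma
    lies below both alpha and t beta, so its mass is at most their H_t. *)
Lemma Fit_le_meet_mass i (pi rho : {finite_measure set (prodsp Om) -> \bar R})
  (t : R) (m : \bar R) : (0 < t)%R ->
  refinement E nu i pi -> refinement E nu (~~ i) rho ->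
  (forall alpha beta, refinement E nu i alpha -> refinement E nu (~~ i) beta ->
     meet_mass t alpha beta <= m) ->
  Fit E nu i t <= m.
Proof.
move=> t0 rpi rrho hm; apply: ge_ereal_sup => _ [sigma [sE s1 s2] <-].
have [alpha ralpha sal] := extend_refinement sE s1 rpi.
have ti0 : (0 <= t^-1)%R by rewrite invr_ge0 ltW.
have [sig' Hsig'] := ex_scale_measure sigma ti0.
have tK (x : \bar R) : t%:E * (t^-1%:E * x) = x.
  by rewrite muleA -EFinM divff ?mul1e// gt_eqF.
have [|A mA|beta rbeta sbe] := @extend_refinement (~~ i) sig' rho _ _ rrho.
- by rewrite Hsig' sE mule0.
- change (sig' (@pr Om (~~ i) @^-1` A) <= nu (~~ i) A).
  rewrite Hsig' -[leRHS]mul1e -(mulVf (x := t)) ?gt_eqF// EFinM -muleA.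
  by rewrite lee_wpmul2l ?lee_fin//; exact: s2.
apply: le_trans (hm _ _ ralpha rbeta).
apply: le_ereal_inf_tmp => _ [A mA <-].
have mAC : measurable (~` A) by exact: measurableC.
rewrite (measure_setT_split sigma mA) leeD//; first exact: sal.
have t0' : 0 <= t%:E by rewrite lee_fin ltW.
by rewrite -[leLHS]tK lee_wpmul2l// -Hsig'; exact: sbe.
Qed.

(** Thin [pi] by a function of the far coordinate until its far marginal becomes the meet of its
    marginal with t nu; thinning preserves the other constraints. *)
Lemma marginal_meet_mass_le_Fit i (pi : {finite_measure set (prodsp Om) -> \bar R})
  (t : R) : (0 < t)%R -> refinement E nu i pi ->
  meet_mass t (marginal (~~ i) pi) (nu (~~ i)) <= Fit E nu i t.
Proof.
move=> t0 [piE pimu].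
have [q [q1 q2 <-]] := ex_meet_measure (marginal (~~ i) pi) (nu (~~ i)) (ltW t0).
have [s [ms s01 hs]] := @ex_level_ratio _ _ _ q (marginal (~~ i) pi) q1.
have sD := level_ratioP ms s01 hs.
pose g y := (s y)%:E.
have g0 y : 0 <= g y by rewrite lee_fin; case/andP: (s01 y).
have g1 y : g y <= 1 by rewrite lee_fin; case/andP: (s01 y).
have mg : measurable_fun setT g by exact/measurable_EFinP.
have mgp : measurable_fun setT (g \o @pr Om (~~ i)).
  by apply: measurableT_comp => //; exact: measurable_pr.
have le1 C : measurable C -> \int[pi]_(z in C) (g \o @pr Om (~~ i)) z <= pi C.
  move=> mC; rewrite -[leRHS]mul1e -integral_cst//; apply: ge0_le_integral => //.
  - by move=> z _; exact: g0.
  - exact: measurable_funTS.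
  - by move=> z _; exact: g1.
have [||sigma Hsigma] := @ex_density_measure _ _ R pi (g \o @pr Om (~~ i)) mgp.
- by move=> z; exact: g0.
- by apply: le_lt_trans (le1 _ measurableT) _; exact: fmeasure_lty.
have marg B : measurable B -> marginal (~~ i) sigma B = q B.
  by move=> mB; rewrite sD// -integral_pr// -Hsigma.
rewrite -marg// marginal_setT.
apply: ereal_sup_ubound; exists sigma => //; split.
- apply/eqP; rewrite eq_le measure_ge0 andbT -piE Hsigma le1//.
  exact: measurable_setC_edges.
- move=> A mA; rewrite -pimu//.
  change (sigma (@pr Om i @^-1` A) <= pi (@pr Om i @^-1` A)).
  by rewrite Hsigma le1//; exact: measurable_pr_preimage.
- by move=> B mB; rewrite marg//; exact: q2.
Qed.

End refinements.

Lemma ge0_integral_setwise_add d (T : measurableType d) (R : realType)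
  (mu m1 m2 : {finite_measure set T -> \bar R}) B (f : T -> \bar R) :
  (forall A, measurable A -> mu A = m1 A + m2 A) -> measurable B ->
  measurable_fun setT f -> (forall x, 0 <= f x) ->
  \int[mu]_(x in B) f x = \int[m1]_(x in B) f x + \int[m2]_(x in B) f x.
Proof.
move=> h mB mf f0.
rewrite -ge0_integral_measure_add//; last exact: measurable_funTS.
apply: eq_measure_integral => A mA _.
exact: etrans (h A mA) (esym (measure_addE m1 m2 A)).
Qed.

(* The pair of second marginals is carried to the pair of refinements by the
   kernel that draws the first coordinate from [K], or from [Kfb] off the
   carrier of the first marginal. *)
Lemma proportional_response_kernel (R : realType) (Om : bool -> ptopologicalType)
  (E : set (Om false * Om true))
  (nu : forall b, {finite_measure set (borel (Om b)) -> \bar R}) i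
  (pi rho : {finite_measure set (prodsp Om) -> \bar R}) :
  proportional_response E nu i pi rho ->
  exists Kap : R.-pker borel (Om (~~ i)) ~> prodsp Om,
    is_kernel_pushforward Kap (marginal (~~ i) pi) pi /\
    is_kernel_pushforward Kap (nu (~~ i)) rho.
Proof.
move=> [K [Kfb [nuac [nus [rhoac [rhos [HK0 [nuE nudom0 [N mN [nusN PN0]]] _ [Hac Hs] rhoE]]]]]]].
pose P : {finite_measure set (borel (Om (~~ i))) -> \bar R} := marginal (~~ i) pi.
have HK : is_kernel_product P K pi by exact: HK0.
have nudom : nuac `<< P by exact: nudom0.
have PN : P (~` N) = 0 by exact: PN0.
(* [K] is a finite kernel with mass 1 only almost everywhere. On [D] it is used as it stands,
   elsewhere [Kfb] takes over; [D] is conull for the far marginal and [nuac] and null for [nus]. *)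
pose one := [set y | K y setT == 1].
have mone : measurable one by exact: kernel_measurable_eq_cst.
pose D := N `&` one.
have mD : measurable D by exact: measurableI.
pose k y : {measure set (borel (Om i)) -> \bar R} := if y \in D then K y else Kfb y.
have [||Ks HKs] := @ex_pkernel _ _ (borel (Om (~~ i))) (borel (Om i)) R k.
- move=> B mB.
  rewrite [X in measurable_fun _ X](_ : _ = fun y => if y \in D then K y B else Kfb y B).
    apply: measurable_fun_ifT; [|exact: measurable_kernel|exact: measurable_kernel].
    apply: (measurable_fun_bool true); rewrite setTI.
    rewrite [X in measurable X](_ : _ = D)//.
    by apply/seteqP; split => y /= h; [exact: set_mem|exact: mem_set].
  by apply/funext => y; rewrite /k; case: ifP.
- move=> y; rewrite /k; case: ifPn => [/set_mem[_ /eqP//]|_]; exact: prob_kernel.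
(* Taking the whole space as first factor in the kernel product, P B is the integral of K y setT
   over B for every B, so this density is 1 almost everywhere. *)
have Pone : P (~` one) = 0.
  have mK : measurable_fun setT (fun y => K y setT) by exact: measurable_kernel.
  have PK B : measurable B -> P B = \int[P]_(y in B) K y setT.
    by move=> mB; rewrite -HK// /P/= /marginal /pushforward preimage_setT setTI.
  have : ae_eq P setT (fun y => K y setT) (cst 1).
    apply: integral_ae_eq => //.
    - apply/integrableP; split => //.
      under eq_integral do rewrite gee0_abs//.
      by rewrite -PK// fmeasure_lty.
    - by move=> B _ mB; rewrite -PK// integral_cst// mul1e.
  move=> h; apply/negligibleP; first exact: measurableC.
  have : P.-negligible (~` [set y | setT y -> K y setT = 1]) by exact: h.
  by apply: negligibleS => y /= h1 h2; apply: h1; apply/eqP; exact: h2.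
have PD : P (~` D) = 0.
  apply/eqP; rewrite eq_le measure_ge0 andbT /D setCI.
  have h : P (~` N `|` ~` one) <= P (~` N) + P (~` one).
    by apply: measureU2; exact: measurableC.
  by rewrite (le_trans h)// PN Pone adde0.
have mDC : measurable (~` D) by exact: measurableC.
have nuacD : nuac (~` D) = 0 by move/null_content_dominatesP : nudom; apply.
have nusD : nus D = 0.
  apply/eqP; rewrite eq_le measure_ge0 andbT -nusN; apply: le_measure; rewrite ?inE//.
  exact: subIsetl.
have aeKs (mu : {finite_measure set (borel (Om (~~ i))) -> \bar R}) A B :
    measurable A -> measurable B -> mu (~` D) = 0 ->
    \int[mu]_(y in B) Ks y A = \int[mu]_(y in B) K y A.
  move=> mA mB muD; apply: ae_eq_integral => //.
  - by apply: measurable_funTS; exact: measurable_kernel.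
  - by apply: measurable_funTS; exact: measurable_kernel.
  have : mu.-negligible (~` D) by apply/negligibleP.
  apply: negligibleS => y /= h Dy; apply: h => _.
  by rewrite HKs /k mem_set.
have aeKsfb (mu : {finite_measure set (borel (Om (~~ i))) -> \bar R}) A B :
    measurable A -> measurable B -> mu D = 0 ->
    \int[mu]_(y in B) Ks y A = \int[mu]_(y in B) Kfb y A.
  move=> mA mB muD; apply: ae_eq_integral => //.
  - by apply: measurable_funTS; exact: measurable_kernel.
  - by apply: measurable_funTS; exact: measurable_kernel.
  have : mu.-negligible D by apply/negligibleP.
  apply: negligibleS => y /= h; apply: contrapT => Dy; apply: h => _.
  by rewrite HKs /k memNset.
have [Kap HKap] := ex_kernel_join Ks.
exists Kap; split.
- have [m Hm] := ex_kernel_integral P Kap measurableT.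
  move=> C mC; rewrite -Hm; apply: (rect_measure_unique (i := i)) => // A B mA mB.
  by rewrite Hm HKap// aeKs// -HK.
- have [m Hm] := ex_kernel_integral (nu (~~ i)) Kap measurableT.
  move=> C mC; rewrite -Hm; apply: (rect_measure_unique (i := i)) => // A B mA mB.
  rewrite Hm HKap// (ge0_integral_setwise_add nuE)//; last exact: measurable_kernel.
  by rewrite aeKs// aeKsfb// rhoE ?Hac ?Hs//; exact: measurable_rect.
Qed.

(** * The two implications *)

Section main.
Context (R : realType) (Om : bool -> ptopologicalType)
  (E : set (Om false * Om true))
  (nu : forall b, {finite_measure set (borel (Om b)) -> \bar R}).
Hypotheses (polish_Om : forall b : bool, Defs.polish R (Om b)) (closed_E : closed E).

Lemma level_optimal_universal i (pi rho : {finite_measure set (prodsp Om) -> \bar R}) :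
  refinement E nu i pi -> level_optimal_maximin E nu i pi ->
  refinement E nu (~~ i) rho -> proportional_response E nu i pi rho ->
  universal_closest E nu i pi rho.
Proof.
move=> rpi [r rdens rFit] rrho prop; split=> // D DPI.
have [Kap [Kpi Krho]] := proportional_response_kernel prop.
apply/eqP; rewrite eq_le; apply/andP; split; last first.
  by apply: ereal_inf_lbound; exists (pi, rho).
apply: le_ereal_inf_tmp => _ [[alpha beta] /= [ral rbe] <-].
apply: (le_trans (DPI _ _ _ _ Kap _ _ _ _ Kpi Krho)).
have [||t t0|K [K1 K2]] := @blackwell _ _ (prodsp Om) (borel (Om (~~ i))) R
    alpha beta (marginal (~~ i) pi) (nu (~~ i)) (codable_Om polish_Om (~~ i)).
- transitivity (pi setT); last exact: esym (marginal_setT (~~ i) pi).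
  exact: etrans (esym (marginal_setT i alpha)) (etrans (ral.2 _ measurableT)
    (etrans (esym (rpi.2 _ measurableT)) (marginal_setT i pi))).
- exact: etrans (esym (marginal_setT (~~ i) beta)) (rbe.2 _ measurableT).
- by rewrite -(integral_min_density rdens t0) rFit// meet_mass_le_Fit.
exact: (DPI _ _ _ _ K _ _ _ _ K1 K2).
Qed.

Section converse.
Variables (i : bool) (pi rho : {finite_measure set (prodsp Om) -> \bar R}).
Hypothesis univ : universal_closest E nu i pi rho.

Let P : {finite_measure set (borel (Om (~~ i))) -> \bar R} := marginal (~~ i) pi.
Let nu1 := nu (~~ i).

Let rpi : refinement E nu i pi. Proof. by case: univ. Qed.
Let rrho : refinement E nu (~~ i) rho. Proof. by case: univ. Qed.

(** Sets depending on the far coordinate alone are among the competitors on the product. *)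
Let meet_mass_pi_rho_le t : (0 < t)%R -> meet_mass t pi rho <= meet_mass t P nu1.
Proof.
move=> t0; apply: le_ereal_inf_tmp => _ [A mA <-].
have mA' : measurable (@pr Om (~~ i) @^-1` A) by exact: measurable_pr_preimage.
apply: le_trans (meet_mass_le t pi rho mA') _.
rewrite leeD2l// lee_wpmul2l ?lee_fin ?(ltW t0)//.
have := rrho.2 (~` A) (measurableC mA); rewrite /marginal /pushforward preimage_setC.
by rewrite /nu1 => ->.
Qed.

Let Fit_le t : (0 < t)%R -> Fit E nu i t <= meet_mass t pi rho.
Proof.
move=> t0; apply: (Fit_le_meet_mass polish_Om closed_E t0 rpi rrho).
move=> alpha beta ral rbe; case: univ => _ _.
move=> /(_ _ (meet_divergence_DPI (ltW t0))) h.
have : meet_divergence t pi rho <= meet_divergence t alpha beta.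
  by rewrite h; apply: ereal_inf_lbound; exists (alpha, beta).
by rewrite /meet_divergence leeN2.
Qed.

Let le_Fit t : (0 < t)%R -> meet_mass t P nu1 <= Fit E nu i t.
Proof. by move=> t0; exact: marginal_meet_mass_le_Fit. Qed.

Lemma universal_level_optimal : level_optimal_maximin E nu i pi.
Proof.
have [r hr] := ex_lebesgue_density P nu1.
exists r => // t t0; rewrite (integral_min_density hr t0); apply/eqP.
rewrite eq_le le_Fit//= (le_trans (Fit_le t0))//; exact: meet_mass_pi_rho_le.
Qed.

Let meet_mass_eq t : (0 < t)%R -> meet_mass t pi rho = meet_mass t P nu1.
Proof.
move=> t0; apply/eqP; rewrite eq_le meet_mass_pi_rho_le//=.
exact: le_trans (le_Fit t0) (Fit_le t0).
Qed.

(** The likelihood ratio of pi to pi + rho is a function of the far coordinate, so disintegrating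
    the sum pi + rho gives a kernel that serves pi and rho separately. *)
Lemma universal_proportional_response : proportional_response E nu i pi rho.
Proof.
have [eta etaE] := ex_add_measure P nu1.
have [tau tauE] := ex_add_measure pi rho.
have [|s [ms s01 hs]] := @ex_level_ratio _ _ _ P eta.
  by move=> A mA; rewrite etaE leeDl.
have fin d (T : measurableType d) (mu : {finite_measure set T -> \bar R}) B :
  measurable B -> mu B = (fine (mu B))%:E by move=> mB; rewrite fineK// fin_num_measure.
have rhomarg B : measurable B -> rho (@pr Om (~~ i) @^-1` B) = nu1 B.
  by move=> mB; exact: rrho.2.
(* For 0 < u < 1, {s <= u} is a Hahn set of the far marginals. By equality of the two H_t its
   cylinder attains the infimum for (pi, rho), hence is a Hahn set there. The levels u = 0 and u >=
   1 are direct. *)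
have ratio : level_ratio (s \o @pr Om (~~ i)) pi tau.
  move=> u u0.
  pose A := [set y | s y <= u]%R.
  have mA : measurable A by exact: measurable_le_set.
  have mA' : measurable (@pr Om (~~ i) @^-1` A) by exact: measurable_pr_preimage.
  have setC_lt (B : set (prodsp Om)) :
      B `<=` [set z | u < (s \o @pr Om (~~ i)) z]%R -> B `<=` ~` (@pr Om (~~ i) @^-1` A).
    by move=> Bs z /Bs /=; rewrite ltNge => /negP.
  have [u1|u1] := leP 1%R u.
    split=> B mB Bs.
      apply: (@le_trans _ _ (tau B)); first by rewrite tauE leeDl.
      by rewrite -[leLHS]mul1e lee_wpmul2r.
    rewrite (_ : B = set0) ?measure0 ?mule0//.
    apply/seteqP; split=> // z /Bs /=; rewrite ltNge (le_trans _ u1)//.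
    by case/andP: (s01 (@pr Om (~~ i) z)).
  move: u0; rewrite le_eqVlt => /predU1P[u0|u0].
    split=> B mB Bs; rewrite -u0 mul0e//.
    have PA : P A <= 0.
      by have := (hs 0%R (lexx _)).1 A mA; rewrite mul0e; apply; rewrite /A -u0.
    by apply: le_trans PA; apply: le_measure; rewrite ?inE.
  have u1' : (0 < 1 - u)%R by rewrite subr_gt0.
  have t0 : (0 < u / (1 - u))%R by rewrite divr_gt0.
  have hahnP : P A + (u / (1 - u))%:E * nu1 (~` A) = meet_mass (u / (1 - u)) P nu1.
    apply/esym/meet_mass_hahn => //; first exact: ltW.
    - move=> B mB BA; have := (hs u (ltW u0)).1 B mB BA.
      rewrite etaE (fin _ _ P B mB) (fin _ _ nu1 B mB) -EFinD -!EFinM !lee_fin mulrAC ler_pdivlMr// => h; lra.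
    - move=> B mB BA; have BA' : B `<=` [set y | u < s y]%R.
        by move=> y /BA /= /negP; rewrite -ltNge.
      have := (hs u (ltW u0)).2 B mB BA'.
      rewrite etaE (fin _ _ P B mB) (fin _ _ nu1 B mB) -EFinD -!EFinM !lee_fin mulrAC ler_pdivrMr// => h; lra.
  have eqm : pi (@pr Om (~~ i) @^-1` A) + (u / (1 - u))%:E *
      rho (~` (@pr Om (~~ i) @^-1` A)) = meet_mass (u / (1 - u)) pi rho.
    rewrite meet_mass_eq// -hahnP preimage_setC rhomarg//; exact: measurableC.
  have [h1 h2] := meet_mass_minimizer (ltW t0) mA' eqm.
  split=> B mB Bs; rewrite tauE.
    have := h1 B mB Bs.
    rewrite (fin _ _ pi B mB) (fin _ _ rho B mB) -EFinD -!EFinM !lee_fin mulrAC ler_pdivlMr// => h; lra.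
  have := h2 B mB (setC_lt _ Bs).
  rewrite (fin _ _ pi B mB) (fin _ _ rho B mB) -EFinD -!EFinM !lee_fin mulrAC ler_pdivrMr// => h; lra.
have [|K HK] := disintegration (tau := tau) (eta := eta) (codable_Om polish_Om i)
   (@measurable_pr Om i) (@measurable_pr Om (~~ i)).
  by move=> B mB; rewrite etaE tauE rhomarg.
have mK A : measurable A -> measurable_fun setT (K ^~ A).
  by move=> mA; exact: measurable_kernel.
(* With A fixed, both sides are measures in B with level ratio [s] relative to tau (rect i A B). *)
have HKpi A B : measurable A -> measurable B ->
    pi (rect i A B) = \int[P]_(y in B) K y A.
  move=> mA mB.
  have [|||l1 Hl1] := @ex_density_measure _ (borel (Om (~~ i))) R P (K ^~ A).
  - exact: mK.
  - by [].
  - apply: (@le_lt_trans _ _ (\int[P]_y (cst 1 y))).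
      apply: ge0_le_integral => //; first exact: mK.
      by move=> y _; rewrite /= -(@prob_kernel _ _ _ _ _ K y) le_measure ?inE.
    by rewrite integral_cst// mul1e fmeasure_lty.
  have exl (mu : {finite_measure set (prodsp Om) -> \bar R}) :
      exists m : {finite_measure set (borel (Om (~~ i))) -> \bar R},
      forall B, m B = mu (rect i A B).
    have [|mA' HmA'] := @ex_restr _ _ _ mu (@pr Om i @^-1` A).
      exact: measurable_pr_preimage.
    have [m Hm] := ex_pushforward mA' (@measurable_pr Om (~~ i)).
    by exists m => C; rewrite Hm HmA' setIC.
  have [l2 Hl2] := exl pi.
  have [e He] := exl tau.
  rewrite -Hl2 -Hl1; apply: (level_ratio_unique ms s01 (eta := e)) => // u u0.
  - have [h1 h2] := ratio u u0; split=> C mC Cs; rewrite Hl2 He.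
      by apply: h1; [exact: measurable_rect|move=> z [_ /Cs]].
    by apply: h2; [exact: measurable_rect|move=> z [_ /Cs]].
  - have [h1 h2] := hs u u0; split=> C mC Cs; rewrite Hl1 He HK//.
      apply: le_integral_le_measure => //; last exact: mK.
      by move=> C' mC' C'C; apply: h1 => //; exact: subset_trans C'C Cs.
    apply: ge_integral_ge_measure => //; last exact: mK.
    by move=> C' mC' C'C; apply: h2 => //; exact: subset_trans C'C Cs.
have HKrho A B : measurable A -> measurable B ->
    rho (rect i A B) = \int[nu1]_(y in B) K y A.
  move=> mA mB; have := HK A B mA mB.
  rewrite -/(rect i A B) tauE HKpi// (ge0_integral_setwise_add (m1 := P) (m2 := nu1))//; last first.
    exact: mK.
  have f1 : \int[P]_(y in B) K y A \is a fin_num.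
    by rewrite -HKpi// fin_num_measure//; exact: measurable_rect.
  exact: adde_fin_inj.
have [nuac [nus [nuE nudom nusing]]] := ex_lebesgue_decomposition nu1 P.
have [Kap HKap] := ex_kernel_join K.
have [rhoac Hrhoac] := ex_kernel_integral nuac Kap measurableT.
have [rhos Hrhos] := ex_kernel_integral nus Kap measurableT.
(* [K] is its own fallback, since it disintegrates rho over all of nu. *)
exists K, K, nuac, nus, rhoac, rhos; split.
- by move=> A B mA mB; exact: HKpi.
- by split.
(* Each rectangle of the complement of the edge set is null for rho, so K y (A n) = 0 for almost
   every y in B n; the non-neighbors of y are the union of the A n with y in B n. *)
- have [A [B [mA mB EAB]]] := setC_edges_rect polish_Om closed_E i.
  have aen n : {ae nus, forall y, B n y -> K y (A n) = 0}.
    have z : \int[nu1]_(y in B n) K y (A n) = 0.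
      rewrite -HKrho//; apply/eqP; rewrite eq_le measure_ge0 andbT -rrho.1.
      apply: le_measure; rewrite ?inE.
      + exact: measurable_rect.
      + exact: measurable_setC_edges.
      + by move=> x xAB; rewrite EAB; exists n.
    have z' : \int[nus]_(y in B n) K y (A n) = 0.
      apply/eqP; rewrite eq_le integral_ge0// andbT -z.
      rewrite (ge0_integral_setwise_add nuE)// ?leeDr ?integral_ge0//.
      exact: mK.
    have : ae_eq nus (B n) (fun y => K y (A n)) (cst 0).
      apply/(ae_eq_integral_abs nus (mB n)); first by apply: measurable_funTS; exact: mK.
      by under eq_integral do rewrite gee0_abs//.
    exact.
  have : {ae nus, forall y, forall n, B n y -> K y (A n) = 0} by exact/ae_foralln.
  apply: filterS => y hy.
  have -> : ~` @nbr Om E i y = \bigcup_n (if y \in B n then A n else set0).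
    apply/seteqP; split=> x.
      move=> nE; have : (~` E) (join i (y, x)) by [].
      rewrite EAB => -[n _ [An Bn]]; exists n => //; move: An Bn.
      rewrite /= pr_join pr_neg_join => An Bn.
      by rewrite mem_set.
    move=> [n _]; case: ifPn => // /set_mem yB xA Exy.
    have : (~` E) (join i (y, x)).
      by rewrite EAB; exists n => //; split; rewrite /= ?pr_join ?pr_neg_join.
    exact.
  have mAB n : measurable (if y \in B n then A n else set0).
    by case: ifP.
  apply/negligibleP; first exact: bigcup_measurable.
  apply: negligible_bigcup => n; apply/negligibleP; first exact: mAB.
  by case: ifPn => [/set_mem/hy//|_]; exact: measure0.
- by split=> A B mA mB; rewrite ?Hrhoac ?Hrhos HKap.
- have [m Hm] := ex_add_measure rhoac rhos.
  move=> C mC; rewrite -Hm; apply: (rect_measure_unique (i := i)) => // A B mA mB.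
  rewrite HKrho// (ge0_integral_setwise_add nuE)//; last exact: mK.
  by rewrite Hm Hrhoac Hrhos !HKap.
Qed.

End converse.

(** Swapping the arguments of a divergence preserves channel-DPI. The case analyses on [i] serve to
    reduce the double negation of the side. *)
Lemma universal_closest_sym i (pi rho : {finite_measure set (prodsp Om) -> \bar R}) :
  universal_closest E nu i pi rho -> universal_closest E nu (~~ i) rho pi.
Proof.
move=> [rpi rrho h]; split => //; first by case: i rpi {rrho h}.
move=> D DPI; pose D' : divergence R := fun d T P Q => D d T Q P.
have /h : channel_DPI D'.
  by move=> d d' X Y K P Q KP KQ hP hQ; exact: DPI hQ hP.
rewrite /D' => ->; congr ereal_inf; apply/seteqP; split => _ [[p q] /= [hp hq] <-].
  by exists (q, p) => //; split => //; case: i rpi rrho h hp hq.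
by exists (q, p) => //; split => //; case: i rpi rrho h hp hq.
Qed.

End main.

Theorem theorem1p1 (R : realType) (Om : bool -> ptopologicalType)
    (E : set (Om false * Om true))
    (nu : forall b : bool, {finite_measure set (borel (Om b)) -> \bar R})
    (polish_Om : forall b : bool, polish R (Om b))
    (closed_E : closed E)
    (nbr_neq0 : forall (i : bool) (y : Om (~~ i)), nbr E y !=set0)
    (nu_neq0 : forall b : bool, nu b [set: borel (Om b)] != 0) :
  (forall (i : bool) (pi rho : {finite_measure set (prodsp Om) -> \bar R}),
     refinement E nu i pi ->
     level_optimal_maximin E nu i pi ->
     refinement E nu (~~ i) rho ->
     proportional_response E nu i pi rho ->
     universal_closest E nu i pi rho) /\
  (forall (i : bool) (pi rho : {finite_measure set (prodsp Om) -> \bar R}),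
     universal_closest E nu i pi rho ->
     [/\ level_optimal_maximin E nu i pi,
         level_optimal_maximin E nu (~~ i) rho,
         proportional_response E nu i pi rho &
         proportional_response E nu (~~ i) rho pi]).
Proof.
split=> i pi rho; first exact: level_optimal_universal.
move=> univ; have univ' := universal_closest_sym univ.
split.
- exact: universal_level_optimal polish_Om closed_E _ _ _ univ.
- exact: universal_level_optimal polish_Om closed_E _ _ _ univ'.
- exact: universal_proportional_response polish_Om closed_E _ _ _ univ.
- exact: universal_proportional_response polish_Om closed_E _ _ _ univ'.
Qed.
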